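(* Let $n\ge1$ and let $D$ be a type $D$ diagram with $n+1$ strands and exactly one dot. Let $I(D)\subseteq[1,n+1]$ be the set of positions of its inner-most caps (dotted or not). For $i\in I(D)$ let $D_i$ be the diagram obtained from $D$ by deleting the inner-most cap at position $i$. If the connectivity of $D_i$ is not $\mathbf 1$, let $\mathcal{D}^e_i$ be the set of all type $D$ diagrams with the same connectivity as $D_i$ and an even number of dots, and let $D_i^{\mathrm{odd}}$ be the unique type $D$ diagram with this connectivity and exactly one dot; if the connectivity of $D_i$ is $\mathbf 1$, let $\mathcal{D}^e_i=\{\mathbf 1\}$ and $D_i^{\mathrm{odd}}=\emptyset$, with $\mathrm{coef}_{n-1}(\emptyset)=0$. Then $$\mathrm{coef}_n(D)=\sum_{i\in I(D)}\mathrm{coef}(h_{n,i})\Bigl(\sum_{D'\in\mathcal{D}^e_i}\mathrm{coef}_{n-1}(D')-[2]\,\mathrm{coef}_{n-1}(D_i^{\mathrm{odd}})\Bigr)+\sum_{i\in I(D)}2^{\delta(i\equiv1)}\,\mathrm{coef}(g_{n,i})\,\mathrm{coef}_{n-1}(D_i^{\mathrm{odd}}),$$ where $\delta(i\equiv1)=1$ if $i=1$ and $0$ otherwise.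
   Context: **Algebra.** Work over $\mathbb{C}(q)$ with $[m]=(q^m-q^{-m})/(q-q^{-1})$. $\mathrm{TL}^D_{n+1}$ is the unital algebra generated by $E_0,\dots,E_n$ with relations $E_i^2=-[2]E_i$; $E_iE_jE_i=E_i$ if $i,j$ are adjacent; $E_iE_j=E_jE_i$ if $i\neq j$ are not adjacent, where adjacency is in the graph on $\{0,\dots,n\}$ with edges $\{0,2\},\{1,2\}$ and $\{i,i+1\}$ for $2\le i\le n-1$. For $m\le n$, $\mathrm{TL}^D_{m+1}$ is the subalgebra generated by $E_0,\dots,E_m$. $Q_n\in\mathrm{TL}^D_{n+1}$ is the unique element with $Q_n\ne0$, $Q_nQ_i=Q_iQ_n=Q_n$ for $0\le i\le n$, and $E_iQ_n=Q_nE_i=0$ for $0\le i\le n$. A word (product of generators) is reduced if it is not a scalar multiple of a shorter word; the distinct elements given by reduced words form a basis. **Diagrams.** An $N$-strand connectivity is a non-crossing pairing by $N$ strands of $N$ bottom and $N$ top marked points of a rectangle. Label the bottom points $1,\dots,N$ from left to right and the top points $N+1,\dots,2N$ from right to left; the strands become non-crossing chords on $\{1,\dots,2N\}$. The identity connectivity $\mathbf 1$ has chords $\{k,2N+1-k\}$. A chord is outer if it is not nested inside another chord. A type $D$ diagram is a connectivity with some chords dotted (at most one dot per chord) such that either the number of dots is even (possibly zero) and all dotted chords are outer, or there is exactly one dot, it is on the chord containing the point $1$, and the connectivity is not $\mathbf 1$. For $i\ge1$, $E_i$ is the undotted diagram with a cap joining the $i$-th and $(i+1)$-th bottom points, a cup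 joining the $i$-th and $(i+1)$-th top points, and vertical strands elsewhere; $E_0$ has the connectivity of $E_1$ with both its cap and its cup dotted. The diagram of a reduced word is obtained by stacking (left factor on top), deleting loops carrying a single dot, and, if the resulting number of dots is odd, moving the unique dot to the chord containing the point $1$. For $n\ge1$ this identifies the basis of reduced words of $\mathrm{TL}^D_{n+1}$ with the $(n+1)$-strand type $D$ diagrams. $\mathrm{coef}_n(D)$ is the coefficient in $Q_n$ of the basis element with diagram $D$; the only $1$-strand diagram is $\mathbf 1$, with $\mathrm{coef}_0(\mathbf 1)=1$. **Inner-most caps.** For an $(n+1)$-strand diagram, there is an inner-most cap at position $i\in[1,n+1]$ if $\{i,i+1\}$ is a chord (for $i=n+1$ this is the vertical strand joining the right-most bottom and top points). Deleting it means deleting this chord and relabelling the remaining $2n$ points increasingly by $1,\dots,2n$, giving an $n$-strand diagram (only its connectivity is used). **Coefficients.** $\mathrm{coef}(g_{n,1})=\frac{[n]}{[2n]}$, $\mathrm{coef}(g_{n,i})=\frac{[n][2i-2]}{[2n][i-1]}$ for $2\le i\le n+1$, and $\mathrm{coef}(h_{n,i})=\frac{[n][n+1-i]}{[2n][n+1]}$ (so $\mathrm{coef}(h_{n,n+1})=0$). *)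

(* Defs.v *)
From HB Require Import structures.
From mathcomp Require Import all_boot all_order all_algebra.
From mathcomp Require Import boolp.
From mathcomp Require classical_sets.
From mathcomp Require Import generic_quotient ring_quotient.
From mathcomp Require Import monalg.

Set Implicit Arguments.
Unset Strict Implicit.
Unset Printing Implicit Defensive.

Import GRing.Theory.
Local Open Scope ring_scope.

(* The 2(n+1) marked points of an (n+1)-strand diagram.  The ordinal p is the
   point labelled p+1: ordinals 0..n are the bottom points from left to right,
   ordinals n+1..2n+1 the top points from right to left, so that [rev_ord]
   exchanges a bottom point with the top point vertically above it. *)
Notation point n := 'I_(n.*2.+2).

(* A connectivity is given by the map sending a point to its partner. *)
Notation conn n := {ffun point n -> point n}.

(* A diagram is a connectivity together with the set of the left end-points
   (i.e. the end-points with the smaller label) of its dotted chords. *)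
Notation diag n := (conn n * {set point n})%type.

Definition is_conn n (c : conn n) : bool :=
  [&& [forall a, c a != a], [forall a, c (c a) == a] &
      [forall a : point n, [forall b : point n,
         ~~ [&& (a < b)%N, (b < c a)%N & (c a < c b)%N]]]].

Definition conn1 n : conn n := [ffun p => rev_ord p].

Definition outer n (c : conn n) (p : point n) : bool :=
  [forall a : point n, ~~ ((a < p)%N && (c p < c a)%N)].

Definition typeD n (D : diag n) : bool :=
  [&& is_conn D.1, [forall p in D.2, (p < D.1 p)%N] &
      (~~ odd #|D.2| && [forall p in D.2, outer D.1 p])
      || ((D.2 == [set ord0]) && (D.1 != conn1 n))].

Definition diag1 n : diag n := (conn1 n, set0).

(* The points a and b are the two ends of the cap of E_i; the left end of its
   cup is [rev_ord b]. *)
Definition gen_diag n (i : 'I_n.+1) : diag n :=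
  let b : point n := inord (maxn i 1) in
  let a : point n := inord (maxn i 1).-1 in
  ([ffun p => if p == a then b else if p == b then a
              else if rev_ord p == a then rev_ord b
              else if rev_ord p == b then rev_ord a else rev_ord p],
   if i == ord0 then [set a; rev_ord b] else set0).

Section Stack.
Variables (n : nat) (X Y : diag n).

(* Stacking X on top of Y: [inl p] is the point p of X and [inr p] the point p
   of Y; the bottom points of X are glued to the top points of Y. *)
Definition stack_edge : rel (point n + point n) := fun u v =>
  match u, v with
  | inl a, inl b => b == X.1 a
  | inr a, inr b => b == Y.1 a
  | inl a, inr b => (a <= n)%N && (b == rev_ord a)
  | inr b, inl a => (a <= n)%N && (b == rev_ord a)
  end.

Definition stack_end (p : point n) : point n + point n :=
  if (p <= n)%N then inr p else inl p.

Definition stack_conn : conn n :=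
  [ffun p => odflt p
     [pick r | (r != p) && connect stack_edge (stack_end p) (stack_end r)]].

(* Two dots on the same strand cancel. *)
Definition stack_dotted (p : point n) : bool :=
  odd (#|[set a in X.2 | connect stack_edge (stack_end p) (inl a)]| +
       #|[set a in Y.2 | connect stack_edge (stack_end p) (inr a)]|).

Definition stack : diag n :=
  (stack_conn, [set p : point n | (p < stack_conn p)%N && stack_dotted p]).

End Stack.

(* The letters of a word are listed from left (top) to right (bottom).  Loops
   are discarded by [stack], and the point labelled 1 is [ord0]. *)
Definition word_diag n (w : seq 'I_n.+1) : diag n :=
  let D := foldr (fun i => stack (gen_diag i)) (diag1 n) w in
  if odd #|D.2| then (D.1, [set ord0]) else D.

(* Here i is a label in [1, n+1], so that the points labelled i and i+1 are the
   ordinals i-1 and i. *)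
Definition innermost n (c : conn n) (i : nat) : bool :=
  [exists p : point n, (val p == i.-1) && (val (c p) == i)].

(* [skip i] is the increasing map whose image misses the points labelled i and
   i+1, and [unskip i] is its inverse. *)
Definition skip (i a : nat) : nat := if (a < i.-1)%N then a else a.+2.
Definition unskip (i a : nat) : nat := if (a < i.-1)%N then a else a.-2.

Definition delete_cap n (c : conn n) (i : nat) : conn n.-1 :=
  [ffun a : point n.-1 => inord (unskip i (c (inord (skip i a))))].

Definition even_diags n (c : conn n) : {set diag n} :=
  if c == conn1 n then [set diag1 n]
  else [set D : diag n | [&& typeD D, D.1 == c & ~~ odd #|D.2|]].

Definition odd_diag n (c : conn n) : option (diag n) :=
  if c == conn1 n then None else Some (c, [set ord0]).

Definition qint (F : fieldType) (q : F) (m : nat) : F :=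
  (q ^+ m - q ^- m) / (q - q^-1).

Definition edgeD (i j : nat) : bool :=
  [|| (i == 0) && (j == 2) | (0 < i) && (j == i.+1)]%N.

Definition adjD (i j : nat) : bool := edgeD i j || edgeD j i.

Section Algebra.
Variables (F : fieldType) (q : F) (n : nat).

Definition freeD := {malg F[{fmonom 'I_n.+1}]}.
HB.instance Definition _ := GRing.Lalgebra.on freeD.

Definition freeGen (i : 'I_n.+1) : freeD := << fmu i >>.

(* The two-sided ideal generated by the relations; it is stable under scaling
   because c *: x = (c *: 1) * x. *)
Inductive relD : freeD -> Prop :=
| relD_sq i : relD (freeGen i * freeGen i + qint q 2 *: freeGen i)
| relD_adj (i j : 'I_n.+1) : adjD i j ->
    relD (freeGen i * freeGen j * freeGen i - freeGen i)
| relD_comm (i j : 'I_n.+1) : i != j -> ~~ adjD i j ->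
    relD (freeGen i * freeGen j - freeGen j * freeGen i)
| relD0 : relD 0
| relDD x y : relD x -> relD y -> relD (x + y)
| relDMl x y : relD y -> relD (x * y)
| relDMr x y : relD x -> relD (x * y).

Definition idealD : {pred freeD} := fun x => `[< relD x >].

Lemma idealDP x : reflect (relD x) (x \in idealD).
Proof. exact: asboolP. Qed.

Lemma idealD_zmod : zmod_closed idealD.
Proof.
split=> [|x y /idealDP xI /idealDP yI]; apply/idealDP; first exact: relD0.
by apply: relDD => //; rewrite -mulN1r; exact: relDMl.
Qed.

HB.instance Definition _ := GRing.isZmodClosed.Build freeD idealD idealD_zmod.

Lemma idealDMl x y : y \in idealD -> x * y \in idealD.
Proof. by move=> /idealDP yI; apply/idealDP; exact: relDMl. Qed.

Lemma idealDMr x y : x \in idealD -> x * y \in idealD.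
Proof. by move=> /idealDP yI; apply/idealDP; exact: relDMr. Qed.

Lemma idealDZ c x : x \in idealD -> c *: x \in idealD.
Proof. by move=> xI; rewrite -[x]mul1r scalerAl; exact: idealDMl. Qed.

Lemma idealD1 : 1 \notin idealD.
Proof.
pose f (x : freeD) := @mcoeff {fmonom 'I_n.+1} F mone x.
have fM x y : f (x * y) = f x * f y by exact: rmorphM.
have fB x y : f (x - y) = f x - f y by exact: raddfB.
have fD x y : f (x + y) = f x + f y by exact: raddfD.
have fZ c x : f (c *: x) = c * f x by exact: mcoeffZ.
have fE i : f (freeGen i) = 0.
  by rewrite /f /freeGen mcoeffU1 fmP /= fm1 fmuE.
apply/negP=> /idealDP I1.
have : f 1 = 0.
  elim: I1 => [i|i j _|i j _ _||x y _ fx _ fy|x y _ fy|x y _ fx].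
  - by rewrite fD fM fZ !fE !mulr0 addr0.
  - by rewrite fB !fM !fE mul0r mul0r subr0.
  - by rewrite fB !fM !fE mulr0 subr0.
  - exact: raddf0.
  - by rewrite fD fx fy addr0.
  - by rewrite fM fy mulr0.
  - by rewrite fM fx mul0r.
by rewrite /f mcoeff1 eqxx => /eqP; rewrite oner_eq0.
Qed.

(* Two-sided ideals are not covered by the library's quotient rings, so only
   the additive structure of the quotient is inherited. *)
Definition TLD : Type := Quotient.quot idealD.
HB.instance Definition _ := GRing.Zmodule.on TLD.

Definition piD (x : freeD) : TLD := (\pi_(Quotient.quot idealD) x)%qT.

Lemma piD_eq x y : (piD x == piD y) = (x - y \in idealD).
Proof. by rewrite -Quotient.idealrBE. Qed.

Lemma piDP x y : reflect (piD x = piD y) (x - y \in idealD).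
Proof. by rewrite -piD_eq; exact: eqP. Qed.

Lemma piD_repr (x : TLD) : piD (repr x) = x.
Proof. exact: reprK. Qed.

Lemma piDD x y : piD (x + y) = piD x + piD y.
Proof. exact: (raddfD \pi_(Quotient.quot idealD)%qT). Qed.

Definition mulD (x y : TLD) : TLD := piD (repr x * repr y).

Definition scaleD (c : F) (x : TLD) : TLD := piD (c *: repr x).

Lemma piDM x y : piD (x * y) = mulD (piD x) (piD y).
Proof.
apply/piDP; rewrite -[x * y](subrK (repr (piD x) * y)) -mulrBl -addrA -mulrBr.
apply: (rpredD (idealDMr _ _) (idealDMl _ _)); by apply/piDP; rewrite piD_repr.
Qed.

Lemma piDZ c x : piD (c *: x) = scaleD c (piD x).
Proof.
by apply/piDP; rewrite -scalerBr; apply/idealDZ/piDP; rewrite piD_repr.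
Qed.

Fact mulDA : associative mulD.
Proof.
by move=> x y z; rewrite -[x]piD_repr -[y]piD_repr -[z]piD_repr -!piDM mulrA.
Qed.

Fact mul1D : left_id (piD 1) mulD.
Proof. by move=> x; rewrite -[x]piD_repr -piDM mul1r. Qed.

Fact mulD1 : right_id (piD 1) mulD.
Proof. by move=> x; rewrite -[x]piD_repr -piDM mulr1. Qed.

Fact mulDDl : left_distributive mulD +%R.
Proof.
move=> x y z; rewrite -[x]piD_repr -[y]piD_repr -[z]piD_repr.
by rewrite -piDD -!piDM mulrDl piDD.
Qed.

Fact mulDDr : right_distributive mulD +%R.
Proof.
move=> x y z; rewrite -[x]piD_repr -[y]piD_repr -[z]piD_repr.
by rewrite -piDD -!piDM mulrDr piDD.
Qed.

Fact oneD_neq0 : piD 1 != 0.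
Proof.
rewrite -[0]piD_repr piD_eq; apply/negP => h.
have h0 : repr (0 : TLD) \in idealD.
  rewrite -[repr _]subr0; apply/piDP; rewrite piD_repr.
  by apply/esym; exact: (raddf0 \pi_(Quotient.quot idealD)%qT).
by move: idealD1; rewrite -(subrK (repr (0 : TLD)) 1) rpredD.
Qed.

HB.instance Definition _ := GRing.Zmodule_isNzRing.Build TLD
  mulDA mul1D mulD1 mulDDl mulDDr oneD_neq0.

Fact scaleDA a b x : scaleD a (scaleD b x) = scaleD (a * b) x.
Proof. by rewrite -[x]piD_repr -!piDZ scalerA. Qed.

Fact scale1D : left_id 1 scaleD.
Proof. by move=> x; rewrite -[x]piD_repr -piDZ scale1r. Qed.

Fact scaleDDr : right_distributive scaleD +%R.
Proof.
move=> a x y; rewrite -[x]piD_repr -[y]piD_repr.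
by rewrite -piDD -!piDZ scalerDr piDD.
Qed.

Fact scaleDDl x : {morph scaleD^~ x : a b / a + b}.
Proof. by move=> a b; rewrite -[x]piD_repr -!piDZ scalerDl piDD. Qed.

HB.instance Definition _ := GRing.Zmodule_isLmodule.Build F TLD
  scaleDA scale1D scaleDDr scaleDDl.

Fact scaleDAl (a : F) (x y : TLD) : a *: (x * y) = (a *: x) * y.
Proof.
rewrite -[x]piD_repr -[y]piD_repr.
by rewrite -[LHS]/(scaleD a (mulD _ _)) -[RHS]/(mulD (scaleD a _) _)
           -piDM -!piDZ -piDM scalerAl.
Qed.

HB.instance Definition _ := GRing.Lmodule_isLalgebra.Build F TLD scaleDAl.

Fact freeD_scaleAr (a : F) (x y : freeD) : a *: (x * y) = x * (a *: y).
Proof.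
have aC z : a *: z = z * malgC a.
  rewrite -mul_malgC !malgM_def fgmulUg fgmulgU; apply: eq_bigr => m _.
  by rewrite mulrC mul1m mulm1.
by rewrite !aC mulrA.
Qed.

Fact scaleDAr (a : F) (x y : TLD) : a *: (x * y) = x * (a *: y).
Proof.
rewrite -[x]piD_repr -[y]piD_repr.
by rewrite -[LHS]/(scaleD a (mulD _ _)) -[RHS]/(mulD _ (scaleD a _))
           -piDM -!piDZ -piDM freeD_scaleAr.
Qed.

HB.instance Definition _ := GRing.Lalgebra_isAlgebra.Build F TLD scaleDAr.

Definition genE (i : 'I_n.+1) : TLD := piD (freeGen i).

Definition word (w : seq 'I_n.+1) : TLD := \prod_(i <- w) genE i.

Definition reduced (w : seq 'I_n.+1) : Prop :=
  forall (w' : seq 'I_n.+1) (c : F),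
    (size w' < size w)%N -> word w <> c *: word w'.

(* TL^D_{m+1} as the subalgebra of TL^D_{n+1} generated by E_0, ..., E_m. *)
Inductive subTLD (m : nat) : TLD -> Prop :=
| subTLD_gen (i : 'I_n.+1) : (i <= m)%N -> subTLD m (genE i)
| subTLD_one : subTLD m 1
| subTLD_lin (c : F) x y : subTLD m x -> subTLD m y -> subTLD m (c *: x + y)
| subTLD_mul x y : subTLD m x -> subTLD m y -> subTLD m (x * y).

(* The defining properties of (Q_0, ..., Q_n), all viewed in TL^D_{n+1}. *)
Definition is_projectors (Q : {ffun 'I_n.+1 -> TLD}) : Prop :=
  forall m : 'I_n.+1,
    [/\ subTLD m (Q m), Q m != 0,
        forall i : 'I_n.+1, (i <= m)%N -> Q m * Q i = Q m /\ Q i * Q m = Q m &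
        forall i : 'I_n.+1, (i <= m)%N -> genE i * Q m = 0 /\ Q m * genE i = 0].

Definition projector : TLD := classical_sets.xget 0 is_projectors ord_max.

Definition basis_elt (D : diag n) : TLD :=
  classical_sets.xget 0
    (fun x => exists w, [/\ reduced w, word_diag w = D & x = word w]).

Definition is_coords (x : TLD) (c : {ffun diag n -> F}) : Prop :=
  x = \sum_(D : diag n | typeD D) c D *: basis_elt D.

(* For n = 0 the identification of diagrams with basis elements breaks down,
   and coef_0 is set to 1 on the unique 1-strand diagram. *)
Definition coef (D : diag n) : F :=
  if n == 0%N then 1 else classical_sets.xget 0 (is_coords projector) D.

End Algebra.

Arguments genE {F q n}.
Arguments coef {F} q n.

Definition coefg (F : fieldType) (q : F) (n i : nat) : F :=
  if i == 1%N then qint q n / qint q (2 * n)%N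
  else (qint q n * qint q (2 * i - 2)%N) / (qint q (2 * n)%N * qint q (i - 1)%N).

Definition coefh (F : fieldType) (q : F) (n i : nat) : F :=
  (qint q n * qint q (n + 1 - i)%N) / (qint q (2 * n)%N * qint q (n + 1)%N).

(* Main.v *)
Require Import Defs.
From mathcomp Require Import all_boot all_order all_algebra.
From mathcomp Require Import reals complex.
From HB Require Import structures.
From mathcomp Require Import boolp zify ring.
From mathcomp Require Import generic_quotient ring_quotient finmap monalg.
From mathcomp Require classical_sets.

(** The projector Q_n is obtained from Q_(n-1) by one multiplication. Let R be the
    combination of the words E_n ... E_i for 2 <= i <= n + 1, with coefficients
    g_(n,i), of E_n ... E_2 E_1 and E_n ... E_2 E_0, both with coefficient
    g_(n,1), and of E_n ... E_2 E_1 E_0 E_2 ... E_i for 1 <= i <= n, with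
    coefficients h_(n,i) (clasp). If P is killed from the right by E_0, ...,
    E_(n-1), then multiplying P R by E_j gives a combination of the same words,
    whose coefficients vanish by three-term recurrences for quantum integers
    (clasp_kill). So Q_(n-1) R is killed from the right by all generators; such
    an element is its own mirror image and is unique up to a scalar, whence
    Q_n = Q_(n-1) R (projector_rec).

    To read off coefficients, let the algebra act on the free module on the type D
    diagrams, a generator capping two neighbouring top points, and let phi x be
    the image of the identity diagram under x. Left multiplication takes place at
    the top and right multiplication at the bottom of diagrams; they commute, so
    that right multiplication by E_j is capping at the bottom (phi_mulr). A diagram
    of Q_(n-1), seen in rank n, has a vertical strand on the right. Multiplication
    by E_n, ..., E_i turns this strand into an undotted innermost cap at position i
    (phi_run); in the odd words, E_0 moreover makes the diagram odd, and closes a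
    loop of value -[2] if it was odd before (phi_odd_run). Hence a diagram D with
    one dot is obtained from the diagrams with connectivity D_i: through the word
    E_n ... E_i from the odd one, and through the odd word from all of them. At
    i = 1 the words ending in E_1 and in E_0 have the same effect on odd diagrams,
    which explains the factor 2. This is the recursion, for the coordinates of
    phi Q_n (coef_odd).

    It remains to see that phi computes coordinates in the basis of reduced words.
    Stacking the generators of a word gives the diagram of the word in the module,
    as long as no undotted loop is closed (word_diag_state); a reduced word closes
    none (reduced_loops), and every diagram is the diagram of a word (good_reach).
    All this relies on the injectivity of phi (phi_inj), proved by induction on the
    rank. The left ideal generated by E_n is the sum of A E_n, where A is the
    algebra of rank n - 1, and of the line of z_n = E_n ... E_1 E_0 E_2 ... E_n
    (sub_alg_left_ideal). On diagrams, its elements are a cap at position n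
    inserted in diagrams of rank n - 1, for which phi is injective by induction, or
    in an odd identity connectivity for z_n. Therefore the kernel of phi is killed
    by E_n from the right, and then, by the relations E_j E_i E_j = E_j, by all
    generators. But an x with this property is a multiple of Q_n, the factor being
    the coordinate of phi x at the identity diagram, which is 0. *)

Set Implicit Arguments.
Unset Strict Implicit.
Unset Printing Implicit Defensive.

Import GRing.Theory.

(** * Dotted matchings and cap-cup pairs *)

Section Matching.
Variable T : finType.

(** A matching of the points with dots, recorded at both ends of their chords.
    The last dot of an odd diagram may be moved to any chord, so that only the
    matching is kept: None. *)
Definition state : predArgType := ({ffun T -> T} * option {ffun T -> bool})%type.

Definition wf_conn (c : {ffun T -> T}) := forall a, c (c a) = a /\ c a <> a.

Definition wf_state (s : state) :=
  wf_conn s.1 /\ (forall t, s.2 = Some t -> forall p, t (s.1 p) = t p).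

(** Multiplication by a cap-cup pair at a and b: the cap joins the partners of a
    and b, the cup is the new chord {a, b}. *)
Definition joinc (a b : T) (c : {ffun T -> T}) : {ffun T -> T} :=
  [ffun p => if p == a then b else if p == b then a
             else if c p == a then c b else if c p == b then c a else c p].

Definition joint (a b : T) (d : bool) (c : {ffun T -> T}) (t : {ffun T -> bool}) :
    {ffun T -> bool} :=
  [ffun p => if (p == a) || (p == b) then d
             else if (c p == a) || (c p == b) then t a (+) t b (+) d else t p].

(** If a and b form a chord, the cap closes it to a loop with the dots of t a and
    of d. Two dots cancel, and the cup restores the chord; a single dot is
    deleted with the loop, and the number of dots becomes odd. *)
Definition dots_after (a b : T) (d : bool) (s : state) : option {ffun T -> bool} :=
  if s.1 a == b then
    if s.2 is Some t then if t a == d then Some t else None else None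
  else omap (joint a b d s.1) s.2.

Definition cup (a b : T) (d : bool) (s : state) : state :=
  (joinc a b s.1, dots_after a b d s).

(** The undotted loops, each worth a factor -[2]; the last dot of an odd diagram
    can be moved away from a loop. *)
Definition loop (a b : T) (d : bool) (s : state) : bool :=
  (s.1 a == b) && (if s.2 is Some t then t a == d else true).

(* The relations below hold pointwise: each is a case analysis on the
   coincidences between a point, its partner and the points of the caps. *)
Ltac no_if x := lazymatch x with
  | context[if _ then _ else _] => fail | context[joint] => fail | _ => idtac end.
Ltac dec_step :=
  match goal with
  | |- context[?x == ?y] => no_if x; no_if y; case: (eqVneq x y) => [?|/eqP ?]
  end; rewrite /=; try (exfalso; congruence).
Ltac dec_all := repeat dec_step.
Ltac bool_all := repeat match goal with
  | |- context[@fun_of_fin ?U ?V ?ph ?t ?x] => no_if x;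
      let W := eval cbv beta in (V x) in
      lazymatch W with bool => let E := fresh in case E: (@fun_of_fin U V ph t x) end
  end;
  rewrite /=; try congruence.

Section Relations.
Variables (c : {ffun T -> T}).
Hypothesis wc : wf_conn c.
Let cK x : c (c x) = x. Proof. by case: (wc x). Qed.
Let cN x : c x <> x. Proof. by case: (wc x). Qed.

Lemma joinc_wf a b : a <> b -> wf_conn (joinc a b c).
Proof.
move=> ab p; rewrite /joinc.
have := @cK a; have := @cK b; have := @cK p.
have := @cN a; have := @cN b; have := @cN p => *.
split; rewrite !ffunE; dec_all; try congruence.
Qed.

Lemma joincC a b : a <> b -> joinc a b c = joinc b a c.
Proof.
move=> ab; apply/ffunP => p; rewrite !ffunE.
have := @cK a; have := @cK b; have := @cK p => *.
dec_all; try congruence.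
Qed.

Lemma joinc_id a b : c a = b -> joinc a b c = c.
Proof.
move=> ab; apply/ffunP => p; rewrite !ffunE.
have := @cK a; have := @cK p => *.
dec_all; try congruence.
Qed.

Lemma joinc_zigzag a b e : b <> e -> a <> e -> c a = b ->
  joinc a b (joinc b e c) = c.
Proof.
move=> be ae ab; apply/ffunP => p; rewrite !ffunE.
have := @cK a; have := @cK b; have := @cK p; have := @cK e => *.
have := @cN a; have := @cN b; have := @cN p => *.
dec_all; try congruence.
Qed.

Lemma joinc_comm a b e f : a <> b -> e <> f -> a <> e -> a <> f -> b <> e -> b <> f ->
  joinc a b (joinc e f c) = joinc e f (joinc a b c).
Proof.
move=> ab ef ae af be bf; apply/ffunP => p; rewrite !ffunE.
have := @cK a; have := @cK b; have := @cK p; have := @cK e; have := @cK f => *.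
dec_all; try congruence.
Qed.

Variable t : {ffun T -> bool}.
Hypothesis wt : forall p, t (c p) = t p.

Lemma joint_wf a b d p : a <> b -> c a <> b ->
  joint a b d c t (joinc a b c p) = joint a b d c t p.
Proof.
move=> ab cab; rewrite !ffunE.
have := @cK a; have := @cK b; have := @cK p => *.
have := @cN a; have := @cN b; have := @cN p => *.
have := @wt a; have := @wt b; have := @wt p => *.
dec_all; bool_all.
Qed.

Lemma jointC a b d : a <> b -> joint a b d c t = joint b a d c t.
Proof.
move=> ab; apply/ffunP => p; rewrite !ffunE.
by rewrite orbC [(c p == a) || _]orbC [t a (+) _]addbC.
Qed.

Lemma joint_zigzag a b e d' : b <> e -> a <> e -> c a = b ->
  joint a b (t a) (joinc b e c) (joint b e d' c t) = t.
Proof.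
move=> be ae ab; apply/ffunP => p; rewrite !ffunE.
have := @cK a; have := @cK b; have := @cK p; have := @cK e => *.
have := @wt a; have := @wt b; have := @wt p; have := @wt e => *.
have := @cN a; have := @cN b; have := @cN p => *.
dec_all; bool_all; by case: (d').
Qed.

Lemma joint_comm a b e f d d' : a <> b -> e <> f -> a <> e -> a <> f -> b <> e -> b <> f ->
  c a <> b -> c e <> f -> joinc e f c a <> b ->
  joint a b d (joinc e f c) (joint e f d' c t) =
  joint e f d' (joinc a b c) (joint a b d c t).
Proof.
move=> ab ef ae af be bf cab cef; rewrite ffunE => cab'; apply/ffunP => p; rewrite !ffunE.
have := @cK a; have := @cK b; have := @cK p; have := @cK e; have := @cK f => *.
have := @wt a; have := @wt b; have := @wt p; have := @wt e; have := @wt f => *.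
have := @cN a; have := @cN b; have := @cN p => *.
move: cab'; dec_all; move=> ?; try congruence; bool_all; by case: (d); case: (d').
Qed.

End Relations.

Variable s : state.
Hypothesis ws : wf_state s.

Lemma cup_wf a b d : a <> b -> wf_state (cup a b d s).
Proof.
case: s ws => c ot [/= wc wt] ab; split; first exact: joinc_wf.
move=> t; rewrite /= /dots_after /=; case: eqP => [cab|cab].
  by case: ot wt => // t' wt; case: eqP => // _ [<-] p; rewrite joinc_id // wt.
case: ot wt => // t' wt [<-] p.
by apply: joint_wf => //; exact: wt.
Qed.

Lemma cup_at a b d : (cup a b d s).1 a = b.
Proof. by rewrite /= ffunE eqxx. Qed.

Lemma cup_dot a b d t : (cup a b d s).2 = Some t -> t a = d.
Proof.
rewrite /= /dots_after; case: eqP => _; case: s.2 => //= t'.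
  by case: eqP => // <- [<-].
by move=> [<-]; rewrite ffunE eqxx.
Qed.

Lemma cupC a b d : a <> b -> cup a b d s = cup b a d s.
Proof.
case: s ws => c ot [/= wc wt] ab; rewrite /cup joincC //; congr pair.
rewrite /dots_after /=.
have -> : (c a == b) = (c b == a).
  by apply/eqP/eqP => <-; case: (wc a); case: (wc b).
case: eqP => [cba|_]; last by case: ot {wt} => //= t; rewrite jointC.
by case: ot wt => // t wt; rewrite -(wt t erefl b) cba.
Qed.

Lemma loopC a b d : a <> b -> loop a b d s = loop b a d s.
Proof.
case: s ws => c ot [/= wc wt] ab; rewrite /loop /=.
have -> : (c a == b) = (c b == a).
  by apply/eqP/eqP => <-; case: (wc a); case: (wc b).
case: eqP => //= cba.
by case: ot wt => // t wt; rewrite -(wt t erefl b) cba.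
Qed.

Lemma cup_id a b d : loop a b d s -> cup a b d s = s.
Proof.
case: s ws => c ot [/= wc wt]; rewrite /loop /cup /dots_after /= => /andP[/eqP cab].
rewrite joinc_id // cab eqxx; case: ot {wt} => //= t; by move=> ->.
Qed.

Lemma cup_comm a b e f d d' : a <> b -> e <> f -> a <> e -> a <> f -> b <> e -> b <> f ->
  cup a b d (cup e f d' s) = cup e f d' (cup a b d s).
Proof.
case: s ws => c ot [/= wc wt] ab ef ae af be bf.
rewrite /cup joinc_comm //; congr pair.
case: ot wt => [t|] wt; last by rewrite /dots_after /= !if_same.
have H := @joint_comm c wc t (wt t erefl) a b e f d d' ab ef ae af be bf.
rewrite /dots_after /=.
case: (wc a) (wc b) (wc e) (wc f) => aK aN [bK bN] [eK eN] [fK fN].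
move: (wt t erefl a) (wt t erefl b) (wt t erefl e) (wt t erefl f) => *.
rewrite !ffunE; dec_all; rewrite ?ffunE; dec_all; try by [].
all: try by congr Some; apply: H => //; rewrite ffunE; dec_all; congruence.
all: clear H; try congr Some; try (apply/ffunP => p; have := wt t erefl p;
  case: (wc p) => pK pN wtp; rewrite !ffunE; dec_all).
all: repeat match goal with H : context[addb] |- _ => move: H end.
all: try by bool_all; case: (d); case: (d').
Qed.

Lemma loop_comm a b e f d d' : a <> b -> e <> f -> a <> e -> a <> f -> b <> e -> b <> f ->
  loop e f d' s + loop a b d (cup e f d' s) = loop a b d s + loop e f d' (cup a b d s).
Proof.
case: s ws => c ot [/= wc wt] ab ef ae af be bf.
case: (wc a) (wc b) (wc e) (wc f) => aK aN [bK bN] [eK eN] [fK fN].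
case: ot wt => [t|] wt; rewrite /loop /cup /dots_after /= !ffunE.
  move: (wt t erefl a) (wt t erefl b) (wt t erefl e) (wt t erefl f) => *.
  dec_all; rewrite ?ffunE; dec_all; try by [].
  all: repeat match goal with H : context[addb] |- _ => move: H end.
  all: try by bool_all; case: (d); case: (d').
all: dec_all; rewrite ?if_same; dec_all; by [].
Qed.

(** Straightening: the chord {a, b} is moved to {b, e} and back, and no loop is
    closed on the way. *)
Lemma zigzag a b e d d' : a <> b -> b <> e -> a <> e -> s.1 a = b ->
    (forall t, s.2 = Some t -> t a = d) ->
  [/\ cup a b d (cup b e d' s) = s, loop b e d' s = false
    & loop a b d (cup b e d' s) = false].
Proof.
case: s ws => c ot [/= wc wt] ab be ae cab ta.
case: (wc a) (wc b) (wc e) => aK aN [bK bN] [eK eN].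
have cb : c b = a by rewrite -cab aK.
have c'a : joinc b e c a <> b by rewrite !ffunE; dec_all; congruence.
have ncb : (c b == e) = false by apply/eqP; congruence.
rewrite /loop /cup /dots_after /= joinc_zigzag // ncb (negPf (introN eqP c'a)).
split=> //; congr pair; case: ot wt ta => //= t wt ta; congr Some.
by rewrite -(ta t erefl); apply: joint_zigzag => //; exact: wt.
Qed.

(** The dotted and the undotted pair at the same place commute, as both products
    close a loop with a single dot: they are odd, with the same matching. *)
Lemma cup_swap a b d d' : a <> b ->
  cup a b d (cup a b d' s) = cup a b d' (cup a b d s) /\
  loop a b d' s + loop a b d (cup a b d' s) = loop a b d s + loop a b d' (cup a b d s).
Proof.
have [->//|dd' ab] := eqVneq d d'.
have H u v : u != v -> cup a b u (cup a b v s) = (joinc a b s.1, None) /\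
    loop a b u (cup a b v s) = ((cup a b v s).2 == None).
  move=> uv; have := cup_wf v ab; have := @cup_at a b v; have := @cup_dot a b v.
  have -> : joinc a b s.1 = (cup a b v s).1 by [].
  case: (cup a b v s) => c ot /= dot cab [/= wc _].
  rewrite /cup /loop /dots_after /= cab eqxx joinc_id //=.
  by case: ot dot => //= t /(_ t erefl) ->; rewrite eq_sym (negPf uv).
have [-> ->] := H d d' dd'; have [] := H d' d; first by rewrite eq_sym.
move=> -> ->; split=> //.
rewrite /loop /cup /dots_after /=; case: eqP => _ /=; last by case: s.2.
case: s.2 => //= t; move: dd'; case: (t a); case: (d); by case: (d').
Qed.

End Matching.

Ltac adj_lia := by rewrite /adjD /edgeD; lia.

HB.instance Definition _ (T : finType) := Finite.on (state T).

(** Generators acting on one side: the points f 0, ..., f n of that side in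
    order, the generator 0 acting at the position of 1 with a dot. *)
Section Steps.
Variables (T : finType) (n : nat) (f : nat -> T).
Hypothesis f_inj : forall i j, (i <= maxn n 1)%N -> (j <= maxn n 1)%N -> f i = f j -> i = j.

Definition gstep (j : nat) (s : state T) : state T :=
  cup (f (maxn j 1).-1) (f (maxn j 1)) (j == 0) s.
Definition gloop (j : nat) (s : state T) : bool :=
  loop (f (maxn j 1).-1) (f (maxn j 1)) (j == 0) s.

Let fN i j : (i <= maxn n 1)%N -> (j <= maxn n 1)%N -> i <> j -> f i <> f j.
Proof. by move=> ile jle ij /f_inj; auto. Qed.

Lemma gstep_wf j s : (j <= n)%N -> wf_state s -> wf_state (gstep j s).
Proof. by move=> jn ws; apply: cup_wf => //; apply: fN; lia. Qed.

Lemma gstep_loop j s : (j <= n)%N -> wf_state s -> gloop j (gstep j s).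
Proof.
move=> jn ws; rewrite /gloop /gstep /loop cup_at eqxx /=.
by move: (@cup_dot _ s (f (maxn j 1).-1) (f (maxn j 1)) (j == 0)) => /=;
  case: dots_after => // t ->.
Qed.

Lemma gstep_id j s : wf_state s -> gloop j s -> gstep j s = s.
Proof. by move=> ws; exact: cup_id. Qed.

Lemma gstep_zigzag i j s : (i <= n)%N -> (j <= n)%N -> adjD i j -> wf_state s ->
  [/\ gstep i (gstep j (gstep i s)) = gstep i s, gloop j (gstep i s) = false
    & gloop i (gstep j (gstep i s)) = false].
Proof.
move=> ile jle ij ws; have ws1 := gstep_wf ile ws.
have ab : f (maxn i 1).-1 <> f (maxn i 1) by apply: fN; lia.
have : (maxn j 1 = (maxn i 1).+1 \/ maxn i 1 = (maxn j 1).+1).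
  by move: ij; adj_lia.
have at1 := @cup_at _ s (f (maxn i 1).-1) (f (maxn i 1)) (i == 0).
have dt1 := @cup_dot _ s (f (maxn i 1).-1) (f (maxn i 1)) (i == 0).
rewrite -/(gstep i s) in at1 dt1; move: (gstep i s) ws1 at1 dt1 => s1 ws1 at1 dt1.
case=> Ej; rewrite /gstep /gloop.
  rewrite Ej /=; apply: zigzag => //; apply: fN; lia.
have at2 : s1.1 (f (maxn i 1)) = f (maxn i 1).-1.
  by rewrite -at1; case: ws1 => wc _; case: (wc (f (maxn i 1).-1)).
have uv : f (maxn j 1).-1 <> f (maxn j 1) by apply: fN; lia.
rewrite (cupC ws1 _ uv) (loopC ws1 _ uv).
have ws2 : wf_state (cup (f (maxn j 1)) (f (maxn j 1).-1) (j == 0) s1).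
  by apply: cup_wf => //; exact: nesym.
rewrite (cupC ws2 _ ab) (loopC ws2 _ ab); rewrite Ej /= in at1 dt1 at2 ab *.
apply: zigzag => //; try by apply: fN; lia.
by move=> t st; rewrite -at1; case: ws1 => _ wt; rewrite (wt t st) (dt1 t st).
Qed.

Lemma gstep_comm i j s : (i <= n)%N -> (j <= n)%N -> i != j -> ~~ adjD i j -> wf_state s ->
  gstep i (gstep j s) = gstep j (gstep i s) /\
  (gloop j s + gloop i (gstep j s) = gloop i s + gloop j (gstep i s))%N.
Proof.
move=> ile jle ij nij ws; have [mm|mm] := eqVneq (maxn i 1) (maxn j 1).
  by rewrite /gstep /gloop mm; apply: cup_swap => //; apply: fN; lia.
have far : ((maxn i 1).+1 < maxn j 1 \/ (maxn j 1).+1 < maxn i 1)%N.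
  by move: ij nij; adj_lia.
by split; [apply: cup_comm|apply: loop_comm] => //; apply: fN; lia.
Qed.

End Steps.

(** Used for the multiplications from the left and from the right, which take
    place at the top and at the bottom of a diagram. *)
Lemma gstep_disjoint (T : finType) (f g : nat -> T) n i j s :
  (forall k l, (k <= maxn n 1)%N -> (l <= maxn n 1)%N -> f k <> g l) ->
  (forall k l, (k <= maxn n 1)%N -> (l <= maxn n 1)%N -> f k = f l -> k = l) ->
  (forall k l, (k <= maxn n 1)%N -> (l <= maxn n 1)%N -> g k = g l -> k = l) ->
  (i <= n)%N -> (j <= n)%N -> wf_state s ->
  gstep f i (gstep g j s) = gstep g j (gstep f i s) /\
  (gloop g j s + gloop f i (gstep g j s) = gloop f i s + gloop g j (gstep f i s))%N.
Proof.
move=> fg fi gi ile jle ws.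
have N (h : nat -> T) k l : (forall k l, (k <= maxn n 1)%N -> (l <= maxn n 1)%N -> h k = h l -> k = l) ->
  (k <= maxn n 1)%N -> (l <= maxn n 1)%N -> k <> l -> h k <> h l by move=> hi kl ll kl' /hi; auto.
split; [apply: cup_comm|apply: loop_comm] => //; try (by apply: fg; lia);
  by apply: N => //; lia.
Qed.

(** * Planarity and the encoding of type D diagrams *)

Section Planar.
Variable K : nat.
Local Notation pt := 'I_K.

Definition noncrossing (c : {ffun pt -> pt}) :=
  forall a b : pt, ~ [/\ (a < b)%N, (b < c a)%N & (c a < c b)%N].

Definition outermost (c : {ffun pt -> pt}) (p : pt) :=
  forall q : pt, ~ (q < p /\ p < c q)%N.

Definition dot_count (c : {ffun pt -> pt}) (t : {ffun pt -> bool}) : nat :=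
  \sum_(p : pt) ((p < c p) && t p).

Definition planar (s : state pt) :=
  [/\ wf_state s, noncrossing s.1
    & forall t, s.2 = Some t ->
        (forall p, t p -> outermost s.1 p) /\ ~~ odd (dot_count s.1 t)].

Section Between.
Variable c : {ffun pt -> pt}.
Hypothesis wc : wf_conn c.
Hypothesis nc : noncrossing c.

Lemma val_neq (x y : pt) : x <> y -> (x : nat) <> y.
Proof. by move=> xy /val_inj. Qed.

Lemma nc_between (x p : pt) : (x < p /\ p < c x)%N -> (x < c p /\ c p < c x)%N.
Proof.
move=> [xp pcx]; case: (wc p) (wc x) => pK pN [xK xN].
have p1 : (c p : nat) <> x by move=> /val_inj E; move: pcx; rewrite -E pK ltnn.
have p2 : (c p : nat) <> c x.
  by move=> /val_inj E; move: xp; rewrite -pK E xK ltnn.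
have := @nc (c p) x; have := @nc x p; rewrite pK => n1 n2.
split; case: ltngtP => // *; try lia; exfalso.
- by apply: n2; split; lia.
- by apply: n1; split; lia.
Qed.

Section Cup.
Variables (a b : pt).
Hypothesis ab1 : (b = a.+1 :> nat).

Let ab : a <> b. Proof. by move=> E; move: ab1; rewrite E; lia. Qed.

Lemma joinc_cases x :
  [\/ (x = a /\ joinc a b c x = b), (x = b /\ joinc a b c x = a),
      [/\ x <> a, x <> b, c x = a, c a = x & joinc a b c x = c b] |
      ([/\ x <> a, x <> b, c x = b, c b = x & joinc a b c x = c a] \/
      [/\ x <> a, x <> b, c x <> a, c x <> b & joinc a b c x = c x])].
Proof.
rewrite ffunE; case: (eqVneq x a) => [->|/eqP xa]; first by constructor 1.
case: (eqVneq x b) => [->|/eqP xb]; first by constructor 2.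
have [cxK _] := wc x.
case: (eqVneq (c x) a) => [E|/eqP ca]; first by constructor 3; split=> //; rewrite -E.
case: (eqVneq (c x) b) => [E|/eqP cb]; constructor 4; [left | by right].
by split=> //; rewrite -E.
Qed.

(** The points a and b are neighbours, so that any other chord has both of them on
    the same side, and hence also their partners. *)
Lemma joinc_noncrossing : noncrossing (joinc a b c).
Proof.
move=> x y [xy yx c'].
have [caK _] := wc a; have [cbK _] := wc b; have [cxK _] := wc x; have [cyK _] := wc y.
have Bx := @nc_between x; have By := @nc_between y; have n0 := @nc x y.
have Jx := joinc_cases x; have Jy := joinc_cases y.
case: (ex_intro (fun r : 'I_K => joinc a b c x = r) _ erefl) => r Er.
case: (ex_intro (fun r : 'I_K => joinc a b c y = r) _ erefl) => r' Er'.
rewrite !Er !Er' in yx c' Jx Jy.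
have vE (u v : pt) : u = v -> (u : nat) = v by move=> ->.
have {}Jy : [\/ [/\ (c y : nat) = a, (c a : nat) = y & (r' : nat) = c b],
    [/\ (c y : nat) = b, (c b : nat) = y & (r' : nat) = c a] |
    [/\ (y : nat) <> a, (y : nat) <> b, (c y : nat) <> a, (c y : nat) <> b & r' = c y]].
  case: Jy => [[E E']|[E E']|[_ _ E1 E2 E3]|[[_ _ E1 E2 E3]|[yA yB E1 E2 E3]]].
  - by rewrite E E' in c' yx; lia.
  - by rewrite E E' in c' yx; lia.
  - by constructor 1; split; exact: vE.
  - by constructor 2; split; exact: vE.
  - by constructor 3; split=> //; exact: val_neq.
case: Jx => [[E E']|[E E']|[xa xb E1 E2 E3]|[[xa xb E1 E2 E3]|[xa xb E1 E2 E3]]].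
- by rewrite E E' in yx xy; lia.
- by rewrite E E' in yx xy; lia.
- move: (vE _ _ E1) (vE _ _ E2) (vE _ _ E3) => {E1 E2 E3} e1 e2 e3.
  have := By (c b); have := By a; rewrite cbK.
  by case: Jy => -[]; [lia|lia|move=> ? ? ? ? E; rewrite E in c'; lia].
- move: (vE _ _ E1) (vE _ _ E2) (vE _ _ E3) => {E1 E2 E3} e1 e2 e3.
  have := By (c a); have := By b; rewrite caK.
  by case: Jy => -[]; [lia|lia|move=> ? ? ? ? E; rewrite E in c'; lia].
have [xa' xb'] := (val_neq xa, val_neq xb); rewrite E3 in yx c'.
have := Bx y; have := Bx a; have := Bx b.
case: Jy => -[]; [by have := val_neq E2; lia|by have := val_neq E1; lia|].
by move=> _ _ _ _ E; rewrite E in c'; case: n0.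
Qed.

Hypothesis cab : c a <> b.
Variables (t : {ffun pt -> bool}) (d : bool).
Hypothesis wt : forall p : pt, t (c p) = t p.
Hypothesis out : forall p : pt, t p -> outermost c p.
(* Dotted caps only occur at the left boundary, where the new chord is outer. *)
Hypothesis d_end : d -> (a = 0 :> nat) \/ (b.+1 = K).

(** Dots stay outer: a chord around the joined chord would be around both chords
    which it replaces, one of which is dotted, and a point between its ends is
    between the ends of one of these two chords. *)
Lemma joint_outermost (p : pt) : joint a b d c t p -> outermost (joinc a b c) p.
Proof.
move=> tp q [qp pq].
have [caK caN] := wc a; have [cbK cbN] := wc b; have [cqK _] := wc q; have [cpK _] := wc p.
have O (x : pt) : t x -> (~ (q < x /\ x < c q) /\ ~ (a < x /\ x < c a) /\ ~ (b < x /\ x < c b))%N.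
  by move=> tx; split; [|split]; apply: (out tx).
have Bq := @nc_between q p; have J := joinc_cases q.
have cqlt := ltn_ord (c q).
have [qa qb] : (q : nat) <> a /\ (q : nat) <> b.
  split=> /val_inj E; move: qp pq; rewrite E ffunE eqxx; first lia.
  by rewrite (introF eqP (nesym ab)); lia.
case: (ex_intro (fun r : 'I_K => joinc a b c q = r) _ erefl) => r Er.
have rK := ltn_ord r; rewrite !Er in pq J.
have rb : (r : nat) <> b.
  case: J => [[E _]|[E _]|[_ _ _ _ ->]|[[_ _ _ _ ->]|[_ _ _ H ->]]].
  - by rewrite E in qa.
  - by rewrite E in qb.
  - exact: val_neq.
  - exact: val_neq.
  - exact: val_neq.
have pab : ~ (p = a \/ p = b).
  move=> pab; have /d_end dd : d.
    by move: tp; rewrite ffunE; case: pab => ->; rewrite eqxx ?orbT.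
  by case: pab => E; rewrite E in qp pq; lia.
have pa : p <> a by move=> E; apply: pab; left.
have pb : p <> b by move=> E; apply: pab; right.
have vpa := val_neq pa; have vpb := val_neq pb.
move: tp; rewrite ffunE (introF eqP pa) (introF eqP pb) /=.
have [cpa|/eqP cpa] := eqVneq (c p) a.
  have pE : p = c a by rewrite -cpa cpK.
  have jq : r = c q.
    case: J => [[E _]|[E _]|[_ _ _ E _]|[[_ _ _ _ E]|[]//]].
    - by rewrite E in qa.
    - by rewrite E in qb.
    - by move: qp; rewrite pE E ltnn.
    - by move: pq; rewrite E pE ltnn.
  rewrite jq in pq rb; have [b1 b2] := Bq (conj qp pq); rewrite cpa in b1 b2.
  have dis : ~~ d by apply/negP => /d_end; lia.
  have tpa : t p = t a by rewrite -wt cpa.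
  case: (boolP (t a)) => ta; first by rewrite -tpa in ta; case: (O _ ta); lia.
  by rewrite (negPf dis); have [/O [? _] _|_] := boolP (t b); first by lia.
have [cpb|/eqP cpb] /= := eqVneq (c p) b.
  have pE : p = c b by rewrite -cpb cpK.
  have jq : r = c q.
    case: J => [[E _]|[E _]|[_ _ _ _ E]|[[_ _ _ E _]|[]//]].
    - by rewrite E in qa.
    - by rewrite E in qb.
    - by move: pq; rewrite E pE ltnn.
    - by move: qp; rewrite pE E ltnn.
  rewrite jq in pq rb rK; have [b1 b2] := Bq (conj qp pq); rewrite cpb in b1 b2.
  have tpb : t p = t b by rewrite -wt cpb.
  case: (boolP (t b)) => tb; first by rewrite -tpb in tb; case: (O _ tb); lia.
  have [/O [? _] _|_] := boolP (t a); first by lia.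
  by move=> /d_end; lia.
move=> /O [O1 [O2 O3]].
case: J => [[E _]|[E _]|[_ _ Eq _ E]|[[_ _ Eq _ E]|[_ _ _ _ E]]].
- by rewrite E in qa.
- by rewrite E in qb.
- by rewrite E in pq; rewrite Eq in O1; lia.
- by rewrite E in pq; rewrite Eq in O1; lia.
- by rewrite E in pq; lia.
Qed.

(** The cup carries d, and the joined chord carries d besides the dots of the two
    chords which it replaces. *)
Lemma dot_count_joint :
  odd (dot_count (joinc a b c) (joint a b d c t)) = odd (dot_count c t).
Proof.
have [caK caN] := wc a; have [cbK cbN] := wc b.
have cba : c b <> a by move=> E; apply: cab; rewrite -E cbK.
have cacb : c a <> c b by move=> E; apply: ab; rewrite -caK E cbK.
have ne (u v : pt) : u <> v -> (u == v) = false by move=> uv; apply/eqP.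
have split4 (f : pt -> nat) : \sum_p f p =
    f a + f b + f (c a) + f (c b) + \sum_(p | [&& p != a, p != b, p != c a & p != c b]) f p.
  rewrite (bigD1 a) // (bigD1 b) ?ne //=; last exact: nesym.
  rewrite (bigD1 (c a)) ?ne //= (bigD1 (c b)) ?ne //=; try exact: nesym.
  by rewrite !addnA; congr (_ + _); apply: eq_bigl => p; rewrite -!andbA.
rewrite /dot_count !split4 (eq_bigr (fun p : pt => ((p < c p) && t p) : nat)); last first.
  move=> p /and4P[pa pb pca pcb]; rewrite !ffunE (negPf pa) (negPf pb) /=.
  have [cpK _] := wc p.
  rewrite (_ : (c p == a) = false); last by apply: contraNF pca => /eqP <-; rewrite cpK.
  by rewrite (_ : (c p == b) = false) //; apply: contraNF pcb => /eqP <-; rewrite cpK.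
rewrite [in LHS]oddD [in RHS]oddD; congr (_ (+) _).
have ja : joinc a b c a = b by rewrite ffunE eqxx.
have jb : joinc a b c b = a by rewrite ffunE (ne _ _ (nesym ab)) eqxx.
have jca : joinc a b c (c a) = c b by rewrite ffunE (ne _ _ caN) (ne _ _ cab) caK eqxx.
have jcb : joinc a b c (c b) = c a.
  by rewrite ffunE (ne _ _ cba) (ne _ _ cbN) cbK (ne _ _ (nesym ab)) eqxx.
rewrite ja jb jca jcb caK cbK.
have ta : joint a b d c t a = d by rewrite ffunE eqxx.
have tb : joint a b d c t b = d by rewrite ffunE eqxx orbT.
have tca : joint a b d c t (c a) = t a (+) t b (+) d.
  by rewrite ffunE (ne _ _ caN) (ne _ _ cab) caK eqxx.
have tcb : joint a b d c t (c b) = t a (+) t b (+) d.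
  by rewrite ffunE (ne _ _ cba) (ne _ _ cbN) cbK eqxx orbT.
rewrite ta tb tca tcb !wt.
have one (u v : pt) e : u <> v -> odd (((u < v) && e) + ((v < u) && e)) = e.
  by move=> /val_neq; case: ltngtP => // _ _; rewrite ?addn0 ?add0n oddb.
have four x1 x2 x3 x4 : odd (x1 + x2 + x3 + x4) = odd (x1 + x2) (+) odd (x3 + x4).
  by rewrite -addnA oddD.
have four' x1 x2 x3 x4 : odd (x1 + x2 + x3 + x4) = odd (x1 + x3) (+) odd (x2 + x4).
  by rewrite (addnAC x1) four.
rewrite four (one a b) // (one (c a) (c b)) // four' (one a (c a)) ?(one b (c b)); try exact: nesym.
by case: (d); case: (t a); case: (t b).
Qed.

End Cup.
End Between.

Lemma cup_planar (a b : pt) (d : bool) (s : state pt) : (b = a.+1 :> nat) ->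
  (d -> (a = 0 :> nat) \/ b.+1 = K) -> planar s -> planar (cup a b d s).
Proof.
case: s => c ot ab1 d_end [/= ws nc dots].
have ab : a <> b by move=> E; move: ab1; rewrite E; lia.
have wc : wf_conn c by case: ws.
split; [exact: cup_wf | exact: joinc_noncrossing | move=> t'].
rewrite /= /dots_after /=; case: eqP => [cab|cab].
  by case: ot ws dots => // t [_ wt] dots; case: eqP => // _ [<-]; rewrite joinc_id //; exact: dots.
case: ot ws dots => // t [_ wt] /(_ t erefl) [out ev] [<-].
split; last by rewrite dot_count_joint //; exact: wt.
by move=> p; apply: joint_outermost => //; exact: wt.
Qed.

End Planar.

Section Encoding.
Variable n : nat.
Local Notation pt := (point n).
Implicit Type s : state pt.

(** The encodings of the type D diagrams: the identity connectivity has no odd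
    diagram. *)
Definition good s := planar s /\ (s.2 = None -> s.1 <> conn1 n).

(** The dot of an odd diagram is moved to the chord of the point 1. *)
Definition diag_of s : diag n :=
  (s.1, if s.2 is Some t then [set p : point n | (p < s.1 p) && t p] else [set ord0]).

Lemma card_dots (c : conn n) (t : {ffun pt -> bool}) :
  #|[set p : point n | (p < c p) && t p]| = dot_count c t.
Proof. by rewrite cardsE -sum1_card big_mkcond /=; apply: eq_bigr => p _; rewrite unfold_in; case: (_ && _). Qed.

Lemma diag_of_typeD s : good s -> typeD (diag_of s).
Proof.
case: s => c ot [[/= [/= wc wt] nc dots] c1]; rewrite /typeD /=.
apply/and3P; split.
- apply/and3P; split; first by apply/forallP => a; apply/eqP; case: (wc a).
    by apply/forallP => a; apply/eqP; case: (wc a).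
  apply/forallP => a; apply/forallP => b; apply/negP => /and3P[*].
  by apply: (nc a b); split.
- apply/forallP => p; apply/implyP; case: ot {wt dots c1} => [t|].
    by rewrite inE => /andP[].
  rewrite inE => /eqP ->; rewrite lt0n; apply/eqP => E; case: (wc ord0) => _; apply.
  exact: val_inj.
case: ot wt dots c1 => [t|] wt dots c1; apply/orP; last first.
  by right; rewrite eqxx /=; apply/eqP; exact: c1.
have [out ev] := dots t erefl.
left; rewrite card_dots ev /=; apply/forallP => p; apply/implyP; rewrite inE => /andP[pc tp].
apply/forallP => a; apply/negP => /andP[ap pa].
by apply: (out p tp a); split=> //; exact: ltn_trans pa.
Qed.

(** The dots of a diagram are only recorded at left ends. *)
Lemma typeD_diag_of (D : diag n) : typeD D -> exists2 s, good s & diag_of s = D.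
Proof.
case: D => c S /and3P[/= /and3P[/forallP c1 /forallP c2 /forallP c3] /forallP lS dS].
have wc : wf_conn c by move=> a; split; apply/eqP.
have nc : noncrossing c.
  by move=> a b [ab bc cc]; move/forallP: (c3 a) => /(_ b); rewrite ab bc cc.
have [oS|eS] := boolP (odd #|S|).
  move: dS; rewrite oS /= => /andP[/eqP -> /eqP cn1].
  by exists (c, None).
pose t := [ffun p : pt => (p \in S) || (c p \in S)].
have {dS} out p : p \in S -> outer c p.
  case/orP: dS => [/andP[_ /forallP H] pS|/andP[/eqP S1 _]]; first by move: (H p); rewrite pS.
  by move: eS; rewrite S1 cards1.
have wt p : t (c p) = t p by rewrite !ffunE orbC; case: (wc p) => ->.
have lt p : p \in S -> (p < c p)%N by move=> pS; move: (lS p); rewrite pS.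
have SE : [set p : point n | (p < c p) && t p] = S.
  apply/setP => p; rewrite inE ffunE; apply/andP/idP => [[pc]|pS].
    by case/orP => // /lt; case: (wc p) => -> _; lia.
  by rewrite lt // pS.
have outS p : p \in S -> outermost c p.
  move=> pS q [qp pq]; have /forallP /(_ q) := out p pS; rewrite qp /= -leqNgt => cc.
  have ne : (c q : nat) <> c p.
    by move=> /val_inj E; move: qp; case: (wc q) (wc p) => <- _ [<- _]; rewrite E ltnn.
  by apply: (nc q p); split=> //; lia.
exists (c, Some t); last by rewrite /diag_of /= SE.
split=> //; split=> //=; first by split=> //= t' [<-].
move=> t' [<-]; split; last by rewrite -card_dots SE.
move=> p; rewrite ffunE => /orP[/outS //|/outS o] q qp.
by apply: (o q); exact: nc_between.
Qed.

Lemma diag_of_inj s s' : good s -> good s' -> diag_of s = diag_of s' -> s = s'.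
Proof.
case: s s' => c ot [c' ot'] [[/= [/= wc wt] nc dots] c1] [[/= [/= _ wt'] _ dots'] c1'].
rewrite /diag_of /= => -[E]; move: E wt' dots' c1' => <- wt' dots' c1'.
case: ot ot' wt wt' dots dots' {c1 c1'} => [t|] [t'|] //= wt wt' dots dots' E.
- congr (_, Some _); apply/ffunP => p.
  wlog pc : p / (p < c p)%N => [H|].
    have [/H //|cp] := ltnP p (c p).
    rewrite -(wt t erefl) -(wt' t' erefl); apply: H; case: (wc p) => -> pN.
    by rewrite ltn_neqAle cp andbT; apply/eqP => /val_inj.
  by move/setP: E => /(_ p); rewrite !inE pc.
- have [_] := dots t erefl; rewrite -card_dots; move: E => ->.
  by rewrite cards1.
- have [_] := dots' t' erefl; rewrite -card_dots; move: E => <-.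
  by rewrite cards1.
Qed.

End Encoding.

(** * Generators at the top and at the bottom of a diagram *)

Section Sides.
Variable n : nat.
Local Notation pt := (point n).

(** The bottom points, and the top points above them, from left to right: right
    factors act at the former, left factors at the latter. *)
Definition rpt (k : nat) : pt := inord k.
Definition lpt (k : nat) : pt := rev_ord (inord k : pt).

Lemma val_rpt k : (k <= maxn n 1)%N -> val (rpt k) = k.
Proof. by move=> kn; rewrite /= inordK //; lia. Qed.

Lemma val_lpt k : (k <= maxn n 1)%N -> val (lpt k) = (n.*2.+1 - k)%N.
Proof. by move=> kn; rewrite /= inordK ?subSS //; lia. Qed.

Lemma rpt_inj k l : (k <= maxn n 1)%N -> (l <= maxn n 1)%N -> rpt k = rpt l -> k = l.
Proof. by move=> kn ln /(congr1 val); rewrite !val_rpt. Qed.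

Lemma lpt_inj k l : (k <= maxn n 1)%N -> (l <= maxn n 1)%N -> lpt k = lpt l -> k = l.
Proof. by move=> kn ln /(congr1 val); rewrite !val_lpt //; lia. Qed.

Lemma lpt_rpt k l : (0 < n)%N -> (k <= maxn n 1)%N -> (l <= maxn n 1)%N -> lpt k <> rpt l.
Proof. by move=> n0 kn ln /(congr1 val); rewrite val_lpt // val_rpt //; lia. Qed.

Definition id_state : state pt := (conn1 n, Some [ffun=> false]).

Lemma conn1_wf : wf_conn (conn1 n).
Proof.
move=> a; rewrite !ffunE rev_ordK; split=> // /(congr1 val) /=.
by have := ltn_ord a; lia.
Qed.

Lemma id_wf : wf_state id_state.
Proof. by split=> [|t [<-] p]; [exact: conn1_wf | rewrite !ffunE]. Qed.

Lemma id_good : good id_state.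
Proof.
split=> //; split; first exact: id_wf.
  move=> a b /=; rewrite !ffunE /= => -[ab ba cc].
  by have := ltn_ord a; have := ltn_ord b; lia.
move=> t [<-]; split=> [p|]; first by rewrite ffunE.
by rewrite /dot_count big1 // => p _; rewrite !ffunE andbF.
Qed.

(** Top points are numbered from right to left, hence the use of cupC. *)
Lemma lstep_good j (s : state pt) : (0 < n)%N -> (j <= n)%N -> good s -> good (gstep lpt j s).
Proof.
move=> n0 jn [ps _]; have ws : wf_state s by case: ps.
have v1 := @val_lpt (maxn j 1); have v0 := @val_lpt (maxn j 1).-1.
have d : lpt (maxn j 1).-1 <> lpt (maxn j 1) by move=> /lpt_inj; lia.
split.
  rewrite /gstep cupC //; apply: cup_planar => //; first by rewrite v0 ?v1; lia.
  by move=> j0; right; rewrite v0; lia.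
move=> _ E; have := @cup_at _ s (lpt (maxn j 1).-1) (lpt (maxn j 1)) (j == 0%N).
move: E; rewrite /gstep => -> /=; rewrite ffunE /lpt rev_ordK => /(congr1 val).
by rewrite /= !inordK; lia.
Qed.

Lemma rstep_good j (s : state pt) : (0 < n)%N -> (j <= n)%N -> good s -> good (gstep rpt j s).
Proof.
move=> n0 jn [ps _]; have ws : wf_state s by case: ps.
have v1 := @val_rpt (maxn j 1); have v0 := @val_rpt (maxn j 1).-1.
split.
  apply: cup_planar => //; first by rewrite v0 ?v1; lia.
  by move=> j0; left; rewrite v0; lia.
move=> _ E; have := @cup_at _ s (rpt (maxn j 1).-1) (rpt (maxn j 1)) (j == 0%N).
move: E; rewrite /gstep => -> /=; rewrite ffunE => /(congr1 val).
by rewrite /= !inordK; lia.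
Qed.

Definition word_state (w : seq 'I_n.+1) : state pt :=
  foldr (fun i : 'I_n.+1 => gstep lpt i) id_state w.
Fixpoint word_loops (w : seq 'I_n.+1) : nat :=
  if w is i :: w' then word_loops w' + gloop lpt i (word_state w') else 0.

Lemma word_state_wf w : wf_state (word_state w).
Proof.
elim: w => [|i w IH]; first exact: id_wf.
by apply: (@gstep_wf _ n) => //; [exact: lpt_inj | rewrite -ltnS].
Qed.

Lemma word_state_good w : (0 < n)%N -> good (word_state w).
Proof.
move=> n0; elim: w => [|i w IH]; first exact: id_good.
by apply: lstep_good => //; rewrite -ltnS.
Qed.

(** On the identity diagram, a generator acts in the same way from both sides. *)
Lemma gen_id j : (0 < n)%N -> (j <= n)%N ->
  [/\ gstep lpt j id_state = gstep rpt j id_state,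
      gloop lpt j id_state = false & gloop rpt j id_state = false].
Proof.
move=> n0 jn; pose a := rpt (maxn j 1).-1; pose b := rpt (maxn j 1).
have va : val a = (maxn j 1).-1 by rewrite val_rpt; lia.
have vb : val b = maxn j 1 by rewrite val_rpt; lia.
rewrite /gstep /gloop -/a -/b -[lpt _]/(rev_ord a) -[lpt (maxn j 1)]/(rev_ord b).
have ab : a <> b by move=> /(congr1 val); rewrite va vb; lia.
have n1 : rev_ord a <> b by move=> /(congr1 val); rewrite vb /= -[nat_of_ord a]/(val a) va; lia.
have n2 : rev_ord b <> a by move=> /(congr1 val); rewrite va /= -[nat_of_ord b]/(val b) vb; lia.
have n3 : rev_ord a <> rev_ord b by move=> /rev_ord_inj.
have rK := @rev_ordK n.*2.+2.
have r_inj (x y : pt) : (rev_ord x == rev_ord y) = (x == y) by exact/inj_eq/rev_ord_inj.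
have rl (x y : pt) : (rev_ord x == y) = (x == rev_ord y) by rewrite -(inj_eq (@rev_ord_inj _)) rK.
have ne (x y : pt) : x <> y -> (x == y) = false by move=> /eqP/negPf.
have l1 : ((conn1 n) (rev_ord a) == rev_ord b) = false.
  by rewrite ffunE rK -rl; exact: ne.
have l2 : ((conn1 n) a == b) = false by rewrite ffunE; exact: ne.
split; last by rewrite /loop /= l2.
- have excl (p : pt) : (p == a) || (p == b) -> (p == rev_ord a) || (p == rev_ord b) -> False.
    by case/orP => /eqP-> /orP[] /eqP/(congr1 val) /=;
      move: va vb => /=; lia.
  rewrite /cup /dots_after l1 l2 /=; congr (_, Some _); apply/ffunP => p.
    rewrite !ffunE ?rK !r_inj !rl; move: (excl p).
    by case: (p == a); case: (p == b); case: (p == rev_ord a);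
      case: (p == rev_ord b) => //= H; case: (H isT isT).
  rewrite !ffunE !r_inj !rl; move: (excl p).
  by case: (p == a); case: (p == b); case: (p == rev_ord a);
    case: (p == rev_ord b) => //= H; rewrite ?addbF //; case: (H isT isT).
- by rewrite /loop /= l1.
Qed.

End Sides.

(** * Insertion of a chord *)

(** The map f embeds T in the complement of {x, y}, with inverse g; the chord
    {x, y} is added without a dot. *)
Section Insert.
Variables (T U : finType).

Definition ins_conn (f : T -> U) (g : U -> T) (x y : U) (c : {ffun T -> T}) : {ffun U -> U} :=
  [ffun p => if p == x then y else if p == y then x else f (c (g p))].
Definition ins_dots (g : U -> T) (x y : U) (t : {ffun T -> bool}) : {ffun U -> bool} :=
  [ffun p => if (p == x) || (p == y) then false else t (g p)].
Definition ins (f : T -> U) (g : U -> T) (x y : U) (s : state T) : state U :=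
  (ins_conn f g x y s.1, omap (ins_dots g x y) s.2).

Definition ins_ok (f : T -> U) (g : U -> T) (x y : U) :=
  [/\ x <> y, cancel f g, forall a, f a <> x /\ f a <> y
    & forall p, p <> x -> p <> y -> f (g p) = p].

Section One.
Variables (f : T -> U) (g : U -> T) (x y : U).
Hypothesis ok : ins_ok f g x y.

Let xy : x <> y. Proof. by case: ok. Qed.
Let fK a : g (f a) = a. Proof. by case: ok => _ /(_ a). Qed.
Let fx a : f a <> x. Proof. by case: ok => _ _ /(_ a) []. Qed.
Let fy a : f a <> y. Proof. by case: ok => _ _ /(_ a) []. Qed.
Let gK p : p <> x -> p <> y -> f (g p) = p. Proof. by case: ok => _ _ _; apply. Qed.
Let fx' a : (f a == x) = false. Proof. exact: introF eqP (@fx a). Qed.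
Let fy' a : (f a == y) = false. Proof. exact: introF eqP (@fy a). Qed.
Let yx' : (y == x) = false. Proof. exact: introF eqP (nesym xy). Qed.
Let f_inj : injective f. Proof. by case: ok => _ /can_inj. Qed.

Lemma ins_pointP (P : U -> Prop) : P x -> P y -> (forall a, P (f a)) -> forall p, P p.
Proof.
move=> Px Py Pf p; case: (eqVneq p x) => [->//|/eqP px].
by case: (eqVneq p y) => [->//|/eqP py]; rewrite -(gK px py).
Qed.

Lemma ins_conn_f c a : ins_conn f g x y c (f a) = f (c a).
Proof. by rewrite ffunE fx' fy' fK. Qed.
Lemma ins_conn_x c : ins_conn f g x y c x = y.
Proof. by rewrite ffunE eqxx. Qed.
Lemma ins_conn_y c : ins_conn f g x y c y = x.
Proof. by rewrite ffunE yx' eqxx. Qed.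
Lemma ins_dots_f t a : ins_dots g x y t (f a) = t a.
Proof. by rewrite ffunE fx' fy' fK. Qed.
Lemma ins_dots_x t : ins_dots g x y t x = false.
Proof. by rewrite ffunE eqxx. Qed.
Lemma ins_dots_y t : ins_dots g x y t y = false.
Proof. by rewrite ffunE eqxx orbT. Qed.

Lemma ins_conn_inj : injective (ins_conn f g x y).
Proof.
move=> c c' E; apply/ffunP => a; apply: f_inj.
by rewrite -!ins_conn_f E.
Qed.

Lemma ins_inj : injective (ins f g x y).
Proof.
move=> [c ot] [c' ot'] [/ins_conn_inj -> E]; congr pair.
case: ot ot' E => [t|] [t'|] //= [E]; congr Some; apply/ffunP => a.
by rewrite -ins_dots_f E ins_dots_f.
Qed.

Lemma ins_wf s : wf_state s -> wf_state (ins f g x y s).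
Proof.
case: s => c ot [/= wc wt]; split => /=.
  apply: ins_pointP => [||a].
  - by rewrite ins_conn_x ins_conn_y; split => //; exact: nesym.
  - by rewrite ins_conn_y ins_conn_x.
  - by rewrite !ins_conn_f; case: (wc a) => -> ca; split => // /f_inj.
case: ot wt => //= t wt _ [<-]; apply: ins_pointP => [||a].
- by rewrite ins_conn_x ins_dots_x ins_dots_y.
- by rewrite ins_conn_y ins_dots_x ins_dots_y.
- by rewrite ins_conn_f !ins_dots_f wt.
Qed.

Lemma wf_ins_conn c : wf_conn (ins_conn f g x y c) -> wf_conn c.
Proof.
move=> wc a; case: (wc (f a)); rewrite !ins_conn_f => /f_inj -> ca.
by split=> // E; apply: ca; rewrite E.
Qed.

Lemma cup_ins a b d s : cup (f a) (f b) d (ins f g x y s) = ins f g x y (cup a b d s).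
Proof.
case: s => c ot; rewrite /cup /ins /=; congr pair.
  apply/ffunP; apply: ins_pointP => [||p].
  - rewrite ins_conn_x ffunE !(eq_sym x) !fx' ins_conn_x.
    by rewrite !(eq_sym y) !fy'.
  - rewrite ins_conn_y ffunE !(eq_sym y) !fy' ins_conn_y.
    by rewrite !(eq_sym x) !fx'.
  - rewrite ins_conn_f !ffunE -/(ins_conn f g x y c) !fx' !fy' !fK !(inj_eq f_inj).
    by do ![case: ifP => _ //].
rewrite /dots_after /= ins_conn_f (inj_eq f_inj).
case: eqP => _; case: ot => //= t; first by rewrite ins_dots_f; case: eqP.
congr Some; apply/ffunP; apply: ins_pointP => [||p].
- by rewrite ins_dots_x ffunE !(eq_sym x) !fx' ins_conn_x !(eq_sym y) !fy' ins_dots_x.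
- by rewrite ins_dots_y ffunE !(eq_sym y) !fy' ins_conn_y !(eq_sym x) !fx' ins_dots_y.
- by rewrite ins_dots_f !ffunE !fx' !fy' !fK !(inj_eq f_inj).
Qed.

Lemma loop_ins a b d s : loop (f a) (f b) d (ins f g x y s) = loop a b d s.
Proof.
case: s => c ot; rewrite /loop /= ins_conn_f (inj_eq f_inj).
by case: ot => //= t; rewrite ins_dots_f.
Qed.

(** The inserted chord is undotted, so that a dotted cap closes it to a loop with
    a single dot. *)
Lemma cup_ins_dotted s : cup x y true (ins f g x y s) = ins f g x y (s.1, None).
Proof.
case: s => c ot; rewrite /cup /ins /dots_after /= ins_conn_x eqxx; congr pair.
  apply/ffunP; apply: ins_pointP => [||p].
  - by rewrite ffunE eqxx ins_conn_x.
  - by rewrite ffunE yx' eqxx ins_conn_y.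
  - by rewrite ffunE fx' fy' !ins_conn_f fx' fy'.
by case: ot => //= t; rewrite ins_dots_x.
Qed.

Lemma loop_ins_dotted s : loop x y true (ins f g x y s) = (s.2 == None).
Proof.
case: s => c ot; rewrite /loop /= ins_conn_x eqxx; case: ot => //= t.
by rewrite ins_dots_x.
Qed.

Lemma insE s : wf_state s -> s.1 x = y -> (forall t, s.2 = Some t -> t x = false) ->
  exists s', s = ins f g x y s'.
Proof.
case: s => c ot [/= wc wt] cxy tx.
have cyx : c y = x by rewrite -cxy; case: (wc x).
have cf a : f (g (c (f a))) = c (f a).
  apply: gK => E; case: (wc (f a)) => E' _.
    by apply: (@fy a); rewrite -E' E.
  by apply: (@fx a); rewrite -E' E.
exists ([ffun a => g (c (f a))], omap (fun t : {ffun U -> bool} => [ffun a => t (f a)]) ot).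
rewrite /ins /=; congr pair.
  apply/ffunP; apply: ins_pointP => [||a].
  - by rewrite ins_conn_x.
  - by rewrite ins_conn_y.
  - by rewrite ins_conn_f ffunE cf.
case: ot wt tx => //= t wt tx; congr Some; apply/ffunP; apply: ins_pointP => [||a].
- by rewrite ins_dots_x tx.
- by rewrite ins_dots_y -(wt t erefl) cyx tx.
- by rewrite ins_dots_f ffunE.
Qed.

End One.

(** Sliding the inserted chord {y, z} across a point: capping x and y moves it to
    {x, y}, the strand of x being continued at z. *)
Section Slide.
Variables (f f' : T -> U) (g g' : U -> T) (x y z : U) (a0 : T).
Hypothesis ok : ins_ok f g y z.
Hypothesis ok' : ins_ok f' g' x y.
Hypothesis fa0 : f a0 = x.
Hypothesis f'a0 : f' a0 = z.
Hypothesis ff' : forall a, a <> a0 -> f a = f' a.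

Let xy : x <> y. Proof. by case: ok'. Qed.
Let yz : y <> z. Proof. by case: ok. Qed.
Let xz : x <> z. Proof. by move=> E; case: ok => _ _ /(_ a0) [_]; rewrite fa0 E. Qed.
Let f_inj : injective f. Proof. by case: ok => _ /can_inj. Qed.

Lemma slide_pointP (P : U -> Prop) :
  P x -> P y -> P z -> (forall a, a <> a0 -> P (f a)) -> forall p, P p.
Proof.
move=> Px Py Pz Pf; apply: (ins_pointP ok) => // a.
by case: (eqVneq a a0) => [->|/eqP /Pf //]; rewrite fa0.
Qed.

Lemma cup_slide s : wf_state s -> cup x y false (ins f g y z s) = ins f' g' x y s.
Proof.
case: s => c ot [/= wc wt].
have cx : ins_conn f g y z c x = f (c a0) by rewrite -fa0 (ins_conn_f ok).
have cy : ins_conn f g y z c y = z by rewrite ins_conn_x.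
have cz : ins_conn f g y z c z = y by rewrite (ins_conn_y ok).
have fy a : f a <> y by case: ok => _ _ /(_ a) [].
have fz a : f a <> z by case: ok => _ _ /(_ a) [].
have ca0 : c a0 <> a0 by case: (wc a0).
have fax a : a <> a0 -> f a <> x by move=> aa; rewrite -fa0 => /f_inj.
have iz : ins_conn f' g' x y c z = f' (c a0) by rewrite -f'a0 (ins_conn_f ok').
have ia a : a <> a0 -> ins_conn f' g' x y c (f a) = f' (c a).
  by move=> aa; rewrite ff' // (ins_conn_f ok').
have E : joinc x y (ins_conn f g y z c) = ins_conn f' g' x y c.
  apply/ffunP; apply: slide_pointP => [|||a aa].
  - by rewrite ffunE eqxx ins_conn_x.
  - by rewrite (ins_conn_y ok') ffunE (introF eqP (nesym xy)) eqxx.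
  - rewrite iz ffunE cz -(ff' ca0) cx.
    rewrite (introF eqP (nesym xz)) (introF eqP (nesym yz)).
    by rewrite (introF eqP (nesym xy)) eqxx.
  - rewrite ia // ffunE (ins_conn_f ok) cy.
    rewrite (introF eqP (fax _ aa)) (introF eqP (@fy _)).
    rewrite (introF eqP (@fy _)).
    have [caa|caa] := eqVneq (c a) a0; first by rewrite caa fa0 eqxx f'a0.
    by rewrite (introF eqP (fax _ (elimN eqP caa))) ff' //; exact/eqP.
rewrite /cup /ins /= E; congr pair.
rewrite /dots_after /= cx (introF eqP (@fy _)).
case: ot wt => //= t /(_ t erefl) wt; congr Some.
have dz : ins_dots g' x y t z = t a0 by rewrite -f'a0 (ins_dots_f ok').
have dx : ins_dots g y z t x = t a0 by rewrite -fa0 (ins_dots_f ok).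
have da a : a <> a0 -> ins_dots g' x y t (f a) = t a.
  by move=> aa; rewrite ff' // (ins_dots_f ok').
apply/ffunP; apply: slide_pointP => [|||a aa].
- by rewrite !ffunE eqxx.
- by rewrite !ffunE eqxx orbT.
- rewrite dz ffunE cz.
  rewrite (introF eqP (nesym xz)) (introF eqP (nesym yz)) eqxx orbT /=.
  by rewrite dx ins_dots_x; case: (t a0).
- rewrite da // ffunE (ins_conn_f ok).
  rewrite (introF eqP (fax _ aa)) (introF eqP (@fy _)) /=.
  rewrite (introF eqP (@fy _)) orbF (ins_dots_f ok).
  case: eqP => //; rewrite -[x in _ = x]fa0 => /f_inj caa.
  by rewrite dx ins_dots_x -caa wt; case: (t a).
Qed.

Lemma loop_slide d s : loop x y d (ins f g y z s) = false.
Proof.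
rewrite /loop /= -fa0 (ins_conn_f ok); case: eqP => //.
by case: ok => _ _ /(_ (s.1 a0)) [].
Qed.

(** Dots do not matter on odd diagrams. *)
Lemma cup_slide_odd d c : wf_conn c ->
  cup x y d (ins f g y z (c, None)) = ins f' g' x y (c, None).
Proof.
move=> wc; have := @cup_slide (c, None); rewrite /cup /dots_after /=.
rewrite !if_same => -> //; split => //.
Qed.

(** The points x and y belong to different chords, so that no loop is closed. *)
Lemma cup_slide_even d s : s.2 != None -> (cup x y d (ins f g y z s)).2 != None.
Proof.
case: s => c [t|] //= _; rewrite /dots_after /= -fa0 (ins_conn_f ok).
by case: (f (c a0) =P y) => // E; case: ok => _ _ /(_ (c a0)) [].
Qed.

End Slide.

End Insert.

(** * Insertion of an innermost cap *)

Section InsertCap.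
Variable m : nat.
Local Notation n := m.+1.

Definition emb (i : nat) (a : point m) : point n := inord (skip i a).
Definition unemb (i : nat) (p : point n) : point m := inord (unskip i p).
(** Positions are labels, hence the points i - 1 and i. *)
Definition insc (i : nat) : state (point m) -> state (point n) :=
  ins (emb i) (unemb i) (inord i.-1) (inord i).

Lemma val_emb i (a : point m) : emb i a = skip i a :> nat.
Proof. by have la := ltn_ord a; rewrite inordK // /skip; case: ifP; lia. Qed.

Lemma val_unemb i (p : point n) : p != i.-1 :> nat -> p != i :> nat -> (0 < i)%N -> (i < n.*2.+2)%N ->
  unemb i p = unskip i p :> nat.
Proof. by have lp := ltn_ord p; move=> *; rewrite inordK // /unskip; case: ifP; lia. Qed.

Lemma insc_ok i : (0 < i < n.*2.+2)%N ->
  ins_ok (emb i) (unemb i) (inord i.-1) (inord i).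
Proof.
move=> /andP[i0 iln]; have il' : (i.-1 < n.*2.+2)%N by lia.
have ne a : emb i a <> i.-1 :> nat /\ emb i a <> i :> nat.
  by rewrite val_emb /skip; case: ifP; lia.
split.
- by move/(congr1 val); rewrite /= !inordK; lia.
- move=> a; apply: val_inj; have [n1 n2] := ne a.
  rewrite /= val_unemb //; try by apply/eqP.
  by rewrite val_emb /skip /unskip; do 2![case: ifP]; lia.
- by move=> a; have [n1 n2] := ne a; split=> E; [apply: n1|apply: n2]; rewrite E inordK.
move=> p p1 p2; have {}p1 : p != i.-1 :> nat.
  by apply/eqP => E; apply: p1; apply: val_inj; rewrite /= inordK.
have {}p2 : p != i :> nat.
  by apply/eqP => E; apply: p2; apply: val_inj; rewrite /= inordK.
apply: val_inj; rewrite /= val_emb val_unemb // /skip /unskip; do 2![case: ifP]; lia.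
Qed.

Lemma emb_lpt k : (k <= m)%N -> emb m.+2 (lpt m k) = lpt n k.
Proof.
move=> km; apply: val_inj; rewrite /= val_emb /skip /= !inordK; try lia.
by case: ifP; lia.
Qed.

Lemma insc_top_step j s : (0 < m)%N -> (j <= m)%N ->
  gstep (lpt n) j (insc m.+2 s) = insc m.+2 (gstep (lpt m) j s) /\
  gloop (lpt n) j (insc m.+2 s) = gloop (lpt m) j s.
Proof.
move=> m0 jm; rewrite /gstep /gloop -!emb_lpt; try lia.
have ok := @insc_ok m.+2; split; [apply: cup_ins | apply: loop_ins]; apply: ok; lia.
Qed.

(** At position n + 1, the insertion adds a vertical strand on the right. *)
Lemma insc_top_id : insc m.+2 (id_state m) = id_state n.
Proof.
have ok : ins_ok (emb m.+2) (unemb m.+2) (inord m.+1) (inord m.+2) by apply: insc_ok; lia.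
rewrite /insc /ins /id_state /=; congr (_, Some _).
  apply/ffunP; apply: (ins_pointP ok) => [||a].
  - rewrite ins_conn_x ffunE; apply: val_inj; rewrite /= !inordK; lia.
  - rewrite (ins_conn_y ok) ffunE; apply: val_inj; rewrite /= !inordK; lia.
  - rewrite (ins_conn_f ok) !ffunE; apply: val_inj; rewrite /= !val_emb /skip /=.
    by have := ltn_ord a; do 2![case: ifP]; lia.
by apply/ffunP => p; rewrite !ffunE; case: ifP.
Qed.

Lemma ins_sym (T U : finType) (f : T -> U) g x y s : x <> y -> ins f g x y s = ins f g y x s.
Proof.
move=> xy; rewrite /ins; congr (_, _).
  by apply/ffunP => p; rewrite !ffunE; case: eqP => [->|//]; case: eqP.
by congr (omap _ _); apply/funext => t; apply/ffunP => p; rewrite !ffunE orbC.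
Qed.

Lemma ins_okC (T U : finType) (f : T -> U) g x y : ins_ok f g x y -> ins_ok f g y x.
Proof.
case=> xy fK fxy gK; split=> //; first exact: nesym.
  by move=> a; case: (fxy a).
by move=> p py px; exact: gK.
Qed.

(** Multiplying by E_i from the right moves an inserted cap from position i + 1
    to i, and conversely E_(i + 1) moves it from i to i + 1. *)
Section Slides.
Variable i : nat.
Hypothesis i0 : (0 < i)%N.
Hypothesis ilm : (i <= m.+1)%N.

Let okS : ins_ok (emb i.+1) (unemb i.+1) (inord i) (inord i.+1).
Proof. by apply: insc_ok; lia. Qed.
Let ok : ins_ok (emb i) (unemb i) (inord i.-1) (inord i).
Proof. by apply: insc_ok; lia. Qed.
Let a0 : point m := inord i.-1.
Let f1 : emb i.+1 a0 = inord i.-1.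
Proof. by apply: val_inj; rewrite /= val_emb /skip !inordK /=; [case: ifP|..]; lia. Qed.
Let f2 : emb i a0 = inord i.+1.
Proof. by apply: val_inj; rewrite /= val_emb /skip !inordK /=; [case: ifP|..]; lia. Qed.
Let ff a : a <> a0 -> emb i.+1 a = emb i a.
Proof.
move=> aa; apply: val_inj; rewrite /= !val_emb /skip /=.
have : (a : nat) <> i.-1 by move=> E; apply: aa; apply: val_inj; rewrite /= inordK //; lia.
by do 2![case: ifP]; lia.
Qed.
Let d1 : inord i.-1 <> inord i :> point n. Proof. by case: ok. Qed.

Let d2 : inord i <> inord i.+1 :> point n. Proof. by case: okS. Qed.

Let okS' : ins_ok (emb i.+1) (unemb i.+1) (inord i.+1) (inord i).
Proof. exact: ins_okC. Qed.
Let ok' : ins_ok (emb i) (unemb i) (inord i) (inord i.-1).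
Proof. exact: ins_okC. Qed.

Lemma insc_down s : wf_state s ->
  cup (rpt n i.-1) (rpt n i) false (insc i.+1 s) = insc i s.
Proof. exact: (cup_slide okS ok f1 f2 ff). Qed.

Lemma insc_down_loop d s : loop (rpt n i.-1) (rpt n i) d (insc i.+1 s) = false.
Proof. exact: (loop_slide okS f1). Qed.

Lemma insc_down_odd d c : wf_conn c ->
  cup (rpt n i.-1) (rpt n i) d (insc i.+1 (c, None)) = insc i (c, None).
Proof. exact: (cup_slide_odd okS ok f1 f2 ff). Qed.

Lemma insc_down_even d s : s.2 != None ->
  (cup (rpt n i.-1) (rpt n i) d (insc i.+1 s)).2 != None.
Proof. exact: (cup_slide_even okS f1). Qed.

Lemma insc_up s : wf_state s ->
  cup (rpt n i) (rpt n i.+1) false (insc i s) = insc i.+1 s.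
Proof.
move=> ws; rewrite cupC //; last exact: ins_wf.
rewrite /insc ins_sym // [in RHS]ins_sym //.
by apply: (cup_slide ok' okS' f2 f1) => // a /ff.
Qed.

Lemma insc_up_loop d s : wf_state s -> loop (rpt n i) (rpt n i.+1) d (insc i s) = false.
Proof.
move=> ws; rewrite loopC //; last exact: ins_wf.
by rewrite /insc ins_sym //; exact: (loop_slide ok' f2).
Qed.

End Slides.

Lemma insc_wf i s : (0 < i < n.*2.+2)%N -> wf_state s -> wf_state (insc i s).
Proof. by move=> /insc_ok ok; exact: ins_wf. Qed.

Lemma insc_inj i : (0 < i < n.*2.+2)%N -> injective (insc i).
Proof. by move=> /insc_ok ok; exact: ins_inj. Qed.

Lemma rstep_insc i s : (0 < i <= n)%N -> wf_state s ->
  gstep (rpt n) i (insc i.+1 s) = insc i s /\ gloop (rpt n) i (insc i.+1 s) = false.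
Proof.
move=> /andP[i0 iln] ws; have E : maxn i 1 = i by lia.
have E0 : (i == 0) = false by lia.
by rewrite /gstep /gloop E E0 insc_down // insc_down_loop.
Qed.

Lemma rstep_insc_up i s : (0 < i)%N -> (i < n)%N -> wf_state s ->
  gstep (rpt n) i.+1 (insc i s) = insc i.+1 s /\ gloop (rpt n) i.+1 (insc i s) = false.
Proof.
move=> i0 iln ws; have E : maxn i.+1 1 = i.+1 by lia.
by rewrite /gstep /gloop E /= insc_up ?insc_up_loop //; lia.
Qed.

(** Multiplication by E_0 sends a cap at position 1 to itself and makes the
    diagram odd; a loop is closed if it was odd before. *)
Lemma rstep0_insc1 s :
  gstep (rpt n) 0 (insc 1 s) = insc 1 (s.1, None) /\
  gloop (rpt n) 0 (insc 1 s) = (s.2 == None).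
Proof.
have ok := @insc_ok 1.
by split; [apply: cup_ins_dotted; apply: ok | apply: loop_ins_dotted; apply: ok].
Qed.

(** Multiplication by E_0 moves a cap from position 2 to 1 as E_1 does, except for
    the dots. *)
Lemma rstep0_insc2_odd c : wf_conn c ->
  gstep (rpt n) 0 (insc 2 (c, None)) = insc 1 (c, None).
Proof. by move=> wc; rewrite /gstep /= (@insc_down_odd 1). Qed.

Lemma rstep0_insc2_even s : s.2 != None -> (gstep (rpt n) 0 (insc 2 s)).2 != None.
Proof. exact: (@insc_down_even 1). Qed.

Lemma rstep0_insc2_loop s : gloop (rpt n) 0 (insc 2 s) = false.
Proof. exact: (@insc_down_loop 1). Qed.

Lemma insc_innermost i s : (0 < i < n.*2.+2)%N -> innermost (insc i s).1 i.
Proof.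
move=> il; apply/existsP; exists (inord i.-1).
by rewrite /= ins_conn_x !inordK ?eqxx //; lia.
Qed.

Lemma delete_insc i s : (0 < i < n.*2.+2)%N -> delete_cap (insc i s).1 i = s.1.
Proof.
move=> il; have ok := insc_ok il; apply/ffunP => a; rewrite ffunE.
rewrite -[inord (skip i a)]/(emb i a) /= (ins_conn_f ok).
by case: ok => _ fK _ _; exact: fK.
Qed.

Lemma innermost_insc i s : (0 < i < n.*2.+2)%N -> wf_state s -> innermost s.1 i ->
  (forall t, s.2 = Some t -> t (inord i.-1) = false) ->
  exists2 s', s = insc i s' & wf_conn s'.1.
Proof.
move=> il ws /existsP[p /andP[/eqP p1 /eqP p2]] t0.
have ok := insc_ok il.
have E : s.1 (inord i.-1) = inord i.
  by rewrite -p1 -[in RHS]p2 !inord_val.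
have [s' Es] := insE ok ws E t0; exists s' => //.
by apply: (wf_ins_conn ok); case: ws; rewrite Es.
Qed.

End InsertCap.

(** * Every diagram is the diagram of a word *)

Section InsertPlanar.
Variable m : nat.
Local Notation n := m.+1.
Variable i : nat.
Hypothesis il : (0 < i < n.*2.+2)%N.
Let ok := insc_ok il.

Lemma emb_lt (a b : point m) : (emb i a < emb i b)%N = (a < b)%N.
Proof. by rewrite !val_emb /skip; do 2![case: ifP]; lia. Qed.

Lemma insc_noncrossing (s : state (point m)) : noncrossing (insc i s).1 -> noncrossing s.1.
Proof.
move=> nc a b [ab bc cc]; apply: (nc (emb i a) (emb i b)).
by rewrite /= !(ins_conn_f ok) !emb_lt; split.
Qed.

Lemma insc_planar (s : state (point m)) : planar (insc i s) -> wf_conn s.1 -> planar s.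
Proof.
case: s => c ot [[/= _ wt] nc dots] wc.
have cf a : ins_conn (emb i) (unemb i) (inord i.-1) (inord i) c (emb i a) = emb i (c a).
  exact: ins_conn_f ok _ _.
split=> //=; [split=> //= t | exact: (@insc_noncrossing (c, ot)) | move=> t].
  move=> E a; move: (wt (ins_dots (unemb i) (inord i.-1) (inord i) t)); rewrite E.
  by move=> /(_ erefl (emb i a)); rewrite /= cf !(ins_dots_f ok).
move=> E; have := dots (ins_dots (unemb i) (inord i.-1) (inord i) t); rewrite E /=.
move=> /(_ erefl) [out ev]; split=> [a ta q [qa aq]|].
  apply: (out (emb i a)) (emb i q) _; first by rewrite (ins_dots_f ok).
  by rewrite cf !emb_lt.
suff <- : dot_count (ins_conn (emb i) (unemb i) (inord i.-1) (inord i) c)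
   (ins_dots (unemb i) (inord i.-1) (inord i) t) = dot_count c t by [].
case: (ok) => xy fK fxy gK.
rewrite /dot_count (bigD1 (inord i.-1)) //= (bigD1 (inord i)) /=; last exact/eqP/nesym.
rewrite ins_dots_x ins_dots_y !andbF !add0n.
rewrite (reindex_onto (emb i) (unemb i)) /=; last first.
  by move=> p /andP[/eqP p1 /eqP p2]; exact: gK.
rewrite (eq_bigl xpredT) => [|a]; last first.
  by case: (fxy a) => /eqP -> /eqP ->; rewrite fK eqxx.
by apply: eq_bigr => a _; rewrite cf emb_lt (ins_dots_f ok).
Qed.

End InsertPlanar.

Section Leftmost.
Variables (n : nat) (c : conn n).
Hypothesis wc : wf_conn c.
Hypothesis nc : noncrossing c.

(** Without a cap at the bottom, the partners of the n + 1 bottom points are the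
    n + 1 top points, in decreasing order. *)
Lemma all_through : (forall p : point n, (p <= n)%N -> (n < c p)%N) -> c = conn1 n.
Proof.
move=> th; have N k : (k <= n)%N -> (inord k : point n) = k :> nat by move=> kn; rewrite inordK; lia.
have dec k : (k < n)%N -> (c (inord k.+1) < c (inord k))%N.
  move=> kn; have k1 := N k (ltnW kn); have k2 := N k.+1 kn.
  have := @nc (inord k) (inord k.+1); have := th (inord k); have := th (inord k.+1).
  rewrite k1 k2 => t1 t2 H; case: ltngtP => // [lt|/val_inj E].
    by exfalso; apply: H; split; lia.
  by have [E1 _] := wc (inord k); have [E2 _] := wc (inord k.+1);
    move: k1; rewrite -E1 -E E2 k2; lia.
have up k : (k <= n)%N -> (c (inord k) + k <= n.*2.+1)%N.
  elim: k => [|k IH] kn; first by have := ltn_ord (c (inord 0)); lia.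
  by have := dec k kn; have := IH (ltnW kn); lia.
have down k : (k <= n)%N -> (n.*2.+1 <= c (inord (n - k)) + (n - k))%N.
  elim: k => [|k IH] kn; first by have := th (inord (n - 0)); rewrite N; lia.
  have := dec (n - k.+1)%N; rewrite (_ : (n - k.+1).+1 = n - k)%N; last lia.
  by have := IH (ltnW kn); lia.
have low (p : point n) : (p <= n)%N -> c p = rev_ord p.
  move=> pn; apply: val_inj; rewrite /=; have := up p pn; have := down (n - p)%N.
  by rewrite (_ : n - (n - p) = p)%N ?inord_val; lia.
apply/ffunP => p; rewrite ffunE; have [/low //|pn] := leqP p n.
have rp : (rev_ord p <= n)%N by rewrite /=; lia.
have E := low _ rp; rewrite rev_ordK in E.
by case: (wc (rev_ord p)) => cK _; rewrite -[RHS]cK E.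
Qed.

(** The bottom chord with the smallest right end is an innermost cap. Unless it
    starts at the left boundary, the chord of the point 0 ends further right, and
    encloses it. *)
Lemma leftmost_cap : c <> conn1 n ->
  exists p : point n, [/\ (p < n)%N, c p = p.+1 :> nat & outermost c p -> p = 0 :> nat].
Proof.
move=> c1; have [[p0 Pp0]|H] := pselect (exists p : point n, (p < c p <= n)%N); last first.
  case: c1; apply: all_through => p pn; rewrite ltnNge; apply/negP => cpn.
  apply: H; have [cpK cpN] := wc p.
  have [lt|gt|/val_inj E] := ltngtP p (c p); last by case: cpN.
    by exists p; rewrite lt.
  by exists (c p); rewrite cpK gt.
case: (@arg_minnP _ p0 (fun p : point n => (p < c p <= n)%N) (fun p : point n => c p : nat) Pp0)
  => p /andP[pcp cpn] mini.
have [cpK cpN] := wc p.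
have E : c p = p.+1 :> nat.
  have [->//|ne] := eqVneq (c p : nat) p.+1.
  have pK : (p.+1 < n.*2.+2)%N by have := ltn_ord (c p); lia.
  pose q : point n := Ordinal pK.
  have [] := @nc_between _ c wc nc p q; first by split=> //=; lia.
  move=> pq qp; have [cqK cqN] := wc q.
  have [lt|gt|/val_inj E] := ltngtP q (c q); last by case: cqN.
    by have := mini q; rewrite lt /=; lia.
  by have := mini (c q); rewrite cqK gt /=; lia.
exists p; split=> //; first by lia.
move=> /(_ ord0) out; have [->//|p0'] := eqVneq (p : nat) 0.
have [c0K c0N] := wc ord0.
have n1 : (c ord0 : nat) <> 0 by move=> E0; apply: c0N; exact: val_inj.
have n2 : (c ord0 : nat) <> p.
  by move=> /val_inj E0; move: E; rewrite -E0 c0K.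
have lt0 : (0 < c ord0)%N by lia.
have := mini ord0; move: out; rewrite /= lt0; lia.
Qed.

End Leftmost.

(** In the identity connectivity only the chord of the point 1 is outer, so that
    an even number of dots is no dot. *)
Lemma good_conn1 n (s : state (point n)) : good s -> s.1 = conn1 n -> s = id_state n.
Proof.
case: s => c [t|] [[[/= wc wt] nc dots] c1] E; last by case: (c1 erefl).
rewrite /id_state -E; congr (_, Some _); have [out ev] := dots t erefl.
have tt p : t p -> p = ord0 \/ p = rev_ord ord0.
  move=> /out /(_ ord0); rewrite E ffunE /= => H.
  have := ltn_ord p; case: (eqVneq p ord0) => [|/eqP p0]; first by left.
  move=> pK; right; apply: val_inj; rewrite /=.
  have : (p : nat) <> 0 by move=> E0; apply: p0; exact: val_inj.
  by lia.
have t0 : t ord0 = false.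
  apply: contraNF ev => t0; rewrite /dot_count (bigD1 ord0) //= big1 => [|p p0].
    by rewrite E ffunE t0.
  case: (boolP (t p)) => [/tt [pE|->]|]; rewrite ?andbF //; first by rewrite pE eqxx in p0.
  by rewrite E ffunE rev_ordK.
apply/ffunP => p; rewrite ffunE; apply/negP => tp; case: (tt p tp) => pE.
  by rewrite pE t0 in tp.
by move: t0; rewrite -(wt t erefl) E ffunE -pE tp.
Qed.

Lemma conn_point0 (c : conn 0) : wf_conn c -> c = conn1 0.
Proof.
move=> wc; apply/ffunP => p; rewrite ffunE; apply: val_inj.
have : (c p : nat) != p by apply/eqP => /val_inj; case: (wc p).
move: (ltn_ord (c p)) (ltn_ord p) => /=.
by case: (nat_of_ord (c p)) => [|[|]] //; case: (nat_of_ord p) => [|[|]].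
Qed.

Definition reach n (s : state (point n)) := exists w, word_state w = s.

Lemma reach_id n : reach (id_state n).
Proof. by exists [::]. Qed.

(** A right factor can be appended, since the actions on both sides commute. *)
Lemma reach_rstep n j (s : state (point n)) : (0 < n)%N -> (j <= n)%N ->
  reach s -> reach (gstep (rpt n) j s).
Proof.
move=> n0 jn [w <-]; exists (rcons w (inord j)).
elim: w => [|i w IH] /=; first by rewrite inordK //; case: (gen_id n0 jn).
rewrite IH; have ile : (i <= n)%N by rewrite -ltnS.
by have [] := @gstep_disjoint _ (lpt n) (rpt n) n i j (word_state w)
  (fun k l => @lpt_rpt n k l n0) (@lpt_inj n) (@rpt_inj n) ile jn (word_state_wf w).
Qed.

Lemma word_state_widen m (w : seq 'I_m.+1) : (0 < m)%N ->
  let w' := map (widen_ord (leqnSn m.+1)) w in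
  word_state w' = insc m.+2 (word_state w) /\ word_loops w' = word_loops w.
Proof.
move=> m0 /=; elim: w => [|i w [IHs IHl]] /=; first by rewrite insc_top_id.
have im : (i <= m)%N by rewrite -ltnS.
by rewrite IHs IHl; have [-> ->] := insc_top_step (word_state w) m0 im.
Qed.

Lemma reach_top m (s : state (point m)) : good s -> reach s -> reach (insc m.+2 s).
Proof.
case: m s => [|m] s gs.
  move=> [w _]; suff -> : s = id_state 0 by rewrite insc_top_id; exact: reach_id.
  by apply: good_conn1 => //; apply: conn_point0; case: gs => [[[]]].
move=> [w <-]; exists (map (widen_ord (leqnSn m.+2)) w).
by have [] := @word_state_widen m.+1 w isT.
Qed.

Lemma reach_down m (s : state (point m)) i : wf_state s -> reach (insc m.+2 s) ->
  (0 < i <= m.+2)%N -> reach (insc i s).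
Proof.
move=> ws rs il; have [k ik] : exists k, (i = m.+2 - k)%N by exists (m.+2 - i)%N; lia.
rewrite {}ik in il *; elim: k il => [|k IH] ik; first by rewrite subn0.
have {IH} : reach (insc (m.+2 - k) s) by apply: IH; lia.
have [E _] := @rstep_insc m (m.+2 - k.+1) s ltac:(lia) ws.
rewrite (_ : (m.+2 - k) = (m.+2 - k.+1).+1)%N; last lia.
by move=> r; rewrite -E; apply: reach_rstep => //; lia.
Qed.

Lemma reach_up m (s : state (point m)) i : wf_state s -> reach (insc 1 s) ->
  (0 < i <= m.+1)%N -> reach (insc i s).
Proof.
move=> ws rs; case: i => // i; elim: i => [|i IH] il //.
have [<- _] := @rstep_insc_up m i.+1 s isT ltac:(lia) ws.
by apply: reach_rstep => //; apply: IH; lia.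
Qed.

(** The identity connectivity has no odd diagram, but inserting a cap in it gives
    one, which E_0 produces from the even diagram. *)
Lemma reach_odd1 m i : (0 < i <= m.+1)%N -> reach (insc i (conn1 m, None)).
Proof.
apply: reach_up; first by split=> //=; exact: conn1_wf.
have [<- _] := @rstep0_insc1 m (id_state m); apply: reach_rstep => //.
by apply: reach_down; [exact: id_wf | rewrite insc_top_id; exact: reach_id | lia].
Qed.

(** Delete the cap, use induction, and move the vertical strand added at position
    m + 2 to position i. *)
Lemma reach_undotted_cap m (s : state (point m.+1)) i : (0 < i <= m.+1)%N ->
  (forall s' : state (point m), good s' -> reach s') ->
  good s -> innermost s.1 i -> (forall t, s.2 = Some t -> t (inord i.-1) = false) ->
  reach s.
Proof.
move=> il IH gs inn t0; have il' : (0 < i < m.+1.*2.+2)%N by lia.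
have [ps _] := gs; have [ws _ _] := ps.
have [s' Es ws'] := innermost_insc il' ws inn t0.
have ps' : planar s' by apply: (insc_planar il') => //; rewrite -Es.
rewrite Es; have [gs'|gs'] := pselect (good s').
  apply: reach_down; [by case: ps' | | lia].
  by apply: reach_top => //; exact: IH.
case: s' gs' Es ps' ws' => c [t|] gs' Es ps' ws'; first by exfalso; apply: gs'; split.
have -> : c = conn1 m by apply: contrapT => c1; apply: gs'; split.
exact: reach_odd1.
Qed.

(** The cap determines the cup, and by parity the dot on the cup. *)
Lemma dotted_2strands (s s' : state (point 1)) t t' : good s -> good s' ->
  s.2 = Some t -> s'.2 = Some t' ->
  s.1 (rpt 1 0) = rpt 1 1 -> s'.1 (rpt 1 0) = rpt 1 1 ->
  t (rpt 1 0) -> t' (rpt 1 0) -> s = s'.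
Proof.
pose u := [ffun p : point 1 => inord (if odd p then p.-1 else p.+1) : point 1].
suff det (s0 : state (point 1)) t0 : good s0 -> s0.2 = Some t0 ->
    s0.1 (rpt 1 0) = rpt 1 1 -> t0 (rpt 1 0) -> s0 = (u, Some [ffun=> true]).
  by move=> g g' st st' c0 c0' tt tt'; rewrite (det s t) // (det s' t').
case: s0 => c [t1|] [[[/= wc wt] _ dots] _] //= [E] c0 tt; rewrite {}E {t1} in wt dots *.
pose r k : point 1 := inord k.
have rE k : (k < 4)%N -> r k = k :> nat by move=> k4; rewrite /r inordK.
have pE (p : point 1) : [\/ p = r 0, p = r 1, p = r 2 | p = r 3].
  have E k : (k < 4)%N -> (p : nat) = k -> p = r k.
    by move=> k4 pk; apply: val_inj; rewrite /= rE.
  move: (ltn_ord p); case pk : (nat_of_ord p) => [|[|[|[|//]]]] _.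
  - by constructor 1; apply: E.
  - by constructor 2; apply: E.
  - by constructor 3; apply: E.
  - by constructor 4; apply: E.
have rne k l : (k < 4)%N -> (l < 4)%N -> k != l -> r k <> r l.
  by move=> k4 l4 kl /(congr1 val); rewrite /= !rE // => /eqP; rewrite (negPf kl).
have c0' : c (r 0) = r 1 by [].
have c1 : c (r 1) = r 0 by rewrite -c0'; case: (wc (r 0)).
have c2 : c (r 2) = r 3.
  have [cK cN] := wc (r 2); case: (pE (c (r 2))) => // X.
  - by move: cK; rewrite X c0' => /rne; case.
  - by move: cK; rewrite X c1 => /rne; case.
have c3 : c (r 3) = r 2 by rewrite -c2; case: (wc (r 2)).
have w p : t0 (c p) = t0 p by exact: (wt t0 erefl).
have [_ ev] := dots t0 erefl.
have t2 : t0 (r 2).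
  apply: contraTT ev => /negPf t2; rewrite negbK /dot_count (bigD1 (r 0)) //= big1.
    by rewrite c0' !rE // tt.
  move=> p p0; case: (pE p) => X.
  - by rewrite X eqxx in p0.
  - by rewrite X c1 !rE.
  - by rewrite X t2 andbF.
  - by rewrite X -w c3 t2 andbF.
congr (_, Some _); apply/ffunP => p; rewrite ffunE.
  by case: (pE p) => ->; rewrite rE //= ?c0' ?c1 ?c2 ?c3.
case: (pE p) => -> //; first by rewrite -w c1.
by rewrite -w c3.
Qed.

(** An undotted innermost bottom cap reduces the rank. If the leftmost cap is
    dotted, it is at position 1, so that s E_2 E_0 = s by straightening, and
    s E_2 has an undotted cap at position 2. On two strands there is no E_2, and
    s is the diagram of E_0. *)
Lemma good_reach n (s : state (point n)) : good s -> reach s.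
Proof.
elim: n s => [|m IH] s gs.
  suff -> : s = id_state 0 by exact: reach_id.
  by apply: good_conn1 => //; apply: conn_point0; case: gs => [[[]]].
have [/good_conn1 ->//|/eqP c1] := eqVneq s.1 (conn1 m.+1); first exact: reach_id.
have [ps _] := gs; have [[wc wt] nc dots] := ps.
have [p [pm cp out]] := leftmost_cap wc nc c1.
have inn : innermost s.1 p.+1 by apply/existsP; exists p; rewrite /= cp !eqxx.
have und i (s' : state (point m.+1)) : good s' -> (0 < i <= m.+1)%N -> innermost s'.1 i ->
    (forall t, s'.2 = Some t -> t (inord i.-1) = false) -> reach s'.
  by move=> gs' il inn' t0; apply: (@reach_undotted_cap m s' i).
have [[t [Et tp]]|H] := pselect (exists t, s.2 = Some t /\ t p); last first.
  apply: (und p.+1) => //= t Et; rewrite inord_val.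
  by apply/negP => tp; apply: H; exists t.
have p0 : p = 0 :> nat by apply: out; case: (dots t Et) => /(_ p tp).
have pE : p = rpt m.+1 0 by apply: val_inj; rewrite val_rpt.
have qE : s.1 p = rpt m.+1 1 by apply: val_inj; rewrite val_rpt; [rewrite [LHS]cp p0 | lia].
case: m IH s gs c1 ps wc wt nc dots p pm cp out inn und t Et tp p0 pE qE => [|m] IH s gs
  c1 ps wc wt nc dots p pm cp out inn und t Et tp p0 pE qE.
  have [wE [tw Etw]] : good (gstep (rpt 1) 0 (id_state 1)) /\
    (exists tw, (gstep (rpt 1) 0 (id_state 1)).2 = Some tw).
    split; first by apply: rstep_good => //; exact: id_good.
    rewrite /gstep /= /dots_after /= ffunE; case: eqP => [/(congr1 val)|_]; last by eexists.
    by rewrite /= !inordK.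
  suff -> : s = gstep (rpt 1) 0 (id_state 1) by apply: reach_rstep => //; exact: reach_id.
  apply: (@dotted_2strands s (gstep (rpt 1) 0 (id_state 1)) t tw) => //.
  - by rewrite -pE.
  - exact: cup_at.
  - by rewrite -pE.
  - exact: (cup_dot Etw).
have n2 : (0 < m.+2)%N by [].
have ws : wf_state s by split.
have lp : gloop (rpt m.+2) 0 s.
  by rewrite /gloop /loop /= -pE qE Et /= tp !eqxx.
have id0 := gstep_id ws lp.
have [zz _ _] := @gstep_zigzag _ m.+2 (rpt m.+2) (@rpt_inj m.+2) 0 2 s isT isT isT ws.
rewrite id0 in zz; rewrite -zz; apply: reach_rstep => //.
have at2 : (gstep (rpt m.+2) 2 s).1 (rpt m.+2 1) = rpt m.+2 2 by exact: cup_at.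
apply: (und 2) => //.
- exact: rstep_good.
- apply/existsP; exists (rpt m.+2 1); rewrite /= -/(gstep (rpt m.+2) 2 s).
  by rewrite [fun_of_fin _ _]at2 !inordK.
- by move=> t' Et'; exact: (cup_dot Et').
Qed.

(** * Stacking generators *)

(** The diagrams before the last dot of an odd one is moved: t records the dots at
    both ends of each chord. *)
Definition dotted n (c : conn n) (t : {ffun point n -> bool}) : diag n :=
  (c, [set p : point n | (p < c p) && t p]).

Lemma card_set2 (T : finType) (x y : T) (P : pred T) : x != y ->
  #|[set z in [set x; y] | P z]| = P x + P y.
Proof.
move=> xy; rewrite -sum1_card (eq_bigl (fun z => (z \in [set x; y]) && P z)).
  rewrite big_mkcondr big_setU1 ?inE //= big_set1.
  by case: (P x); case: (P y).
by move=> z; rewrite inE.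
Qed.

Section StackGenerator.
Variables (n : nat) (i : 'I_n.+1) (c : conn n) (t : {ffun point n -> bool}).
Hypothesis n0 : 0 < n.
Hypothesis wc : wf_conn c.
Hypothesis wt : forall p, t (c p) = t p.
Local Notation pt := (point n).
Local Notation a0 := (rpt n (maxn i 1).-1).
Local Notation b0 := (rpt n (maxn i 1)).
Local Notation a := (lpt n (maxn i 1).-1).
Local Notation b := (lpt n (maxn i 1)).
Local Notation X := (gen_diag i).
Local Notation Y := (dotted c t).
Local Notation edge := (stack_edge X Y).

Let im : maxn i 1 <= n. Proof. by have := ltn_ord i; lia. Qed.
Let va0 : a0 = (maxn i 1).-1 :> nat. Proof. by rewrite /= inordK; lia. Qed.
Let vb0 : b0 = maxn i 1 :> nat. Proof. by rewrite /= inordK; lia. Qed.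
Let va : a = n.*2.+1 - (maxn i 1).-1 :> nat. Proof. by rewrite /= inordK; lia. Qed.
Let vb : b = n.*2.+1 - maxn i 1 :> nat. Proof. by rewrite /= inordK; lia. Qed.

Definition lend (p : pt) : pt := if p < c p then p else c p.

Let lendC (p : pt) : lend (c p) = lend p.
Proof.
case: (wc p) => pK /eqP; rewrite /lend pK -val_eqE /=.
by case: ltngtP.
Qed.

Let lend_or (p : pt) : lend p = p \/ lend p = c p.
Proof. by rewrite /lend; case: ifP; [left|right]. Qed.

Let lendK (p : pt) : lend (lend p) = lend p.
Proof. by case: (lend_or p) => E; rewrite {1}E ?lendC. Qed.

Let lend_eq (p r : pt) : (lend p == lend r) = (r == p) || (r == c p).
Proof.
apply/eqP/orP => [E|[/eqP->//|/eqP->]]; last by rewrite lendC.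
case: (wc p) (wc r) => pK _ [rK _].
case: (lend_or p) (lend_or r) => Ep [] Er; rewrite Ep Er in E.
- by left; rewrite E.
- by right; rewrite E rK.
- by right; rewrite E.
- by left; rewrite -rK -E pK.
Qed.

Let lend_left (p : pt) : (p < c p) = (lend p == p).
Proof.
case: (wc p) => pK /eqP cp; rewrite /lend; case: ltnP => // _; first by rewrite eqxx.
by rewrite (negPf cp).
Qed.

Let t_lend (p : pt) : t (lend p) = t p.
Proof. by case: (lend_or p) => ->; rewrite ?wt. Qed.

(** The components of the stack are the new cup (None) and the chords of the lower
    diagram, those of a and b being merged by the cap. A block of chords
    is represented by a left end; the points of the upper diagram outside the new
    cup are connected to top points of the lower one. *)
Definition block (p : pt) : pt := if lend p == lend b then lend a else lend p.
Definition block_of (u : pt + pt) : option pt :=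
  match u with
  | inl p => if (p == a) || (p == b) then None
             else Some (block (if p <= n then rev_ord p else p))
  | inr p => Some (block p)
  end.

Let vne (x y : pt) : x <> y :> nat -> (x == y) = false.
Proof. by move=> xy; apply/eqP => E; apply: xy; rewrite E. Qed.
Let a0b0 : (b0 == a0) = false. Proof. by apply: vne; rewrite va0 vb0; lia. Qed.
Let ab : (b == a) = false. Proof. by apply: vne; rewrite va vb; lia. Qed.
Let top_ab (p : pt) : p <= n -> ((p == a) = false) * ((p == b) = false).
Proof. by move=> pn; split; apply: vne; rewrite ?va ?vb; lia. Qed.
Let a0n : a0 <= n. Proof. by rewrite va0; lia. Qed.
Let b0n : b0 <= n. Proof. by rewrite vb0; lia. Qed.
Let ab_low : ((a == a0) = false) * ((a == b0) = false) *
  ((b == a0) = false) * ((b == b0) = false).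
Proof. by split; [split; [split|]|]; apply: vne; rewrite ?va ?vb ?va0 ?vb0; lia. Qed.
Let rev_le (p : pt) : (rev_ord p <= n) = (n < p).
Proof. by have := ltn_ord p; rewrite /=; lia. Qed.
Let ra : rev_ord a = a0. Proof. exact: rev_ordK. Qed.
Let rb : rev_ord b = b0. Proof. exact: rev_ordK. Qed.

Let r_eq (x y : pt) : (rev_ord x == y) = (x == rev_ord y).
Proof. by rewrite -(inj_eq (@rev_ord_inj _)) rev_ordK. Qed.

Let X_E (p : pt) : X.1 p = if p == a0 then b0 else if p == b0 then a0 else
  if p == a then b else if p == b then a else rev_ord p.
Proof. by rewrite ffunE /= !r_eq. Qed.

Lemma edge_block u v : edge u v -> block_of u = block_of v.
Proof.
have rK := @rev_ordK n.*2.+2.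
have glue (p : pt) : p <= n -> block_of (inl p) = block_of (inr (rev_ord p)).
  by move=> pn; rewrite /= !top_ab // pn.
have merge : block a = block b.
  by rewrite /block eqxx; case: eqP.
case: u v => [p|p] [r|r] /=.
- move=> /eqP ->; rewrite X_E.
  have [->|pa0] := eqVneq p a0; first by rewrite !top_ab // a0n b0n merge.
  have [->|pb0] := eqVneq p b0; first by rewrite !top_ab // a0n b0n merge.
  have [->|pa] := eqVneq p a; first by rewrite eqxx orbT.
  have [->|pb] := eqVneq p b; first by rewrite eqxx.
  rewrite !r_eq ra rb ?(negPf pa) ?(negPf pb) ?(negPf pa0) ?(negPf pb0) /= rev_le rK.
  by case: ltnP.
- by move=> /andP[pn /eqP ->]; exact: glue.
- by move=> /andP[pn /eqP ->]; exact: esym (glue _ pn).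
- by move=> /eqP ->; rewrite /block lendC.
Qed.

Let edge_sym : symmetric edge.
Proof.
have Xinv p : X.1 (X.1 p) = p.
  rewrite !X_E.
  have [->|pa0] := eqVneq p a0; first by rewrite a0b0 eqxx.
  have [->|pb0] := eqVneq p b0; first by rewrite eqxx.
  have [->|pa] := eqVneq p a; first by rewrite !ab_low ab eqxx.
  have [->|pb] := eqVneq p b; first by rewrite !ab_low eqxx.
  by rewrite !r_eq ra rb
    ?(negPf pa) ?(negPf pb) ?(negPf pa0) ?(negPf pb0) rev_ordK.
have sym (f : pt -> pt) (x y : pt) : (forall p, f (f p) = p) -> (y == f x) = (x == f y).
  by move=> fK; apply/eqP/eqP => ->.
move=> [p|p] [r|r] //=; first exact: sym.
by apply: (sym c) => x; case: (wc x).
Qed.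

Lemma connect_block u : connect edge u (if block_of u is Some p then inr p else inl a).
Proof.
have csym := sym_connect_sym edge_sym.
have low p : connect edge (inr p) (inr (block p)).
  have l : connect edge (inr p) (inr (lend p)).
    by case: (lend_or p) => -> //; apply: connect1 => /=.
  apply: connect_trans l _; rewrite /block; case: eqP => // ->.
  have l x : connect edge (inr (lend x)) (inr x).
    by case: (lend_or x) => -> //; rewrite csym; apply: connect1 => /=.
  apply: connect_trans (l b) _; rewrite csym; apply: connect_trans (l a) _.
  apply: (@connect_trans _ _ (inl a0)); first by apply: connect1; rewrite /= a0n /= eq_sym.
  apply: (@connect_trans _ _ (inl b0)); first by apply: connect1; rewrite /= X_E eqxx.
  by apply: connect1; rewrite /= b0n /=.
case: u => [p|p] /=; last exact: low.
have [->|pa] := eqVneq p a; first by [].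
have [->|pb] /= := eqVneq p b.
  by apply: connect1; rewrite /= X_E !ab_low ab !eqxx.
case: leqP => pn; first by apply: connect_trans (low _); apply: connect1; rewrite /= pn /=.
have [E|pa0] := eqVneq p a0; first by rewrite E ltnNge a0n in pn.
have [E|pb0] := eqVneq p b0; first by rewrite E ltnNge b0n in pn.
apply: connect_trans (low p); apply: (@connect_trans _ _ (inl (rev_ord p))).
  by apply: connect1; rewrite /= X_E ?(negPf pa) ?(negPf pb) ?(negPf pa0) ?(negPf pb0).
by apply: connect1; rewrite /= rev_le pn rev_ordK /=.
Qed.

(** The blocks are the connected components of the stack. *)
Lemma connect_stackE u v : connect edge u v = (block_of u == block_of v).
Proof.
apply/idP/eqP => [/connectP[p]|E]; last first.
  apply: connect_trans (connect_block u) _; rewrite E sym_connect_sym //.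
  exact: connect_block.
elim: p u => [|w p IH] u /=; first by move=> _ ->.
by case/andP => /edge_block -> /IH H /H.
Qed.

Lemma block_end (p : pt) :
  block_of (stack_end p) = if (p == a) || (p == b) then None else Some (block p).
Proof.
rewrite /stack_end; case: (leqP p n) => pn /=; first by rewrite !top_ab.
by rewrite leqNgt pn.
Qed.

Let block_merged z : (block z == lend a) = (lend z == lend a) || (lend z == lend b).
Proof. by rewrite /block; case: (lend z =P lend b) => [->|_]; rewrite ?eqxx ?orbT ?orbF. Qed.

Let block_other p z : lend p != lend a -> lend p != lend b ->
  (block z == lend p) = (lend z == lend p).
Proof.
move=> pa pb; rewrite /block; case: (lend z =P lend b) => [->|//].
by rewrite eq_sym (negPf pa) eq_sym (negPf pb).
Qed.

Let block_cases p : p != a -> p != b ->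
  ((c p == a) || (c p == b)) /\ block p = lend a \/
  [/\ (c p == a) || (c p == b) = false, lend p != lend a, lend p != lend b & block p = lend p].
Proof.
move=> pa pb; have E x : (lend p == lend x) = (x == p) || (x == c p) by exact: lend_eq.
have [cab|/norP[ca cb]] := boolP (_ || _).
  left; split=> //; apply/eqP; rewrite block_merged !E (eq_sym a (c p)) (eq_sym b (c p)).
  by case/orP: cab => ->; rewrite !orbT.
have la : lend p != lend a by rewrite E negb_or !(eq_sym a) pa ca.
have lb : lend p != lend b by rewrite E negb_or !(eq_sym b) pb cb.
by right; split=> //; rewrite /block (negPf lb).
Qed.

Lemma connect_end (p r : pt) :
  connect edge (stack_end p) (stack_end r) = (r == p) || (r == joinc a b c p).
Proof.
rewrite connect_stackE !block_end ffunE.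
have [->|pa] := eqVneq p a; first by rewrite /=; case: (_ || _).
have [->|pb] := eqVneq p b; first by rewrite /= orbC; case: (_ || _).
rewrite /=; have [ca cb cp cr] : [/\ c (c a) = a, c (c b) = b, c (c p) = p & c (c r) = r].
  by split; apply: (fun x => proj1 (wc x)).
have crab x : (lend r == lend x) = (r == x) || (r == c x).
  by rewrite eq_sym lend_eq.
have [rab|/norP[ra' rb']] := boolP (_ || _).
  apply/esym/negbTE; rewrite negb_or; apply/andP; split.
    by apply: contraTN rab => /eqP ->; rewrite negb_or pa.
  have cN x : c x != x by apply/eqP; case: (wc x).
  apply: contraTN rab => /eqP ->; case: (eqVneq (c p) a) => [E|cpa].
    rewrite negb_or cN andbT; apply: contraNneq pb => E'.
    by rewrite -cp E -E' cb.
  case: (eqVneq (c p) b) => [E|cpb]; last by rewrite negb_or cpa cpb.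
  rewrite negb_or cN; apply: contraNneq pa => E'.
  by rewrite -cp E -E' ca.
rewrite (inj_eq (@Some_inj _)) eq_sym.
have [[cab ->]|[cab la lb ->]] := block_cases pa pb.
  rewrite block_merged !crab (negPf ra') (negPf rb') /=.
  case/orP: cab => /eqP E; first by rewrite E eqxx -E cp.
  by rewrite E ab eqxx -E cp orbC.
move/norP: cab => [/negPf-> /negPf->].
by rewrite block_other // crab.
Qed.

Lemma stack_gen_conn : (stack X Y).1 = joinc a b c.
Proof.
have ne : a <> b by move=> E; move: ab; rewrite E eqxx.
apply/ffunP => p; rewrite ffunE; case: pickP => [r /andP[rp]|H] /=.
  by rewrite connect_end (negPf rp) => /eqP.
have [_ /eqP jp] := joinc_wf wc ne p.
by move: (H (joinc a b c p)); rewrite connect_end eqxx orbT jp.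
Qed.

(** Dots add up along the strands: the new cup gets d, and the strand through
    the cap those of a and b besides d. *)
Lemma stack_gen_dotted (p : pt) : stack_dotted X Y p = joint a b (i == ord0) c t p.
Proof.
rewrite /stack_dotted oddD.
have -> : odd #|[set z in X.2 | connect edge (stack_end p) (inl z)]| =
    (i == ord0) && [|| p == a, p == b, c p == a | c p == b].
  have -> : X.2 = if i == ord0 then [set a0; b] else set0 by [].
  have [i0|_] := eqVneq i ord0; last first.
    by rewrite (_ : [set z in _ | _] = set0) ?cards0 //; apply/setP => z; rewrite !inE.
  rewrite card_set2; last by rewrite eq_sym ab_low.
  have ca : block a = lend a by apply/eqP; rewrite block_merged eqxx.
  have ka0 : block_of (inl a0) = Some (lend a) by rewrite /block_of !top_ab // a0n ca.
  rewrite !connect_stackE block_end ka0 [block_of (inl b)]/block_of eqxx orbT.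
  have [//|pa] /= := eqVneq p a; have [//|pb] /= := eqVneq p b.
  rewrite addn0 oddb (inj_eq (@Some_inj _)).
  by have [[-> ->]|[-> la _ ->]] := block_cases pa pb; rewrite ?eqxx ?(negPf la).
have -> : odd #|[set z in Y.2 | connect edge (stack_end p) (inr z)]| =
    if (p == a) || (p == b) then false else
    if (c p == a) || (c p == b) then t a (+) t b else t p.
  have -> : [set z in Y.2 | connect edge (stack_end p) (inr z)] =
      [set z | [&& lend z == z, t z & block_of (stack_end p) == Some (block z)]].
    by apply/setP => z; rewrite !inE connect_stackE lend_left andbA.
  rewrite block_end.
  have [_|/norP[pa pb]] := boolP ((p == a) || (p == b)).
    by rewrite (_ : [set z | _] = set0) ?cards0 //; apply/setP => z; rewrite !inE !andbF.
  have [[cab ->]|[-> la lb ->]] := block_cases pa pb.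
    rewrite cab; have lab : lend a != lend b.
      rewrite lend_eq ab /=; case/orP: cab => /eqP E; apply/eqP => E'.
        by move/eqP: pb; apply; rewrite E' -E; case: (wc p).
      by move/eqP: pa; apply; case: (wc p) (wc a) => <- _ [<- _]; rewrite E E'.
    rewrite (_ : [set z | _] = [set z in [set lend a; lend b] | t z]).
      by rewrite card_set2 // oddD !oddb !t_lend.
    apply/setP => z; rewrite !inE (inj_eq (@Some_inj _)) [lend a == block z]eq_sym block_merged.
    have [->|zl] := eqVneq (lend z) z; first by rewrite /= andbC.
    have zN x : (z == lend x) = false.
      by apply: contraNF zl => /eqP ->; rewrite lendK.
    by rewrite !zN.
  rewrite -t_lend (_ : [set z | _] = if t (lend p) then [set lend p] else set0).
    by case: (t _); rewrite ?cards1 ?cards0.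
  apply/setP => z; rewrite !inE (inj_eq (@Some_inj _)) [lend p == block z]eq_sym block_other //.
  have [->|zl] := eqVneq (lend z) z.
    rewrite (fun_if (fun S : {set pt} => z \in S)) !inE.
    by have [->|_] := eqVneq z (lend p); rewrite ?andbF ?if_same //=; case: (t _).
  have zN : (z == lend p) = false by apply: contraNF zl => /eqP ->; rewrite lendK.
  by rewrite (fun_if (fun S : {set pt} => z \in S)) !inE zN if_same.
rewrite ffunE.
case: (p == a); first by rewrite addbF andbT.
case: (p == b); first by rewrite addbF andbT.
by rewrite /=; case: (_ || _); rewrite ?andbT ?andbF // addbC.
Qed.

(** Stacking a generator on a diagram is multiplication by a cap-cup pair, whether
    or not a loop is closed. *)
Lemma stack_gen : stack X Y = dotted (joinc a b c) (joint a b (i == ord0) c t).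
Proof.
rewrite [stack _ _]surjective_pairing /dotted stack_gen_conn; congr pair.
apply/setP => p; rewrite !inE stack_gen_dotted.
by have -> : stack_conn X Y = joinc a b c by exact: stack_gen_conn.
Qed.

End StackGenerator.

Section WordDiagram.
Variable n : nat.
Hypothesis n0 : 0 < n.

(** The chord {a, b} is replaced by a cup with the opposite dot. *)
Lemma dot_count_flip (c : conn n) (t : {ffun point n -> bool}) (a b : point n) d :
  wf_conn c -> (forall p, t (c p) = t p) -> c a = b -> b < a -> t a != d ->
  odd (dot_count c (joint a b d c t)) = ~~ odd (dot_count c t).
Proof.
move=> wc wt cab ba ta; have [caK _] := wc a; have cba : c b = a by rewrite -cab.
rewrite /dot_count (bigD1 b) // [in RHS](bigD1 b) //= cba ba ffunE eqxx orbT /=.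
have tb : t b = t a by rewrite -cab wt.
rewrite !oddD !oddb tb (eq_bigr (fun p : point n => ((p < c p) && t p) : nat)).
  by move: ta; case: (t a); case: (d); case: (odd _).
move=> p pb; rewrite ffunE (negPf pb) orbF.
have [->|pa] /= := eqVneq p a; first by rewrite cab ltnNge ltnW.
have [E|_] := eqVneq (c p) a.
  by move: pb; case: (wc p) => <- _; rewrite E cab eqxx.
have [E|//] := eqVneq (c p) b.
by move: pa; case: (wc p) => <- _; rewrite E cba eqxx.
Qed.

(** Stacking keeps all the dots, and moves one only at the end, whereas states
    forget them as soon as their number is odd. Both agree on words which do not
    close an undotted loop. *)
Lemma word_dotted (w : seq 'I_n.+1) : word_loops w = 0 ->
  let s := word_state w in
  exists t, [/\ foldr (fun i => stack (gen_diag i)) (diag1 n) w = dotted s.1 t,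
    forall p, t (s.1 p) = t p
    & if s.2 is Some t' then t = t' else odd (dot_count s.1 t)].
Proof.
elim: w => [|i w IH] /= => [_|/eqP].
  exists [ffun=> false]; split=> [|p|//]; last by rewrite !ffunE.
  by congr pair; apply/setP => p; rewrite !inE [X in _ && X]ffunE andbF.
rewrite addn_eq0 eqb0 => /andP[/eqP/IH [t [-> wt ts]] nl].
have [[wc wt'] _ _] := proj1 (word_state_good w n0).
have im : maxn i 1 <= n by have := ltn_ord i; lia.
have v1 := @val_lpt n (maxn i 1); have v0 := @val_lpt n (maxn i 1).-1.
have [_ _ dots] := proj1 (word_state_good w n0).
move: nl; rewrite /gstep /gloop /cup /loop /dots_after.
case: (word_state w) ts wt wc wt' dots => c ot /= ts wt wc wt' dots nl.
move: nl v0 v1; set a := lpt n (maxn i 1).-1; set b := lpt n (maxn i 1) => nl v0 v1.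
have ba : a = b.+1 :> nat by rewrite v0 ?v1; lia.
have nba : b <> a by move=> E; move: ba; rewrite E; lia.
exists (joint a b (i == ord0) c t); rewrite stack_gen //.
have i0 : (i == ord0) = (i == 0 :> nat) by [].
have [cab|/eqP cab] := eqVneq (c a) b.
  have [cK _] := wc a; rewrite cab eqxx /= in nl; have cba : c b = a by rewrite -cab.
  case: ot ts nl wt' dots => [t' tt'|//] nl wt' dots; rewrite tt' in wt *.
  rewrite (negPf nl) joinc_id // dot_count_flip //; last by rewrite ba.
  have [_ ev] := dots t' erefl; split=> // p; rewrite !ffunE; have [cpK _] := wc p.
  have inj x y : (c x == y) = (x == c y).
    by apply/eqP/eqP => [<-|->]; [case: (wc x)|case: (wc y)].
  by rewrite !(cab, cba, inj); case: (p == a); case: (p == b); rewrite ?wt.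
have cba : c b <> a by move=> E; apply: cab; rewrite -E; case: (wc b).
split=> //.
  by move=> p; rewrite joint_wf //; exact: nesym.
case: ot ts {wt' dots nl} => [t' ->//|] /= ts.
rewrite (joincC wc (nesym nba)) (jointC _ _ _ (nesym nba)).
by rewrite dot_count_joint.
Qed.

Lemma word_diag_state (w : seq 'I_n.+1) : word_loops w = 0 ->
  word_diag w = diag_of (word_state w).
Proof.
move=> /word_dotted; have [[_ _ dots] _] := word_state_good w n0.
rewrite /word_diag /diag_of; case: (word_state w) dots => c [t'|] /= dots [t [-> _]] H.
  by have [_ ev] := dots t' erefl; rewrite H /= card_dots (negPf ev).
by rewrite /= card_dots H.
Qed.

End WordDiagram.

Local Open Scope ring_scope.

(** * Modules and homomorphisms *)

Section Linear.
Variables (K : pzRingType) (V W : lmodType K) (f : V -> W).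
Hypothesis fL : forall c x y, f (c *: x + y) = c *: f x + f y.

Lemma lin0 : f 0 = 0.
Proof. by have := fL (-1) 0 0; rewrite scaler0 addr0 scaleN1r addNr. Qed.

Lemma linD x y : f (x + y) = f x + f y.
Proof. by have := fL 1 x y; rewrite !scale1r. Qed.

Lemma linZ c x : f (c *: x) = c *: f x.
Proof. by have := fL c x 0; rewrite lin0 !addr0. Qed.

End Linear.

Section Action.
Variables (F : fieldType) (q : F) (n : nat) (M : lmodType F).
Variable T : 'I_n.+1 -> M -> M.
Hypothesis T_lin : forall i c u v, T i (c *: u + v) = c *: T i u + T i v.

(* Operators satisfying the relations define a module structure: words act by
   composition, and the two-sided ideal of the relations acts by zero. *)
Definition act_word (w : seq 'I_n.+1) (v : M) : M := foldr T v w.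

Lemma act_word_lin w c u v :
  act_word w (c *: u + v) = c *: act_word w u + act_word w v.
Proof. by elim: w => //= i w ->; exact: T_lin. Qed.

Lemma act_word0 w : act_word w 0 = 0.
Proof. exact: lin0 (act_word_lin w). Qed.

Lemma act_wordD w u v : act_word w (u + v) = act_word w u + act_word w v.
Proof. exact: linD (act_word_lin w) u v. Qed.

Lemma act_wordZ w c v : act_word w (c *: v) = c *: act_word w v.
Proof. exact: linZ (act_word_lin w) c v. Qed.

Definition act_free (x : freeD F n) (v : M) : M :=
  \sum_(k <- msupp x) x@_k *: act_word k v.

Lemma act_freeEw (d : {fset {fmonom 'I_n.+1}}) x v :
  (msupp x `<=` d)%fset -> act_free x v = \sum_(k <- d) x@_k *: act_word k v.
Proof.
move=> le; rewrite [LHS](big_fset_incl _ le) => //= k kd /mcoeff_outdom ->.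
by rewrite scale0r.
Qed.

Lemma act_free_linl c x y v :
  act_free (c *: x + y) v = c *: act_free x v + act_free y v.
Proof.
pose d := (msupp x `|` msupp y)%fset.
rewrite (@act_freeEw d x) ?fsubsetUl // (@act_freeEw d y) ?fsubsetUr //.
rewrite (@act_freeEw d).
  rewrite scaler_sumr -big_split /=; apply: eq_bigr => k _.
  by rewrite mcoeffD mcoeffZ scalerDl scalerA.
apply: fsubset_trans (msuppD_le _ _) _.
by apply: fsetSU; exact: msuppZ_le.
Qed.

Lemma act_freeDl x y v : act_free (x + y) v = act_free x v + act_free y v.
Proof. by rewrite -[x]scale1r act_free_linl !scale1r. Qed.

Lemma act_free0l v : act_free 0 v = 0.
Proof. by rewrite /act_free msupp0 big_seq_fset0. Qed.

Lemma act_free0r x : act_free x 0 = 0.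
Proof. by rewrite /act_free big1 // => k _; rewrite act_word0 scaler0. Qed.

Lemma act_freeZl c x v : act_free (c *: x) v = c *: act_free x v.
Proof. by rewrite -[c *: x]addr0 act_free_linl act_free0l addr0. Qed.

Lemma act_freeBl x y v : act_free (x - y) v = act_free x v - act_free y v.
Proof. by rewrite -(scaleN1r y) addrC act_free_linl scaleN1r addrC. Qed.

Lemma act_freeU c k v : act_free << c *g k >> v = c *: act_word k v.
Proof. by rewrite (act_freeEw _ msuppU_le) big_seq_fset1 mcoeffUU. Qed.

Lemma act_free_sum (I : Type) (r : seq I) (G : I -> freeD F n) v :
  act_free (\sum_(i <- r) G i) v = \sum_(i <- r) act_free (G i) v.
Proof.
elim: r => [|i r IH]; first by rewrite !big_nil act_free0l.
by rewrite !big_cons act_freeDl IH.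
Qed.

Lemma act_freeM x y v : act_free (x * y) v = act_free x (act_free y v).
Proof.
rewrite malgM_def /fgmul act_free_sum.
rewrite [RHS]/act_free; apply: eq_bigr => k _.
rewrite act_free_sum [act_free y v]/act_free.
elim: (enum_fset (msupp y)) => [|l r IH].
  by rewrite !big_nil act_word0 scaler0.
rewrite !big_cons act_wordD scalerDr IH; congr (_ + _).
rewrite act_freeU act_wordZ scalerA; congr (_ *: _).
by rewrite fmM /act_word foldr_cat.
Qed.

Lemma act_freeGen i v : act_free (freeGen F i) v = T i v.
Proof. by rewrite /freeGen act_freeU scale1r fmuE. Qed.

Hypothesis T_sq : forall i v, T i (T i v) = - qint q 2 *: T i v.
Hypothesis T_adj : forall (i j : 'I_n.+1) v, adjD i j -> T i (T j (T i v)) = T i v.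
Hypothesis T_comm : forall (i j : 'I_n.+1) v, i != j -> ~~ adjD i j ->
  T i (T j v) = T j (T i v).

Lemma act_free_rel x : relD q x -> forall v, act_free x v = 0.
Proof.
elim=> [i|i j ij|i j ij nij||y z _ IHy _ IHz|y z _ IH|y z _ IH] v.
- by rewrite act_freeDl act_freeZl act_freeM 2!act_freeGen T_sq scaleNr addNr.
- by rewrite act_freeBl 2!act_freeM 3!act_freeGen (T_adj v ij) subrr.
- have E a b : act_free (freeGen F a * freeGen F b) v = T a (T b v).
    by rewrite act_freeM 2!act_freeGen.
  rewrite act_freeBl; apply/eqP; rewrite subr_eq0; apply/eqP.
  exact: etrans (E i j) (etrans (T_comm v ij nij) (esym (E j i))).
- exact: act_free0l.
- by rewrite act_freeDl IHy IHz addr0.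
- by rewrite act_freeM IH act_free0r.
- by rewrite act_freeM IH.
Qed.

Definition act (x : TLD q n) (v : M) : M := act_free (repr x) v.

Lemma act_pi x v : act (piD q x) v = act_free x v.
Proof.
apply/eqP; rewrite -subr_eq0 -act_freeBl; apply/eqP.
apply: act_free_rel; apply/idealDP; apply/piDP.
by rewrite piD_repr.
Qed.

Lemma act_linl c x y v : act (c *: x + y) v = c *: act x v + act y v.
Proof.
rewrite -[x]piD_repr -[y]piD_repr.
by rewrite -[c *: piD q (repr x)]piDZ -piDD !act_pi act_free_linl.
Qed.

Lemma actM x y v : act (x * y) v = act x (act y v).
Proof.
rewrite -[x]piD_repr -[y]piD_repr.
by rewrite -[piD q (repr x) * _]piDM !act_pi act_freeM.
Qed.

Lemma act1 v : act 1 v = v.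
Proof. by rewrite -[1]/(piD q 1) act_pi act_freeU scale1r fm1. Qed.

Lemma act_gen i v : act (genE i) v = T i v.
Proof. by rewrite /genE act_pi act_freeGen. Qed.

Lemma act_wordE w v : act (word q w) v = act_word w v.
Proof.
elim: w => [|i w IH]; first by rewrite /word big_nil act1.
by rewrite /word big_cons actM act_gen -/(word q w) IH.
Qed.

End Action.

Section TLDBasics.
Variables (F : fieldType) (q : F) (n : nat).
Local Notation A := (TLD q n).

Lemma word_nil : word q [::] = 1 :> A.
Proof. by rewrite /word big_nil. Qed.

Lemma word_cons i w : word q (i :: w) = genE i * word q w :> A.
Proof. by rewrite /word big_cons. Qed.

Lemma word_cat u w : word q (u ++ w) = word q u * word q w :> A.
Proof. by rewrite /word big_cat. Qed.

Lemma piD_malg (k : {fmonom 'I_n.+1}) : piD q << k >> = word q k.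
Proof.
case: k; elim=> [|i w IH]; first by rewrite word_nil -fmoneE.
rewrite word_cons -IH /genE -[RHS]piDM; congr piD.
rewrite malgM_def fgmulUU mulr1; congr mkmalgU.
by apply/eqP; rewrite fmP fmM fmuE.
Qed.

Lemma piD0 : piD q 0 = 0 :> A.
Proof. exact: (raddf0 \pi_(Quotient.quot (idealD q (n := n)))%qT). Qed.

(** Words span the algebra. *)
Lemma TLD_ind (P : A -> Prop) :
  P 0 -> (forall c w x, P x -> P (c *: word q w + x)) -> forall x, P x.
Proof.
move=> P0 PS x; rewrite -[x]piD_repr [repr x]monalgE.
elim: (enum_fset _) => [|k s IH]; first by rewrite big_nil piD0.
rewrite big_cons piDD; set c := (repr x)@_k.
have kE : << c *g k >> = c *: << k >> :> freeD F n.
  apply/malgP => l; rewrite mcoeffU mcoeffZ mcoeffU1.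
  by rewrite mulr_natr.
have -> : piD q << c *g k >> = c *: word q k.
  by rewrite kE -piD_malg; exact: piDZ.
exact: PS.
Qed.

Lemma TLD_ext (V : lmodType F) (f g : A -> V) :
  (forall c x y, f (c *: x + y) = c *: f x + f y) ->
  (forall c x y, g (c *: x + y) = c *: g x + g y) ->
  (forall w, f (word q w) = g (word q w)) -> forall x, f x = g x.
Proof.
move=> fL gL fg; elim/TLD_ind => [|c w x IH]; first by rewrite (lin0 fL) (lin0 gL).
by rewrite fL gL IH fg.
Qed.

Lemma TLD_sq i : genE i * genE i = - qint q 2 *: genE i :> A.
Proof.
apply/eqP; rewrite scaleNr -subr_eq0 opprK; apply/eqP.
rewrite /genE -[piD q _ * _]piDM -[_ *: _]piDZ -piDD.
rewrite -piD0; apply/piDP; rewrite subr0; apply/idealDP; exact: relD_sq.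
Qed.

Lemma TLD_adj (i j : 'I_n.+1) : adjD i j -> genE i * genE j * genE i = genE i :> A.
Proof.
move=> ij; rewrite /genE -[piD q _ * _]piDM -[piD q (_ * _) * _]piDM.
by apply/piDP/idealDP; exact: relD_adj.
Qed.

Lemma TLD_comm (i j : 'I_n.+1) : i != j -> ~~ adjD i j -> genE i * genE j = genE j * genE i :> A.
Proof.
move=> ij nij; rewrite /genE -[LHS]piDM -[RHS]piDM.
by apply/piDP/idealDP; exact: relD_comm.
Qed.

End TLDBasics.

(** Generators satisfying the relations in an algebra act on it by left
    multiplication; the image of 1 is a homomorphism. *)
Section Hom.
Variables (F : fieldType) (q : F) (m : nat) (A : algType F) (e : 'I_m.+1 -> A).
Hypothesis e_sq : forall i, e i * e i = - qint q 2 *: e i.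
Hypothesis e_adj : forall i j : 'I_m.+1, adjD i j -> e i * e j * e i = e i.
Hypothesis e_comm : forall i j : 'I_m.+1, i != j -> ~~ adjD i j ->
  e i * e j = e j * e i.

Let T (i : 'I_m.+1) (v : A) := e i * v.

Let T_lin i c u v : T i (c *: u + v) = c *: T i u + T i v.
Proof. by rewrite /T mulrDr scalerAr. Qed.
Let T_sq i v : T i (T i v) = - qint q 2 *: T i v.
Proof. by rewrite /T mulrA e_sq scalerAl. Qed.
Let T_adj (i j : 'I_m.+1) v : adjD i j -> T i (T j (T i v)) = T i v.
Proof. by move=> ij; rewrite /T !mulrA e_adj. Qed.
Let T_comm (i j : 'I_m.+1) v : i != j -> ~~ adjD i j -> T i (T j v) = T j (T i v).
Proof. by move=> ij nij; rewrite /T !mulrA e_comm. Qed.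

Definition tlhom (x : TLD q m) : A := act T x 1.

Lemma tlhom_lin c x y : tlhom (c *: x + y) = c *: tlhom x + tlhom y.
Proof. exact: act_linl. Qed.

Lemma tlhom_act x v : act T x v = tlhom x * v.
Proof.
have act0 u : act T (0 : TLD q m) u = 0.
  exact: (lin0 (f := fun x => act T x u) (fun c x y => act_linl T_lin T_sq T_adj T_comm c x y u)).
elim/TLD_ind: x v => [|c w x IH] v; first by rewrite /tlhom !act0 mul0r.
rewrite /tlhom !act_linl // IH mulrDl -scalerAl; congr (_ *: _ + _).
rewrite !act_wordE //; elim: w => [|i w IHw]; first by rewrite /= mul1r.
by rewrite [LHS]/= IHw /T mulrA.
Qed.

Lemma tlhom1 : tlhom 1 = 1.
Proof. exact: act1. Qed.

Lemma tlhomM x y : tlhom (x * y) = tlhom x * tlhom y.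
Proof. by rewrite -[RHS]tlhom_act /tlhom actM. Qed.

Lemma tlhom_gen i : tlhom (genE i) = e i.
Proof. by rewrite /tlhom act_gen // /T mulr1. Qed.

Lemma tlhom0 : tlhom 0 = 0.
Proof. exact: lin0 tlhom_lin. Qed.

Lemma tlhom_word w : tlhom (word q w) = \prod_(i <- w) e i.
Proof.
elim: w => [|i w IH]; first by rewrite word_nil big_nil tlhom1.
by rewrite word_cons big_cons tlhomM tlhom_gen IH.
Qed.

End Hom.

(** The relations are symmetric under reversal of words, so that right
    multiplication defines an anti-homomorphism. *)
Section AntiHom.
Variables (F : fieldType) (q : F) (m : nat) (A : algType F) (e : 'I_m.+1 -> A).
Hypothesis e_sq : forall i, e i * e i = - qint q 2 *: e i.
Hypothesis e_adj : forall i j : 'I_m.+1, adjD i j -> e i * e j * e i = e i.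
Hypothesis e_comm : forall i j : 'I_m.+1, i != j -> ~~ adjD i j ->
  e i * e j = e j * e i.

Let T (i : 'I_m.+1) (v : A) := v * e i.

Let T_lin i c u v : T i (c *: u + v) = c *: T i u + T i v.
Proof. by rewrite /T mulrDl scalerAl. Qed.
Let T_sq i v : T i (T i v) = - qint q 2 *: T i v.
Proof. by rewrite /T -mulrA e_sq scalerAr. Qed.
Let T_adj (i j : 'I_m.+1) v : adjD i j -> T i (T j (T i v)) = T i v.
Proof. by move=> ij; rewrite /T -!mulrA (mulrA (e i)) e_adj. Qed.
Let T_comm (i j : 'I_m.+1) v : i != j -> ~~ adjD i j -> T i (T j v) = T j (T i v).
Proof. by move=> ij nij; rewrite /T -!mulrA (e_comm ij nij). Qed.

Definition tlanti (x : TLD q m) : A := act T x 1.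

Lemma tlanti_lin c x y : tlanti (c *: x + y) = c *: tlanti x + tlanti y.
Proof. exact: act_linl. Qed.

Lemma tlanti_word w : tlanti (word q w) = \prod_(i <- rev w) e i.
Proof.
rewrite /tlanti act_wordE //; elim: w => [|i w IH]; first by rewrite big_nil.
by rewrite [LHS]/= IH rev_cons -cats1 big_cat big_seq1.
Qed.

Lemma tlantiM x y : tlanti (x * y) = tlanti y * tlanti x.
Proof.
have -> : tlanti (x * y) = act T x (tlanti y) by exact: actM.
move: (tlanti y) => v; move: x.
apply: (TLD_ext (f := fun x => act T x v) (g := fun x => v * tlanti x)).
- by move=> c u w; exact: act_linl.
- by move=> c u w; rewrite tlanti_lin mulrDr scalerAr.
move=> w; rewrite tlanti_word act_wordE //; elim: w => [|i w IHw].
  by rewrite big_nil mulr1.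
by rewrite [LHS]/= IHw /T rev_cons -cats1 big_cat big_seq1 mulrA.
Qed.

Lemma tlanti_gen i : tlanti (genE i) = e i.
Proof. by rewrite /tlanti act_gen // /T mul1r. Qed.

Lemma tlanti0 : tlanti 0 = 0.
Proof. exact: lin0 tlanti_lin. Qed.

End AntiHom.

(** * The clasp *)

Section QuantumIntegers.
Variables (F : fieldType) (q : F).
Hypothesis q_neq0 : q != 0.
Hypothesis qint_neq0 : forall m, (0 < m)%N -> qint q m != 0.

Lemma q_sub_neq0 : q - q^-1 != 0.
Proof.
apply: contraNneq (qint_neq0 (isT : 0 < 1)%N) => q0.
by rewrite /qint q0 invr0 mulr0.
Qed.

Lemma qint0 : qint q 0 = 0.
Proof. by rewrite /qint expr0 invr1 subrr mul0r. Qed.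

Lemma qint2 : qint q 2 = q + q^-1.
Proof.
apply: (mulIf q_sub_neq0); rewrite /qint divfK ?q_sub_neq0 //.
by field.
Qed.

Lemma qint_double m : (0 < m)%N -> qint q (2 * m) / qint q m = q ^+ m + q ^- m.
Proof.
move=> m0; apply: (mulIf (qint_neq0 m0)); rewrite divfK ?qint_neq0 //.
rewrite /qint mulrA; congr (_ / _); rewrite mulnC exprM.
by field; rewrite expf_neq0.
Qed.

Lemma qint_rec m : qint q m.+2 + qint q m = qint q 2 * qint q m.+1.
Proof.
rewrite qint2 /qint -mulrDl mulrA; congr (_ / _).
by rewrite !exprS; field; rewrite ?expf_neq0 ?q_neq0.
Qed.

Lemma coefgE n i : (1 < i)%N ->
  coefg q n i = qint q n / qint q (2 * n) * (q ^+ i.-1 + q ^- i.-1).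
Proof.
case: i => [|[|i]] // _; rewrite /coefg /= -(@qint_double i.+1) //.
by rewrite (_ : 2 * i.+2 - 2 = 2 * i.+1)%N ?subn1 /= ?mulf_div //; lia.
Qed.

Lemma coefg_rec n i : (2 < i)%N ->
  coefg q n i.+1 + coefg q n i.-1 = qint q 2 * coefg q n i.
Proof.
case: i => [|[|[|i]]] // _; rewrite !coefgE //= qint2.
move: (_ / _) => c; rewrite !exprS; field.
by rewrite ?expf_neq0 ?q_neq0.
Qed.

Lemma coefg1 n : coefg q n 1 = qint q n / qint q (2 * n).
Proof. by []. Qed.

Lemma coefg_rec2 n : coefg q n 3 + coefg q n 1 *+ 2 = qint q 2 * coefg q n 2.
Proof.
rewrite coefg1 !coefgE //= qint2 -mulr_natr; move: (_ / _) => c.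
by rewrite !exprS expr0; field; rewrite ?expf_neq0 ?q_neq0.
Qed.

Lemma coefg_rec1 n : coefg q n 2 = qint q 2 * coefg q n 1.
Proof. by rewrite coefg1 coefgE //= qint2 mulrC expr1. Qed.

Lemma coefg_top n : (0 < n)%N -> coefg q n n.+1 = 1.
Proof.
move=> n0; rewrite coefgE //= -qint_double // mulf_div [X in _ / X]mulrC.
by rewrite divff // mulf_neq0 // qint_neq0 // muln_gt0.
Qed.

Lemma coefhE n i :
  coefh q n i = qint q n / qint q (2 * n) / qint q n.+1 * qint q (n.+1 - i).
Proof. by rewrite /coefh addn1 invfM mulrACA (mulrC (qint q (_ - _))) mulrA. Qed.

Lemma coefh_rec n i : (0 < i <= n)%N ->
  coefh q n i.+1 + coefh q n i.-1 = qint q 2 * coefh q n i.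
Proof.
case: i => [|i] //= ile; rewrite !coefhE -mulrDr mulrCA; congr (_ * _).
rewrite (_ : n.+1 - i = (n.+1 - i.+2).+2)%N; last lia.
by rewrite (_ : n.+1 - i.+1 = (n.+1 - i.+2).+1)%N 1?addrC ?qint_rec //; lia.
Qed.

Lemma coefh_rec1 n : coefg q n 1 + coefh q n 2 = qint q 2 * coefh q n 1.
Proof.
case: n => [|n].
  by rewrite coefg1 !coefhE qint0 !mul0r mulr0 addr0.
rewrite coefg1 -(@coefh_rec n.+1 1) //= addrC; congr (_ + _).
by rewrite coefhE subn0 divfK // qint_neq0.
Qed.

Lemma coefh_top n : coefh q n n.+1 = 0.
Proof. by rewrite coefhE subnn qint0 mulr0. Qed.

End QuantumIntegers.

Lemma sumr_eq_nat (R : pzSemiRingType) (a b k : nat) (f : nat -> R) :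
  \sum_(a <= i < b) f i * (i == k)%:R = if (a <= k < b)%N then f k else 0.
Proof.
transitivity (\sum_(a <= i < b | i == k) f i); last exact: big_nat1_eq.
rewrite [RHS]big_mkcond /=; apply: eq_bigr => i _.
by case: eqP => _; rewrite ?mulr1 ?mulr0.
Qed.

Section Runs.
Variables (F : fieldType) (A : algType F) (n : nat) (e : nat -> A).

(* In terms of words, run i is E_n E_(n-1) ... E_i, run0 is E_n ... E_2 E_0 and
   odd_run i is E_n ... E_2 E_1 E_0 E_2 ... E_i. *)
Fixpoint down m : A := if m is m'.+1 then down m' * e (n - m') else 1.
Fixpoint up k : A := if k is k'.+1 then up k' * e k'.+2 else 1.

Definition run i : A := down (n.+1 - i).
Definition run0 : A := run 2 * e 0.
Definition odd_run i : A := run 1 * e 0 * up i.-1.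

Lemma run_top : run n.+1 = 1.
Proof. by rewrite /run subnn. Qed.

Lemma runS i : (i <= n)%N -> run i = run i.+1 * e i.
Proof.
move=> ile; rewrite /run (_ : n.+1 - i = (n.+1 - i.+1).+1)%N /=; last lia.
by congr (_ * e _); lia.
Qed.

Lemma odd_runS i : (0 < i)%N -> odd_run i.+1 = odd_run i * e i.+1.
Proof. by case: i => // i _; rewrite /odd_run /= !mulrA. Qed.

End Runs.

Section Clasp.
Variables (F : fieldType) (q : F) (A : algType F) (n : nat) (e : nat -> A).
Hypothesis q_neq0 : q != 0.
Hypothesis qint_neq0 : forall m, (0 < m)%N -> qint q m != 0.
Hypothesis n_gt0 : (0 < n)%N.
Hypothesis e_sq : forall i, (i <= n)%N -> e i * e i = - qint q 2 *: e i.
Hypothesis e_adj : forall i j, (i <= n)%N -> (j <= n)%N -> adjD i j ->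
  e i * e j * e i = e i.
Hypothesis e_comm : forall i j, (i <= n)%N -> (j <= n)%N -> i != j -> ~~ adjD i j ->
  e i * e j = e j * e i.
Local Notation down := (down n e).
Local Notation up := (up e).
Local Notation run := (run n e).
Local Notation run0 := (run0 n e).
Local Notation odd_run := (odd_run n e).

(** The element by which the projector of rank n - 1 is multiplied to obtain the
    one of rank n. *)
Definition clasp : A :=
  \sum_(2 <= i < n.+2) coefg q n i *: run i
  + coefg q n 1 *: (run 1 + run0)
  + \sum_(1 <= i < n.+1) coefh q n i *: odd_run i.

Lemma clasp_aug (f : A -> F) :
  (forall x y, f (x + y) = f x + f y) -> (forall c x, f (c *: x) = c * f x) ->
  (forall x y, f (x * y) = f x * f y) -> f 1 = 1 -> (forall i, f (e i) = 0) ->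
  f clasp = 1.
Proof.
move=> fD fZ fM f1 fe.
have f0 : f 0 = 0 by rewrite -(scale0r (0 : A)) fZ mul0r.
have f_sum (a b : nat) (c : nat -> F) (y : nat -> A) :
    f (\sum_(a <= i < b) c i *: y i) = \sum_(a <= i < b) c i * f (y i).
  by rewrite (big_morph f fD f0); apply: eq_bigr => i _; exact: fZ.
have f_down m : (0 < m)%N -> f (down m) = 0 by case: m => // m _; rewrite /= fM fe mulr0.
rewrite /clasp !fD fZ fD !f_sum.
rewrite big_nat_recr //= coefg_top // mul1r run_top f1.
rewrite big_nat big1 ?add0r => [|i /andP[i1 iln]]; last first.
  by rewrite /run f_down ?mulr0 // subn_gt0.
rewrite {1}/run f_down ?subn_gt0 // /run0 fM fe mulr0.
rewrite addr0 mulr0 addr0 big_nat big1 ?addr0 // => i /andP[i1 iln].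
by rewrite /odd_run !fM fe mulr0 mul0r mulr0.
Qed.

Variable P : A.
Hypothesis P_kill : forall j, (1 < n)%N -> (j < n)%N -> P * e j = 0.

(* The elements P run i, P run0 and P odd_run i span a right module: a generator
   sends each of them to a multiple of one of them. *)
Definition PR i := P * run i.
Definition PO i := P * odd_run i.

Lemma PRS (i : nat) : (i <= n)%N -> PR i = PR i.+1 * e i.
Proof. by move=> ile; rewrite /PR runS // mulrA. Qed.

Lemma POS (i : nat) : (0 < i)%N -> PO i.+1 = PO i * e i.+1.
Proof. by move=> i0; rewrite /PO odd_runS // mulrA. Qed.

(** Such an e j commutes with run i, and meets P, which kills it. *)
Lemma run_kill_low i j : (2 < i <= n.+1)%N -> (j.+1 < i)%N -> (1 < n)%N ->
  PR i * e j = 0.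
Proof.
move=> /andP[i2 ile] ji n1.
have [k ik] : exists k, (i + k = n.+1)%N by exists (n.+1 - i)%N; lia.
elim: k i ik i2 ile ji => [|k IH] i ik i2 ile ji.
  rewrite addn0 in ik; rewrite ik /PR run_top mulr1 P_kill //; lia.
rewrite PRS; last lia.
rewrite -mulrA e_comm; [|lia|lia|lia|]; last adj_lia.
by rewrite mulrA IH ?mul0r //; lia.
Qed.

(** Here e j moves left to e j e (j - 1), straightens it to e j, and leaves run j
    followed by e (j - 2), which is of the previous kind. *)
Lemma run_kill_high i j : (1 < i)%N -> (i.+1 < j <= n)%N -> PR i * e j = 0.
Proof.
move=> i2 /andP[ij jn].
have [k ijk] : exists k, (i + k = j)%N by exists (j - i)%N; lia.
elim: k i ijk i2 ij => [|k IH] i ijk i2 ij; first lia.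
rewrite PRS; last lia.
rewrite -mulrA e_comm; [|lia|lia|lia|]; last adj_lia.
rewrite mulrA; have [ij2|ij2] := eqVneq j i.+2; last by rewrite IH ?mul0r //; lia.
rewrite PRS; last lia.
rewrite PRS; last lia.
rewrite ij2 -(mulrA (PR _)) -(mulrA (PR _)) e_adj; [|lia|lia|]; last adj_lia.
rewrite -PRS; last lia.
by rewrite run_kill_low //; lia.
Qed.

Definition PR0 := PR 2 * e 0.

Lemma comm01 : e 0 * e 1 = e 1 * e 0.
Proof. by apply: e_comm. Qed.

Lemma odd_run1E : PO 1 = PR 1 * e 0.
Proof. by rewrite /PO /odd_run /= mulr1 mulrA. Qed.

Lemma odd_run1E0 : PO 1 = PR0 * e 1.
Proof. by rewrite odd_run1E PRS // /PR0 -!mulrA comm01. Qed.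

Lemma run_gen i j : (1 < i <= n.+1)%N -> (1 < j <= n)%N ->
  PR i * e j = ((i == j)%:R * - qint q 2 + (i == j.+1)%:R + (i.+1 == j)%:R) *: PR j.
Proof.
move=> /andP[i1 iln] /andP[j1 jn].
have [->|nij] := eqVneq i j.
  have -> : (j == j.+1) = false by lia.
  have -> : (j.+1 == j) = false by lia.
  by rewrite mul1r !addr0 PRS // -mulrA e_sq // scalerAr.
have [->|nij1] := eqVneq i j.+1.
  rewrite (_ : (j.+2 == j) = false); last lia.
  by rewrite mul0r add0r addr0 scale1r -PRS.
have [ij|nij2] := eqVneq i.+1 j.
  rewrite mul0r !add0r scale1r (@PRS i); last lia.
  rewrite ij (@PRS j) // -!mulrA (mulrA (e j)) e_adj //; first lia.
  adj_lia.
rewrite mul0r !add0r scale0r.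
have [ij|ij] := ltnP i j; first by rewrite run_kill_high //; lia.
by rewrite run_kill_low //; lia.
Qed.

Lemma fork_gen k j : (k <= 1)%N -> (1 < j <= n)%N ->
  PR 2 * e k * e j = (j == 2)%:R *: PR 2.
Proof.
move=> k1 /andP[j1 jn]; case: eqVneq => [j2|j2].
  rewrite j2 in jn *; rewrite scale1r (@PRS 2) // -!mulrA (mulrA (e 2)) e_adj //; first lia.
  by case: k k1 => [|[|]].
rewrite -mulrA e_comm; [|lia|lia|lia|adj_lia].
rewrite mulrA run_gen //; last lia.
have -> : (2 == j) = false by lia.
have -> : (2 == j.+1) = false by lia.
have [j3|j3] := eqVneq 3 j; last by rewrite mul0r !addr0 !scale0r mul0r.
by rewrite mul0r !add0r scale1r -j3 run_kill_low ?scale0r //; lia.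
Qed.

Lemma run1_gen j : (1 < j <= n)%N -> PR 1 * e j = (j == 2)%:R *: PR 2.
Proof. by move=> jn; rewrite (@PRS 1) // fork_gen. Qed.

Lemma run0_gen j : (1 < j <= n)%N -> PR0 * e j = (j == 2)%:R *: PR 2.
Proof. exact: fork_gen. Qed.

(** The generator e j passes the part of odd_run i after run 1, and meets run 1,
    which it kills. *)
Lemma odd_run_kill_high i j : (0 < i)%N -> (i.+1 < j <= n)%N -> PO i * e j = 0.
Proof.
case: i => // i _; elim: i => [|i IH] /andP[ij jn].
  rewrite odd_run1E -mulrA e_comm; [|lia|lia|lia|adj_lia].
  rewrite mulrA run1_gen; last lia.
  by rewrite (_ : (j == 2) = false) ?scale0r ?mul0r //; lia.
rewrite POS // -mulrA e_comm; [|lia|lia|lia|adj_lia].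
by rewrite mulrA IH ?mul0r //; lia.
Qed.

Lemma odd_run_back i : (1 < i)%N -> (i < n)%N -> PO i.+1 * e i = PO i.
Proof.
case: i => // i i1 iln; rewrite POS // POS // -!mulrA (mulrA (e i.+1)) e_adj //; try lia.
adj_lia.
Qed.

Lemma odd_run_gen i j : (0 < i <= n)%N -> (1 < j <= n)%N ->
  PO i * e j = ((i == j)%:R * - qint q 2 + (i == j.+1)%:R + (i.+1 == j)%:R) *: PO j.
Proof.
move=> /andP[i1 iln] /andP[j1 jn].
have [->|nij] := eqVneq i j.
  have -> : (j == j.+1) = false by lia.
  have -> : (j.+1 == j) = false by lia.
  case: j j1 jn => // j j1 jn.
  by rewrite mul1r !addr0 POS // -mulrA e_sq // scalerAr.
have [ij|nij1] := eqVneq i j.+1.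
  rewrite (_ : (i.+1 == j) = false); last lia.
  by rewrite mul0r add0r addr0 scale1r ij odd_run_back //; lia.
have [ij|nij2] := eqVneq i.+1 j.
  by rewrite mul0r !add0r scale1r -ij POS.
rewrite mul0r !add0r scale0r.
have [ij|ij] := ltnP i j; first by rewrite odd_run_kill_high //; lia.
have [k ik] : exists k, (i = j.+2 + k)%N by exists (i - j.+2)%N; lia.
elim: k i ik i1 iln nij nij1 nij2 ij => [|k IH] i -> _ iln _ _ _ _.
  rewrite addn0 POS // -mulrA e_comm; [|lia|lia|lia|adj_lia].
  by rewrite mulrA odd_run_back ?odd_run_kill_high //; lia.
rewrite addnS POS // -mulrA e_comm; [|lia|lia|lia|adj_lia].
by rewrite mulrA IH ?mul0r //; lia.
Qed.

Lemma odd_run_gen01 i j : (0 < i <= n)%N -> (j <= 1)%N ->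
  PO i * e j = ((i == 1)%:R * - qint q 2 + (i == 2)%:R) *: PO 1.
Proof.
move=> /andP[]; case: i => // i _; elim: i => [|[|i] IH] iln j1.
- rewrite eqxx mul1r addr0; case: j j1 => [|[|//]] _.
    by rewrite odd_run1E -mulrA e_sq // scalerAr.
  by rewrite odd_run1E0 -mulrA e_sq // scalerAr.
- rewrite mul0r add0r scale1r POS //.
  case: j j1 {IH} => [|[|//]] _.
    by rewrite odd_run1E -!mulrA (mulrA (e 0)) e_adj.
  by rewrite odd_run1E0 -!mulrA (mulrA (e 1)) e_adj.
rewrite mul0r add0r scale0r POS // -mulrA e_comm; [|lia|lia|lia|adj_lia].
rewrite mulrA IH //; last lia.
rewrite mul0r add0r; case: i {IH} => [|i] in iln *; last by rewrite scale0r mul0r.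
by rewrite scale1r odd_run_kill_high //; lia.
Qed.

(** Multiplying by e j collects, in front of each of the words, a combination of
    three neighbouring coefficients, which vanishes by the recurrences. *)
Lemma clasp_kill j : (j <= n)%N -> P * clasp * e j = 0.
Proof.
move=> jn.
have -> : P * clasp * e j =
    \sum_(2 <= i < n.+2) coefg q n i *: (PR i * e j)
    + coefg q n 1 *: (PR 1 * e j + PR0 * e j)
    + \sum_(1 <= i < n.+1) coefh q n i *: (PO i * e j).
  rewrite /clasp !mulrDr !mulrDl -!scalerAr -!scalerAl !mulr_sumr !mulr_suml.
  rewrite mulrDr mulrDl /PR0 /run0 mulrA; congr (_ + _ + _);
    by apply: eq_bigr => i _; rewrite -scalerAr -scalerAl.
have [j1|j1] := leqP j 1.
  under [X in _ + X]eq_big_nat => i /andP[i0 iln].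
    rewrite odd_run_gen01 ?i0 // scalerA; over.
  rewrite -scaler_suml.
  have -> : \sum_(1 <= i < n.+1) coefh q n i * ((i == 1)%:R * - qint q 2 + (i == 2)%:R)
    = - coefg q n 1.
    transitivity (\sum_(1 <= i < n.+1) (- qint q 2 * (coefh q n i * (i == 1)%:R)
                    + coefh q n i * (i == 2)%:R)).
      by apply: eq_bigr => i _; ring.
    rewrite big_split -mulr_sumr /= (sumr_eq_nat _ _ 1 (coefh q n)).
    rewrite (sumr_eq_nat _ _ 2 (coefh q n)).
    have -> : (1 <= 1 < n.+1)%N by lia.
    have -> : (1 <= 2 < n.+1)%N = (1 < n)%N by lia.
    case: (ltnP 1 n) => n1.
      by rewrite mulNr -coefh_rec1 // opprD addrNK.
    have n1' : n = 1%N by lia.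
    by rewrite mulNr -coefh_rec1 // n1' coefh_top !addr0.
  have low i : (2 <= i < n.+2)%N -> PR i * e j = (i == 2)%:R *: (if j == 0 then PR0 else PR 1).
    move=> /andP[i1 iln]; have [->|i2] := eqVneq i 2.
      by rewrite scale1r; case: j jn j1 => [|[|//]] // *; rewrite -PRS.
    by rewrite scale0r run_kill_low //; lia.
  under eq_big_nat => i ir do rewrite low // scalerA.
  rewrite -scaler_suml sumr_eq_nat.
  have -> : (2 <= 2 < n.+2)%N by lia.
  rewrite coefg_rec1 //.
  case: j jn j1 {low} => [|[|//]] _ _ /=.
    rewrite -odd_run1E /PR0 -mulrA e_sq // -scalerAr -/PR0 scalerDr scalerA.
    by rewrite mulrN mulrC !scaleNr (addrC (coefg q n 1 *: PO 1)) addrA subrr add0r subrr.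
  rewrite -odd_run1E0 (@PRS 1 n_gt0) -mulrA e_sq // -scalerAr -PRS // scalerDr scalerA.
  by rewrite mulrN mulrC !scaleNr addrA subrr add0r subrr.
under eq_big_nat => i ir.
  rewrite run_gen; [|lia|lia].
  rewrite scalerA; over.
under [X in _ + X]eq_big_nat => i ir.
  rewrite odd_run_gen; [|lia|lia].
  rewrite scalerA; over.
rewrite -!scaler_suml.
have sumE a b (f : nat -> F) : (0 < a)%N ->
    \sum_(a <= i < b) f i * ((i == j)%:R * - qint q 2 + (i == j.+1)%:R + (i.+1 == j)%:R)
  = - qint q 2 * (if (a <= j < b)%N then f j else 0)
    + (if (a <= j.+1 < b)%N then f j.+1 else 0)
    + (if (a <= j.-1 < b)%N then f j.-1 else 0).
  move=> a0; rewrite -(sumr_eq_nat _ _ _ f) mulr_sumr -(sumr_eq_nat _ _ _ f).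
  rewrite -(sumr_eq_nat _ _ j.-1 f) -!big_split /=; apply: eq_big_nat => i /andP[ai _].
  rewrite (_ : (i.+1 == j) = (i == j.-1)); last lia.
  by ring.
rewrite !sumE //.
rewrite run1_gen ?run0_gen; [|lia|lia].
have -> : (2 <= j < n.+2)%N by lia.
have -> : (2 <= j.+1 < n.+2)%N by lia.
have -> : (1 <= j.-1 < n.+1)%N by lia.
have -> : (if (1 <= j.+1 < n.+1)%N then coefh q n j.+1 else 0) = coefh q n j.+1.
  case: ifP => // jn'; have -> : j = n by lia.
  by rewrite coefh_top.
have hrec : coefh q n j.+1 + coefh q n j.-1 = qint q 2 * coefh q n j.
  by apply: coefh_rec => //; lia.
have -> : - qint q 2 * coefh q n j + coefh q n j.+1 + coefh q n j.-1 = 0.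
  by rewrite -addrA hrec mulNr addNr.
rewrite scale0r addr0.
have [j2|j2] := eqVneq j 2.
  rewrite j2 /= addr0 !scale1r scalerDr -!scalerDl.
  by rewrite mulNr -coefg_rec2 // mulr2n -addrA addNr scale0r.
rewrite !scale0r addr0 scaler0 addr0.
have -> : (2 <= j.-1 < n.+2)%N by lia.
by rewrite -addrA coefg_rec ?mulNr ?addNr ?scale0r //; lia.
Qed.

End Clasp.

(** * The projectors *)

Section Maps.
Variables (F : fieldType) (q : F).

(** The augmentation: the coefficient of the empty word. *)
Definition eps n : TLD q n -> F := tlhom (A := F^o) (fun _ => 0).

Section Eps.
Variable n : nat.
Let sq (i : 'I_n.+1) : (0 : F^o) * 0 = - qint q 2 *: (0 : F^o).
Proof. by rewrite mulr0 scaler0. Qed.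
Let adj (i j : 'I_n.+1) : adjD i j -> (0 : F^o) * 0 * 0 = 0.
Proof. by rewrite mulr0. Qed.
Let com (i j : 'I_n.+1) : i != j -> ~~ adjD i j -> (0 : F^o) * 0 = 0 * 0.
Proof. by []. Qed.

Lemma eps_lin c (x y : TLD q n) : eps (c *: x + y) = c * eps x + eps y.
Proof. exact: (tlhom_lin sq adj com). Qed.
Lemma epsM (x y : TLD q n) : eps (x * y) = eps x * eps y.
Proof. exact: (tlhomM sq adj com). Qed.
Lemma eps1 : eps (1 : TLD q n) = 1.
Proof. exact: (tlhom1 sq adj com). Qed.
Lemma eps_gen i : eps (genE i : TLD q n) = 0.
Proof. exact: (tlhom_gen sq adj com). Qed.
Lemma eps0 : eps (0 : TLD q n) = 0.
Proof. exact: (tlhom0 sq adj com). Qed.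
Lemma epsD (x y : TLD q n) : eps (x + y) = eps x + eps y.
Proof. exact: (linD (W := F^o) eps_lin). Qed.
Lemma epsZ c (x : TLD q n) : eps (c *: x) = c * eps x.
Proof. exact: (linZ (W := F^o) eps_lin). Qed.
Lemma eps_word (w : seq 'I_n.+1) : eps (word q w) = (nilp w)%:R.
Proof.
rewrite [LHS](tlhom_word sq adj com); case: w => [|i w]; first by rewrite big_nil.
by rewrite big_cons mul0r.
Qed.
End Eps.

(** Generators indexed by numbers, to be used in all ranks. *)
Definition gen_nat n (i : nat) : TLD q n := genE (inord i).

Lemma gen_nat_val n (i : 'I_n.+1) : gen_nat n i = genE i.
Proof. by rewrite /gen_nat inord_val. Qed.

Lemma gen_nat_sq n i : (i <= n)%N ->
  gen_nat n i * gen_nat n i = - qint q 2 *: gen_nat n i.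
Proof. by move=> _; exact: TLD_sq. Qed.

Lemma gen_nat_adj n i j : (i <= n)%N -> (j <= n)%N -> adjD i j ->
  gen_nat n i * gen_nat n j * gen_nat n i = gen_nat n i.
Proof. by move=> ilen jlen ij; apply: TLD_adj; rewrite !inordK. Qed.

Lemma gen_nat_comm n i j : (i <= n)%N -> (j <= n)%N -> i != j -> ~~ adjD i j ->
  gen_nat n i * gen_nat n j = gen_nat n j * gen_nat n i.
Proof.
move=> ilen jlen ij nij; apply: TLD_comm; last by rewrite !inordK.
by apply: contra ij => /eqP/(congr1 val); rewrite /= !inordK // => ->.
Qed.

Definition incl m n : TLD q m -> TLD q n := tlhom (fun i : 'I_m.+1 => gen_nat n i).

Section Inclusion.
Variables m n : nat.
Hypothesis le_mn : (m <= n)%N.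
Let le (i : 'I_m.+1) : (i <= n)%N.
Proof. by apply: leq_trans le_mn; rewrite -ltnS. Qed.
Let sq (i : 'I_m.+1) : gen_nat n i * gen_nat n i = - qint q 2 *: gen_nat n i.
Proof. exact: gen_nat_sq. Qed.
Let adj (i j : 'I_m.+1) : adjD i j -> gen_nat n i * gen_nat n j * gen_nat n i = gen_nat n i.
Proof. exact: gen_nat_adj. Qed.
Let com (i j : 'I_m.+1) : i != j -> ~~ adjD i j ->
  gen_nat n i * gen_nat n j = gen_nat n j * gen_nat n i.
Proof. by move=> ij; apply: gen_nat_comm. Qed.

Lemma incl_lin c (x y : TLD q m) : incl n (c *: x + y) = c *: incl n x + incl n y :> TLD q n.
Proof. exact: (tlhom_lin sq adj com). Qed.
Lemma inclM (x y : TLD q m) : incl n (x * y) = incl n x * incl n y.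
Proof. exact: (tlhomM sq adj com). Qed.
Lemma incl1 : incl n (1 : TLD q m) = 1.
Proof. exact: (tlhom1 sq adj com). Qed.
Lemma incl_gen (i : 'I_m.+1) : incl n (genE i : TLD q m) = gen_nat n i.
Proof. exact: (tlhom_gen sq adj com). Qed.
Lemma incl0 : incl n (0 : TLD q m) = 0.
Proof. exact: (tlhom0 sq adj com). Qed.
Lemma incl_word (w : seq 'I_m.+1) :
  incl n (word q w) = word q (map (widen_ord (le_mn : m < n.+1)%N) w).
Proof.
elim: w => [|i w IH]; first by rewrite !word_nil incl1.
rewrite map_cons !word_cons inclM incl_gen IH.
suff -> : gen_nat n i = genE (widen_ord (le_mn : m < n.+1)%N i) by [].
by congr genE; apply: val_inj; rewrite /= inordK // ltnS le.
Qed.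

Lemma eps_incl (x : TLD q m) : eps (incl n x) = eps x.
Proof.
apply: (TLD_ext (V := F^o) (f := fun x => eps (incl n x))) => {x} [c x y||w].
- by rewrite incl_lin eps_lin.
- exact: eps_lin.
elim: w => [|i w IHw]; first by rewrite word_nil incl1 2!eps1.
by rewrite word_cons inclM 2!epsM incl_gen 2!eps_gen 2!mul0r.
Qed.

Lemma incl_sub (x : TLD q m) : subTLD m (incl n x).
Proof.
elim/TLD_ind: x => [|c w x IH].
  rewrite incl0; have := subTLD_lin (-1) (subTLD_one q n m) (subTLD_one q n m).
  by rewrite scaleN1r addNr.
rewrite incl_lin; apply: subTLD_lin; last exact: IH.
elim: w => [|i w IHw]; first by rewrite word_nil incl1; exact: subTLD_one.
rewrite word_cons inclM incl_gen; apply: subTLD_mul IHw.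
by apply: subTLD_gen; rewrite inordK ?ltnS // -ltnS.
Qed.

(** An element killed by the generators of rank m only sees augmentations. *)
Lemma absorb_incl (P : TLD q n) (x : TLD q m) :
  (forall i, (i <= m)%N -> P * gen_nat n i = 0) -> P * incl n x = eps x *: P.
Proof.
move=> P0; apply: (TLD_ext (f := fun x => P * incl n x) (g := fun x => eps x *: P)).
- by move=> c y z; rewrite incl_lin mulrDr scalerAr.
- by move=> c y z; rewrite eps_lin scalerDl scalerA.
case => [|i w]; first by rewrite word_nil incl1 eps1 scale1r mulr1.
by rewrite word_cons inclM epsM incl_gen eps_gen mul0r scale0r mulrA P0 ?mul0r // -ltnS.
Qed.

Lemma absorb_incl_l (P : TLD q n) (x : TLD q m) :
  (forall i, (i <= m)%N -> gen_nat n i * P = 0) -> incl n x * P = eps x *: P.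
Proof.
move=> P0; apply: (TLD_ext (f := fun x => incl n x * P) (g := fun x => eps x *: P)).
- by move=> c y z; rewrite incl_lin mulrDl scalerAl.
- by move=> c y z; rewrite eps_lin scalerDl scalerA.
elim/last_ind => [|w i _]; first by rewrite word_nil incl1 eps1 scale1r mul1r.
rewrite -cats1 word_cat word_cons word_nil mulr1 inclM epsM incl_gen eps_gen mulr0 scale0r.
by rewrite -mulrA P0 ?mulr0 // -ltnS.
Qed.

End Inclusion.

Lemma incl_id n (x : TLD q n) : incl n x = x.
Proof.
apply: (TLD_ext (f := @incl n n)) => [c y z||w]; [exact: incl_lin|by []|].
elim: w => [|i w IHw]; first by rewrite word_nil incl1.
rewrite word_cons (inclM (leqnn n)) (incl_gen (leqnn n)) IHw.
by rewrite gen_nat_val.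
Qed.

(** The anti-automorphism reversing words. *)
Definition star n : TLD q n -> TLD q n := tlanti (fun i => genE i).

Section Star.
Variable n : nat.
Let sq (i : 'I_n.+1) : genE i * genE i = - qint q 2 *: genE i :> TLD q n.
Proof. exact: TLD_sq. Qed.
Let adj (i j : 'I_n.+1) : adjD i j -> (genE i * genE j * genE i : TLD q n) = genE i.
Proof. exact: TLD_adj. Qed.
Let com (i j : 'I_n.+1) : i != j -> ~~ adjD i j ->
  (genE i * genE j : TLD q n) = genE j * genE i.
Proof. exact: TLD_comm. Qed.

Lemma star_lin c (x y : TLD q n) : star (c *: x + y) = c *: star x + star y.
Proof. exact: (tlanti_lin sq adj com). Qed.
Lemma star0 : star (0 : TLD q n) = 0.
Proof. exact: (tlanti0 sq adj com). Qed.
Lemma starM (x y : TLD q n) : star (x * y) = star y * star x.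
Proof. exact: (tlantiM sq adj com). Qed.
Lemma star_gen i : star (genE i : TLD q n) = genE i.
Proof. exact: (tlanti_gen sq adj com). Qed.
Lemma star_word w : star (word q w : TLD q n) = word q (rev w).
Proof. exact: (tlanti_word sq adj com). Qed.

Lemma eps_star (x : TLD q n) : eps (star x) = eps x.
Proof.
move: x; apply: (TLD_ext (V := F^o) (f := fun x => eps (star x))) => [c y z||w].
- by rewrite star_lin eps_lin.
- exact: eps_lin.
by rewrite star_word 2!eps_word /nilp size_rev.
Qed.

End Star.

(** The elements annihilated by the generators on both sides, normalized by
    the augmentation; there is exactly one for each n. *)
Definition is_jw n (Q : TLD q n) : Prop :=
  eps Q = 1 /\ forall i, genE i * Q = 0 /\ Q * genE i = 0.

Lemma absorb n (P x : TLD q n) : (forall i, P * genE i = 0) -> P * x = eps x *: P.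
Proof.
move=> P0; have := absorb_incl (leqnn n) x (fun i _ => P0 (inord i)).
by rewrite incl_id.
Qed.

Lemma absorb_l n (P x : TLD q n) : (forall i, genE i * P = 0) -> x * P = eps x *: P.
Proof.
move=> P0; have := absorb_incl_l (leqnn n) x (fun i _ => P0 (inord i)).
by rewrite incl_id.
Qed.

(** Multiply the two elements: each absorbs the other. *)
Lemma is_jw_uniq n (Q Q' : TLD q n) : is_jw Q -> is_jw Q' -> Q = Q'.
Proof.
move=> [Q1 Q0] [Q'1 Q'0].
have := absorb Q' (fun i => proj2 (Q0 i)); rewrite Q'1 scale1r => e1.
have := absorb_l Q (fun i => proj1 (Q'0 i)); rewrite Q1 scale1r => e2.
exact: etrans (esym e1) e2.
Qed.

(** One-sided annihilation suffices: such a Q equals its own mirror image. *)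
Lemma is_jw_onesided n (Q : TLD q n) : eps Q = 1 ->
  (forall i, Q * genE i = 0) -> is_jw Q.
Proof.
move=> Q1 Q0; split=> // i; split=> //.
have S0 j : genE j * star Q = 0.
  have := starM Q (genE j); rewrite Q0 star0 star_gen => E.
  exact: esym E.
have := absorb (star Q) Q0; rewrite eps_star Q1 scale1r => e1.
have := absorb_l Q S0; rewrite Q1 scale1r => e2.
have e3 : star Q = Q by exact: etrans (esym e2) e1.
by have := S0 i; rewrite e3.
Qed.

Section Existence.
Hypothesis q_neq0 : q != 0.
Hypothesis qint_neq0 : forall m, (0 < m)%N -> qint q m != 0.

(** The projector of rank n, included in rank n + 1; in rank 1 the clasp alone is
    the projector. *)
Definition clasp_prefix n (P : TLD q n) : TLD q n.+1 :=
  if n == 0 then 1 else incl n.+1 P.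

Lemma eps_clasp n : (0 < n)%N -> eps (clasp q n (gen_nat n)) = 1.
Proof.
move=> n0; apply: clasp_aug => // [x y|c x|x y||i].
- exact: epsD.
- exact: epsZ.
- exact: epsM.
- exact: eps1.
- exact: eps_gen.
Qed.

Lemma jw_step n (P : TLD q n) : is_jw P ->
  is_jw (clasp_prefix P * clasp q n.+1 (gen_nat n.+1)).
Proof.
move=> [P1 P0]; have c1 : eps (clasp_prefix P) = 1.
  rewrite /clasp_prefix; case: eqP => _; first exact: eps1.
  by rewrite eps_incl.
have ck j : (1 < n.+1)%N -> (j < n.+1)%N -> clasp_prefix P * gen_nat n.+1 j = 0.
  move=> n1 jn; rewrite /clasp_prefix; case: eqP => [n0|_]; first by lia.
  have -> : gen_nat n.+1 j = incl n.+1 (genE (inord j : 'I_n.+1)).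
    by rewrite incl_gen // inordK.
  rewrite -inclM //; case: (P0 (inord j)) => _ E.
  by rewrite E incl0.
have K := clasp_kill q_neq0 qint_neq0 (ltn0Sn n) (@gen_nat_sq n.+1) (@gen_nat_adj n.+1)
  (@gen_nat_comm n.+1) ck.
apply: is_jw_onesided; first by rewrite epsM c1 eps_clasp ?mulr1.
by move=> i; have := K i (ltn_ord i); rewrite gen_nat_val.
Qed.

Lemma jw_exists n : exists Q : TLD q n, is_jw Q.
Proof.
elim: n => [|n [P jP]]; last by exists (clasp_prefix P * clasp q n.+1 (gen_nat n.+1)); exact: jw_step.
have q2 : qint q 2 != 0 by exact: qint_neq0.
exists ((qint q 2)^-1 *: genE ord0 + 1); apply: is_jw_onesided.
  by rewrite eps_lin eps_gen mulr0 add0r eps1.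
move=> i; rewrite (ord1 i) mulrDl mul1r -scalerAl TLD_sq scalerA mulrN mulVf //.
by rewrite scaleN1r addNr.
Qed.

(** The projectors of all smaller ranks satisfy the defining properties, so that
    the chosen family satisfies them; idempotence gives the augmentation 1. *)
Lemma projector_is_jw n : is_jw (projector q n).
Proof.
have jw m : {Q : TLD q m | is_jw Q} by apply: cid; exact: jw_exists.
pose Q : {ffun 'I_n.+1 -> TLD q n} := [ffun m : 'I_n.+1 => incl n (sval (jw m))].
have QP : is_projectors Q.
  move=> m; have mn : (m <= n)%N by rewrite -ltnS.
  rewrite ffunE; case: (jw m) => /= P [P1 P0].
  have kill i : (i <= m)%N -> gen_nat n i * incl n P = 0 /\ incl n P * gen_nat n i = 0.
    move=> im; have -> : gen_nat n i = incl n (genE (inord i : 'I_m.+1)).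
      by rewrite incl_gen // inordK.
    have [E1 E2] := P0 (inord i).
    by split; rewrite -(inclM mn) ?E1 ?E2 incl0.
  split.
  - exact: incl_sub.
  - apply/eqP => P00; have := eps_incl mn P; rewrite P00 eps0 P1 => /esym/eqP.
    by rewrite oner_eq0.
  - move=> i im; rewrite ffunE; case: (jw i) => /= P' [P'1 P'0].
    have iN : (i <= n)%N by exact: leq_trans im mn.
    rewrite absorb_incl // ?absorb_incl_l // ?P'1 ?scale1r //.
      by move=> j ji; case: (kill j (leq_trans ji im)).
    by move=> j ji; case: (kill j (leq_trans ji im)).
  - by move=> i im; have := kill i im; rewrite gen_nat_val.
have [_ Q'0 Q'Q Q'k] := classical_sets.xgetPex (0 : {ffun 'I_n.+1 -> TLD q n}) (ex_intro _ Q QP) ord_max.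
have k i : genE i * projector q n = 0 /\ projector q n * genE i = 0.
  by apply: Q'k; rewrite -ltnS.
split=> //; have [_] := Q'Q ord_max (leqnn _); rewrite -/(projector q n) absorb; last first.
  by move=> i; case: (k i).
move/eqP; rewrite -subr_eq0 -[X in _ - X]scale1r -scalerBl.
rewrite scaler_eq0 (negPf Q'0) orbF subr_eq0 => /eqP; apply.
Qed.

Lemma projector_rec n :
  projector q n.+1 = clasp_prefix (projector q n) * clasp q n.+1 (gen_nat n.+1).
Proof. apply: is_jw_uniq; [exact: projector_is_jw | exact/jw_step/projector_is_jw]. Qed.

End Existence.

End Maps.

(** * The left ideal of the last generator *)

Section LeftIdeal.
Variables (F : fieldType) (d : F) (A : algType F) (n : nat) (e : nat -> A).
Hypothesis e_sq : forall i, (i <= n)%N -> e i * e i = d *: e i.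
Hypothesis e_adj : forall i j, (i <= n)%N -> (j <= n)%N -> adjD i j ->
  e i * e j * e i = e i.
Hypothesis e_comm : forall i j, (i <= n)%N -> (j <= n)%N -> i != j -> ~~ adjD i j ->
  e i * e j = e j * e i.

(** Products grow to the left by one letter, for the inductions below. *)
Inductive sub_alg (m : nat) : A -> Prop :=
| sub_alg1 : sub_alg m 1
| sub_alg_lin c x y : sub_alg m x -> sub_alg m y -> sub_alg m (c *: x + y)
| sub_alg_gen i x : (i <= m)%N -> sub_alg m x -> sub_alg m (e i * x).

Lemma sub_alg0 m : sub_alg m 0.
Proof.
by have := sub_alg_lin (-1) (sub_alg1 m) (sub_alg1 m); rewrite scaleN1r addNr.
Qed.

Lemma sub_algZ m c x : sub_alg m x -> sub_alg m (c *: x).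
Proof. by move=> sx; rewrite -[_ *: _]addr0; apply: sub_alg_lin => //; exact: sub_alg0. Qed.

Lemma sub_algD m x y : sub_alg m x -> sub_alg m y -> sub_alg m (x + y).
Proof. by move=> sx sy; rewrite -[x]scale1r; exact: sub_alg_lin. Qed.

Lemma sub_algM m x y : sub_alg m x -> sub_alg m y -> sub_alg m (x * y).
Proof.
move=> sx sy; elim: sx => [|c u v _ su _ sv|i u im _ su].
- by rewrite mul1r.
- by rewrite mulrDl -scalerAl; exact: sub_alg_lin.
- by rewrite -mulrA; exact: sub_alg_gen.
Qed.

Lemma sub_alg_e m i : (i <= m)%N -> sub_alg m (e i).
Proof. by move=> im; rewrite -[e i]mulr1; apply: sub_alg_gen => //; exact: sub_alg1. Qed.

Lemma sub_alg_le m k x : (m <= k)%N -> sub_alg m x -> sub_alg k x.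
Proof.
move=> mk; elim=> [|c u v _ su _ sv|i u im _ su].
- exact: sub_alg1.
- exact: sub_alg_lin.
- by apply: sub_alg_gen => //; exact: leq_trans mk.
Qed.

Lemma sub_alg_comm m j y : (0 < m)%N -> (m.+1 < j <= n)%N -> sub_alg m y ->
  e j * y = y * e j.
Proof.
move=> m0 /andP[mj jn]; elim=> [|c u v _ su _ sv|i u im _ su].
- by rewrite mulr1 mul1r.
- by rewrite mulrDl mulrDr -scalerAl -scalerAr su sv.
- rewrite mulrA e_comm; [|lia|lia|lia|adj_lia].
  by rewrite -mulrA su mulrA.
Qed.

(** The word going down from e m through e 1 and e 0 and up again. *)
Fixpoint hairpin m : A :=
  if m is m'.+1 then (if m' is 0 then e 1 * e 0 else e m * hairpin m' * e m) else 1.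

Lemma hairpinS m : (0 < m)%N -> hairpin m.+1 = e m.+1 * hairpin m * e m.+1.
Proof. by case: m. Qed.

Lemma sub_hairpin m : (0 < m)%N -> sub_alg m (hairpin m).
Proof.
case: m => // m _; elim: m => [|m IH].
  by apply: sub_algM; exact: sub_alg_e.
rewrite hairpinS //; apply: sub_algM; last exact: sub_alg_e.
by apply: sub_algM; [exact: sub_alg_e | exact: sub_alg_le IH].
Qed.

Lemma e_hairpin m : (1 < m <= n)%N -> e m * hairpin m = d *: hairpin m.
Proof.
case: m => [|[|m]] // /andP[_ mn].
by rewrite hairpinS // !mulrA e_sq // -!scalerAl.
Qed.

(** A generator other than e m passes the outer letters of the hairpin and
    straightens the first one at which it stops; unwinding, all letters but the
    last e m fall within rank m - 1. *)
Lemma gen_hairpin m i : (1 < m <= n)%N -> (i < m)%N ->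
  exists2 y, sub_alg m.-1 y & e i * hairpin m = y * e m.
Proof.
case: m => [|[|m]] // /andP[_]; elim: m i => [|m IH] i mn im; rewrite hairpinS //.
  have n1 : (1 <= n)%N by lia.
  exists (e 0 * e 1); first by apply: sub_algM; exact: sub_alg_e.
  case: i im => [|[|]] // _; rewrite /=.
    by rewrite -(@e_comm 0 1) // !mulrA e_adj.
  by rewrite !mulrA e_adj // (@e_comm 0 1).
have [->|im'] := eqVneq i m.+2.
  exists (hairpin m.+2); first exact: sub_hairpin.
  by rewrite (@hairpinS m.+1) // !mulrA e_adj //; adj_lia.
case: (IH i) => [||y sy Ey]; try lia.
exists y; first exact: sub_alg_le sy.
move: (hairpin m.+2) Ey => h Ey; rewrite !mulrA e_comm; [|lia|lia|lia|adj_lia].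
rewrite -(mulrA _ (e i)) Ey mulrA (@sub_alg_comm m.+1) //; last lia.
by rewrite -!mulrA (mulrA (e m.+3)) e_adj //; adj_lia.
Qed.

Lemma hairpin_gen m i : (1 < m <= n)%N -> (i < m)%N ->
  exists2 y, sub_alg m.-1 y & hairpin m * e i = e m * y.
Proof.
case: m => [|[|m]] // /andP[_]; elim: m i => [|m IH] i mn im; rewrite hairpinS //.
  have n1 : (1 <= n)%N by lia.
  exists (e 0 * e 1); first by apply: sub_algM; exact: sub_alg_e.
  case: i im => [|[|]] // _; rewrite /=.
    by rewrite -!mulrA (mulrA (e 0) (e 2)) e_adj // (@e_comm 0 1).
  by rewrite -(@e_comm 0 1) // -!mulrA (mulrA (e 1) (e 2)) e_adj.
have [->|im'] := eqVneq i m.+2.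
  exists (hairpin m.+2); first exact: sub_hairpin.
  rewrite (@hairpinS m.+1) // -!mulrA (mulrA (e m.+2) (e m.+3)) e_adj //;
    adj_lia.
case: (IH i) => [||y sy Ey]; try lia.
exists y; first exact: sub_alg_le sy.
move: (hairpin m.+2) Ey => h Ey; rewrite -!mulrA (@e_comm m.+3); [|lia|lia|lia|adj_lia].
rewrite (mulrA _ (e i)) Ey -mulrA -(@sub_alg_comm m.+1) //; last lia.
by rewrite !mulrA e_adj //; adj_lia.
Qed.

Lemma hairpin_sub m y : (1 < m <= n)%N -> sub_alg m.-1 y ->
  exists c u, sub_alg m.-1 u /\ hairpin m * y = c *: hairpin m + e m * u.
Proof.
move=> mn; elim=> [|c u v _ [cu [u' [su Eu]]] _ [cv [v' [sv Ev]]]|i u im su _].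
- by exists 1, 0; split; [exact: sub_alg0 | rewrite mulr1 mulr0 scale1r addr0].
- exists (c * cu + cv), (c *: u' + v'); split; first exact: sub_alg_lin.
  rewrite mulrDr -scalerAr Eu Ev !mulrDr scalerDr -scalerAr scalerDl scalerA.
  by rewrite addrACA.
- have [|v sv Ev] := hairpin_gen (i := i) mn; first lia.
  exists 0, (v * u); split; first exact: sub_algM.
  by rewrite mulrA Ev scale0r add0r mulrA.
Qed.

(** The form which all x * e m take, for x in the algebra of rank m. *)
Definition left_ideal_form m (x : A) : Prop :=
  exists y c, sub_alg m.-1 y /\ x = y * e m + c *: hairpin m.

Lemma left_ideal_form_lin m c x y : left_ideal_form m x -> left_ideal_form m y ->
  left_ideal_form m (c *: x + y).
Proof.
move=> [x' [a [sx ->]]] [y' [b [sy ->]]].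
exists (c *: x' + y'), (c * a + b); split; first exact: sub_alg_lin.
by rewrite mulrDl -scalerAl scalerDr scalerDl scalerA addrACA.
Qed.

Lemma left_ideal_form_gen m i x : (1 < m <= n)%N -> (i < m)%N ->
  left_ideal_form m x -> left_ideal_form m (e i * x).
Proof.
move=> mn im [y [c [sy ->]]]; have [u su Eu] := gen_hairpin mn im.
exists (e i * y + c *: u), 0; split.
  by apply: sub_algD; [apply: sub_alg_gen => //; lia | exact: sub_algZ].
by rewrite mulrDr mulrDl -scalerAr Eu mulrA -scalerAl scale0r addr0.
Qed.

(** In terms of words: no e m, a single e m, or the hairpin. *)
Inductive split_form (m : nat) : A -> Prop :=
| split_sub y : sub_alg m.-1 y -> split_form m y
| split_mid y1 y2 : sub_alg m.-1 y1 -> sub_alg m.-1 y2 -> split_form m (y1 * e m * y2)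
| split_hairpin : split_form m (hairpin m)
| split_lin c x y : split_form m x -> split_form m y -> split_form m (c *: x + y).

(** Up to the hairpin, e m is needed at most once in a word: the assumption
    removes one of two occurrences. *)
Lemma sub_alg_split m x : (1 < m <= n)%N ->
  (forall y, sub_alg m.-1 y -> left_ideal_form m (e m * y * e m)) ->
  sub_alg m x -> split_form m x.
Proof.
move=> mn eye; elim=> [|c u v _ su _ sv|i u im _ su].
- by apply: split_sub; exact: sub_alg1.
- exact: split_lin.
have [{im}->|im'] := eqVneq i m; last first.
  elim: su => [y sy|y1 y2 s1 s2||c x' y _ sx _ sy].
  - by apply: split_sub; apply: sub_alg_gen => //; lia.
  - by rewrite !mulrA; apply: split_mid => //; apply: sub_alg_gen => //; lia.
  - have [|y sy ->] := gen_hairpin (i := i) mn; first lia.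
    by rewrite -[_ * _]mulr1; apply: split_mid => //; exact: sub_alg1.
  - by rewrite mulrDr -scalerAr; exact: split_lin.
elim: su => [y sy|y1 y2 s1 s2||c x' y _ sx _ sy].
- by rewrite -[e m]mul1r; apply: split_mid => //; exact: sub_alg1.
- rewrite !mulrA; case: (eye _ s1) => [y [c [sy ->]]].
  have [c' [u' [su' Eu']]] := hairpin_sub mn s2.
  rewrite mulrDl -scalerAl Eu' addrC; apply: split_lin; last exact: split_mid.
  apply: split_lin; first exact: split_hairpin.
  by rewrite -[e m]mul1r; apply: split_mid => //; exact: sub_alg1.
- rewrite e_hairpin // -[_ *: _]addr0; apply: split_lin; first exact: split_hairpin.
  by apply: split_sub; exact: sub_alg0.
- by rewrite mulrDr -scalerAr; exact: split_lin.
Qed.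

Lemma sub_alg_rank1 x : (1 <= n)%N -> sub_alg 1 x ->
  exists a b c f, x = a *: 1 + b *: e 0 + c *: e 1 + f *: (e 0 * e 1).
Proof.
move=> n1; elim=> [|k u v _ [a [b [c [f ->]]]] _ [a' [b' [c' [f' ->]]]]|i u im _ [a [b [c [f ->]]]]].
- by exists 1, 0, 0, 0; rewrite scale1r !scale0r !addr0.
- exists (k * a + a'), (k * b + b'), (k * c + c'), (k * f + f').
  by rewrite !scalerDr !scalerDl !scalerA (addrACA _ (_ *: (e 0 * e 1))) (addrACA _ (_ *: e 1)) (addrACA _ (_ *: e 0)).
case: i im => [|[|]] // _.
- exists 0, (a + d * b), 0, (c + d * f).
  rewrite !mulrDr -!scalerAr mulr1 mulrA e_sq // -scalerAl !scalerA !scale0r add0r addr0.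
  by rewrite !scalerDl (mulrC d b) (mulrC d f) -!addrA.
- exists 0, 0, (a + d * c), (b + d * f).
  rewrite !mulrDr -!scalerAr mulr1 mulrA -(@e_comm 0 1) // -mulrA e_sq // -scalerAr !scalerA !scale0r add0r.
  by rewrite !scalerDl (mulrC d c) (mulrC d f) !add0r -!addrA; congr (_ + _); rewrite addrCA.
Qed.

(** By induction, y is a combination of the hairpin of rank m - 1 and of words with
    at most one e (m - 1), the other letters of which commute with e m. *)
Lemma e_sub_e m y : (1 < m <= n)%N -> sub_alg m.-1 y ->
  left_ideal_form m (e m * y * e m).
Proof.
case: m => [|[|m]] // /andP[_]; elim: m y => [|m IH] y mn sy.
  have [|a [b [c [f ->]]]] := sub_alg_rank1 _ sy; first lia.
  have n1 : (1 <= n)%N by lia.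
  exists ((a * d + b + c) *: 1), f; split; first by apply: sub_algZ; exact: sub_alg1.
  rewrite !mulrDr !mulrDl -!scalerAr -!scalerAl mulr1 mul1r e_sq // !e_adj // scalerA.
  by rewrite !scalerDl hairpinS //= (@e_comm 0 1) // mulrA.
have mn' : (1 < m.+2 <= n)%N by lia.
have := sub_alg_split mn' (fun y => IH y _) sy; rewrite ltnW // => /(_ isT) sp.
elim: {y sy} sp => [y sy|y1 y2 s1 s2||c x y _ sx _ sy].
- exists (d *: y), 0; split; first by apply: sub_algZ; exact: sub_alg_le sy.
  rewrite (@sub_alg_comm m.+1) //; last lia.
  by rewrite -mulrA e_sq // scale0r addr0 -scalerAr -scalerAl.
- exists (y1 * y2), 0; split; first by apply: sub_algM; [exact: sub_alg_le s1 | exact: sub_alg_le s2].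
  rewrite scale0r addr0 !mulrA (@sub_alg_comm m.+1 m.+3 y1) //; last lia.
  rewrite -!mulrA -(@sub_alg_comm m.+1 m.+3 y2) //; last lia.
  rewrite (mulrA (e m.+2)) (mulrA (e m.+3)) (mulrA (e m.+3)) e_adj //;
    adj_lia.
- by exists 0, 1; split; [exact: sub_alg0 | rewrite mul0r add0r scale1r].
- by rewrite mulrDr mulrDl -scalerAr -scalerAl; exact: left_ideal_form_lin.
Qed.

Lemma sub_alg_left_ideal m x : (1 < m <= n)%N -> sub_alg m x ->
  left_ideal_form m (x * e m).
Proof.
move=> mn; elim=> [|c u v _ su _ sv|i u im _ su].
- exists 1, 0; split; first exact: sub_alg1.
  by rewrite scale0r addr0.
- by rewrite mulrDl -scalerAl; exact: left_ideal_form_lin.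
rewrite -mulrA; have [{im}->|im'] := eqVneq i m; last first.
  by apply: left_ideal_form_gen => //; lia.
case: su => y [c [sy ->]]; rewrite mulrDr mulrA -scalerAr e_hairpin // addrC.
apply: left_ideal_form_lin; last exact: e_sub_e.
exists 0, d; split; first exact: sub_alg0.
by rewrite mul0r add0r.
Qed.

End LeftIdeal.

(** * The diagram module *)

(** Diagrams are multiplied by generators up to powers of delta. Only the action
    on well-formed states matters; the others are sent to 0. *)
Section Monomial.
Variables (F : fieldType) (delta : F) (T : finType).
Local Notation M := {ffun state T -> F^o}.

Definition base (s : state T) : M := [ffun x => (x == s)%:R].

Lemma base_sum (v : M) : v = \sum_s v s *: base s.
Proof.
apply/ffunP => x; rewrite sum_ffunE (bigD1 x) //= big1 ?addr0.
  by rewrite !ffunE eqxx; rewrite [_ *: _]mulr1.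
by move=> y yx; rewrite !ffunE eq_sym (negPf yx) scaler0.
Qed.

Definition mono (k : state T -> nat) (g : state T -> state T) (v : M) : M :=
  \sum_(s | `[< wf_state s >]) (v s * delta ^+ k s) *: base (g s).

Lemma mono_lin k g c u v : mono k g (c *: u + v) = c *: mono k g u + mono k g v.
Proof.
rewrite scaler_sumr -big_split /=; apply: eq_bigr => s _.
by rewrite !ffunE scalerA -scalerDl mulrDl mulrA.
Qed.

Lemma mono0 k g : mono k g 0 = 0.
Proof. exact: lin0 (mono_lin k g). Qed.

Lemma monoD k g u v : mono k g (u + v) = mono k g u + mono k g v.
Proof. exact: linD (mono_lin k g) u v. Qed.

Lemma monoZ k g c v : mono k g (c *: v) = c *: mono k g v.
Proof. exact: linZ (mono_lin k g) c v. Qed.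

Lemma mono_base k g s : wf_state s -> mono k g (base s) = delta ^+ k s *: base (g s).
Proof.
move=> ws; rewrite /mono (bigD1 s) /=; last exact/asboolP.
rewrite big1 ?addr0 => [|x /andP[_ xs]]; first by rewrite ffunE eqxx mul1r.
by rewrite ffunE (negPf xs) mul0r scale0r.
Qed.

Lemma mono_base_bad k g s : ~ wf_state s -> mono k g (base s) = 0.
Proof.
move=> ws; rewrite /mono big1 // => x wx; rewrite ffunE.
case: eqP => [xs|_]; last by rewrite mul0r scale0r.
by move/asboolP: wx; rewrite xs.
Qed.

Lemma mono_ext (h1 h2 : M -> M) :
  (forall c u v, h1 (c *: u + v) = c *: h1 u + h1 v) ->
  (forall c u v, h2 (c *: u + v) = c *: h2 u + h2 v) ->
  (forall s, h1 (base s) = h2 (base s)) -> forall v, h1 v = h2 v.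
Proof.
move=> L1 L2 E v; rewrite [v]base_sum.
elim: (index_enum _) => [|s r IH]; first by rewrite !big_nil (lin0 L1) (lin0 L2).
by rewrite !big_cons L1 L2 E IH.
Qed.

Lemma mono_comp k1 g1 k2 g2 v : (forall s, wf_state s -> wf_state (g2 s)) ->
  mono k1 g1 (mono k2 g2 v) = mono (fun s => k2 s + k1 (g2 s))%N (g1 \o g2) v.
Proof.
move=> wg; move: v; apply: mono_ext => [c u v|c u v|s]; rewrite ?mono_lin //.
have [ws|ws] := pselect (wf_state s); last by rewrite !mono_base_bad // mono0.
by rewrite !mono_base // monoZ mono_base ?scalerA -?exprD //; exact: wg.
Qed.

Lemma eq_mono k1 g1 k2 g2 v :
  (forall s, wf_state s -> k1 s = k2 s /\ g1 s = g2 s) -> mono k1 g1 v = mono k2 g2 v.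
Proof. by move=> E; apply: eq_bigr => s /asboolP /E [-> ->]. Qed.

End Monomial.

Section Phi.
Variables (F : fieldType) (q : F) (n : nat).
Local Notation M := {ffun state (point n) -> F^o}.
Local Notation delta := (- qint q 2).

Definition opL (i : 'I_n.+1) : M -> M :=
  mono delta (fun s => gloop (lpt n) i s : nat) (gstep (lpt n) i).
Definition opR (j : nat) : M -> M :=
  mono delta (fun s => gloop (rpt n) j s : nat) (gstep (rpt n) j).

Let wfL (i : 'I_n.+1) (s : state (point n)) : wf_state s -> wf_state (gstep (lpt n) i s).
Proof. by move=> ws; apply: (@gstep_wf _ n) => //; [exact: lpt_inj | rewrite -ltnS]. Qed.
Let wfR j (s : state (point n)) : (j <= n)%N -> wf_state s -> wf_state (gstep (rpt n) j s).
Proof. by move=> jn ws; apply: (@gstep_wf _ n) => //; exact: rpt_inj. Qed.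
Let le (i : 'I_n.+1) : (i <= n)%N. Proof. by rewrite -ltnS. Qed.

Let opL_lin (i : 'I_n.+1) c u v : opL i (c *: u + v) = c *: opL i u + opL i v.
Proof. exact: mono_lin. Qed.

Let opL_sq i v : opL i (opL i v) = delta *: opL i v.
Proof.
rewrite /opL mono_comp; last exact: wfL.
rewrite scaler_sumr; apply: eq_bigr => s /asboolP ws /=.
rewrite (@gstep_loop _ n (lpt n) i s (le i) ws) addn1 exprSr scalerA; congr (_ *: base _ _).
  by rewrite mulrA mulrC.
apply: gstep_id; first exact: wfL.
exact: (@gstep_loop _ n (lpt n) i s (le i) ws).
Qed.

Let opL_adj (i j : 'I_n.+1) v : adjD i j -> opL i (opL j (opL i v)) = opL i v.
Proof.
move=> ij; rewrite /opL mono_comp ?mono_comp; [|exact: wfL..].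
apply: eq_mono => s ws; have [E l1 l2] := gstep_zigzag (@lpt_inj n) (le i) (le j) ij ws.
by rewrite /= l1 l2 !addn0.
Qed.

Let opL_comm (i j : 'I_n.+1) v : i != j -> ~~ adjD i j -> opL i (opL j v) = opL j (opL i v).
Proof.
move=> ij nij; rewrite /opL !mono_comp; [|exact: wfL..].
by apply: eq_mono => s ws /=; have [-> ->] := gstep_comm (@lpt_inj n) (le i) (le j) ij nij ws.
Qed.

(** The image of the identity diagram: its coordinates are those of x in the
    diagram basis. *)
Definition phi (x : TLD q n) : M := act opL x (base F (id_state n)).

Lemma phi_lin c x y : phi (c *: x + y) = c *: phi x + phi y.
Proof. exact: act_linl. Qed.

Lemma phi0 : phi 0 = 0.
Proof. exact: lin0 phi_lin. Qed.

Lemma phiD x y : phi (x + y) = phi x + phi y.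
Proof. exact: linD phi_lin x y. Qed.

Lemma phiZ c x : phi (c *: x) = c *: phi x.
Proof. exact: linZ phi_lin c x. Qed.

Lemma phi_word w : phi (word q w) = delta ^+ word_loops w *: base F (word_state w).
Proof.
rewrite /phi act_wordE //; elim: w => [|i w IH]; first by rewrite expr0 scale1r.
rewrite [LHS]/= IH /opL monoZ mono_base; last exact: word_state_wf.
by rewrite scalerA exprD.
Qed.

Lemma phi1 : phi 1 = base F (id_state n).
Proof. by have := phi_word [::]; rewrite word_nil expr0 scale1r. Qed.

Section Positive.
Hypothesis n0 : (0 < n)%N.

Lemma phi_good x s : phi x s != 0 -> good s.
Proof.
move=> xs; apply: contrapT => gs; move/negP: xs; apply.
apply/eqP; move: x; apply: (TLD_ext (V := F^o) (f := fun x => phi x s) (g := fun _ => 0)).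
- by move=> c x y; rewrite phi_lin !ffunE.
- by move=> c x y; rewrite scaler0 addr0.
move=> w; rewrite phi_word !ffunE; case: eqP => [E|_]; last by rewrite scaler0.
by case: gs; rewrite E; exact: word_state_good.
Qed.

Lemma word_state_id i w : word_state (i :: w) <> id_state n.
Proof.
move=> /(congr1 (fun s : state (point n) => s.1)).
have := @cup_at _ (word_state w) (lpt n (maxn i 1).-1) (lpt n (maxn i 1)) (i == 0 :> nat).
rewrite -[cup _ _ _ _]/(word_state (i :: w)) => at1 E; move: at1.
rewrite E /= ffunE /lpt rev_ordK => /(congr1 val) /=.
by have lei := le i; rewrite !inordK; lia.
Qed.

(** The identity diagram has no cup, whereas words of positive length have one. *)
Lemma phi_id x : phi x (id_state n) = eps x.
Proof.
move: x; apply: (TLD_ext (V := F^o) (f := fun x => phi x (id_state n))).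
- by move=> c x y; rewrite phi_lin !ffunE.
- exact: eps_lin.
case=> [|i w]; first by rewrite word_nil phi1 eps1 ffunE eqxx.
rewrite phi_word eps_word !ffunE eq_sym.
by rewrite (introF eqP (@word_state_id i w)) scaler0.
Qed.

Let opLR i j v : (j <= n)%N -> opL i (opR j v) = opR j (opL i v).
Proof.
move=> jn; rewrite /opL /opR !mono_comp; [|by move=> s; exact: wfL|by move=> s; exact: wfR].
apply: eq_mono => s ws /=.
have [-> ->] // := @gstep_disjoint _ (lpt n) (rpt n) n i j s
  (fun k l => @lpt_rpt n k l n0) (@lpt_inj n) (@rpt_inj n) (le i) jn ws.
Qed.

Lemma act_opR (x : TLD q n) j v : (j <= n)%N -> act opL x (opR j v) = opR j (act opL x v).
Proof.
move=> jn; move: x; apply: (TLD_ext (f := fun x => act opL x (opR j v))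
  (g := fun x => opR j (act opL x v))).
- by move=> c x y; exact: act_linl.
- move=> c x y; rewrite act_linl //; exact: mono_lin.
move=> w; rewrite 2!(act_wordE opL_lin opL_sq opL_adj opL_comm); elim: w => [|i w IH]; first by [].
by rewrite [LHS]/= IH opLR.
Qed.

(** The identity diagram does not tell left from right multiplication, and right
    multiplication commutes with the action. *)
Lemma phi_mulr x (j : nat) : (j <= n)%N -> phi (x * gen_nat q n j) = opR j (phi x).
Proof.
move=> jn; rewrite /phi actM // act_gen // /opL inordK // mono_base; last exact: id_wf.
have [-> -> r] := gen_id n0 jn; rewrite -act_opR //; congr act.
by rewrite /opR mono_base ?r //; exact: id_wf.
Qed.

End Positive.

End Phi.

(** * Multiplication by the words of the clasp *)

Section Push.
Variables (F : fieldType) (T U : finType).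

(** The linear extension of g, the states which are not well formed being sent
    to 0. *)
Definition push (g : state T -> state U) (v : {ffun state T -> F^o}) : {ffun state U -> F^o} :=
  \sum_(s | `[< wf_state s >]) v s *: base F (g s).

Lemma push_lin g c u v : push g (c *: u + v) = c *: push g u + push g v.
Proof.
rewrite scaler_sumr -big_split /=; apply: eq_bigr => s _.
by rewrite !ffunE scalerDl scalerA.
Qed.

Lemma push_base g s : wf_state s -> push g (base F s) = base F (g s).
Proof.
move=> ws; rewrite /push (bigD1 s) /=; last exact/asboolP.
rewrite big1 ?addr0 => [|x /andP[_ xs]]; first by rewrite ffunE eqxx scale1r.
by rewrite ffunE (negPf xs) scale0r.
Qed.

Lemma pushE g v x : push g v x = \sum_(s | `[< wf_state s >]) v s * (x == g s)%:R.
Proof. by rewrite /push sum_ffunE; apply: eq_bigr => s _; rewrite !ffunE. Qed.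

Lemma push_at g v s : injective g -> wf_state s -> push g v (g s) = v s.
Proof.
move=> gi ws; rewrite pushE (bigD1 s) /=; last exact/asboolP.
rewrite eqxx mulr1 big1 ?addr0 // => x /andP[_ xs].
by rewrite (inj_eq gi) eq_sym (negPf xs) mulr0.
Qed.

Lemma push_out g v x : (forall s, wf_state s -> g s <> x) -> push g v x = 0.
Proof.
move=> H; rewrite pushE big1 // => s /asboolP /H gs.
by rewrite eq_sym (introF eqP gs) mulr0.
Qed.

Lemma mono_push (delta : F) k h g g' v :
  (forall s, wf_state s -> wf_state (g s)) ->
  (forall s, wf_state s -> h (g s) = g' s /\ k (g s) = 0%N) ->
  mono delta k h (push g v) = push g' v.
Proof.
move=> wg hg; rewrite {1}/push (big_morph _ (monoD delta k h) (mono0 delta k h)).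
apply: eq_bigr => s /asboolP ws; have [E1 E2] := hg s ws.
by rewrite monoZ mono_base ?E1 ?E2 ?expr0 ?scale1r //; exact: wg.
Qed.

Lemma push0 g : push g 0 = 0.
Proof. exact: lin0 (push_lin g). Qed.

Lemma pushD g u v : push g (u + v) = push g u + push g v.
Proof. exact: linD (push_lin g) u v. Qed.

Lemma pushZ g c v : push g (c *: v) = c *: push g v.
Proof. exact: linZ (push_lin g) c v. Qed.

Lemma push_mono (delta : F) k h g v : (forall s, wf_state s -> wf_state (h s)) ->
  push g (mono delta k h v) = \sum_(s | `[< wf_state s >]) (v s * delta ^+ k s) *: base F (g (h s)).
Proof.
move=> wh; rewrite {1}/mono (big_morph _ (pushD g) (push0 g)).
by apply: eq_bigr => s /asboolP ws; rewrite pushZ push_base //; exact: wh.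
Qed.

End Push.

Section Transfer.
Variables (F : fieldType) (q : F) (m : nat).
Local Notation n := m.+1.
Local Notation delta := (- qint q 2).
Local Notation e := (gen_nat q n).

(** What E_0 does to the rest of a diagram with a cap at position 1: it becomes
    odd, and a loop is closed if it was odd before. *)
Definition oddify (v : {ffun state (point m) -> F^o}) : {ffun state (point m) -> F^o} :=
  mono delta (fun s => s.2 == None : nat) (fun s => (s.1, None)) v.

Lemma phi_incl (x : TLD q m) : (0 < m)%N -> phi (incl n x) = push (insc m.+2) (phi x).
Proof.
move=> m0; move: x; apply: (TLD_ext (f := fun x => phi (incl n x))
  (g := fun x => push (insc m.+2) (phi x))).
- by move=> c x y; rewrite incl_lin // phi_lin.
- by move=> c x y; rewrite phi_lin push_lin.
move=> w; rewrite (incl_word q (leqnSn m) w).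
have -> : map (widen_ord (leqnSn m : m < m.+2)%N) w = map (widen_ord (leqnSn m.+1)) w.
  by apply: eq_map => i; apply: val_inj.
have [s l] := @word_state_widen m w m0.
rewrite phi_word s l (phi_word q w) pushZ push_base //; exact: word_state_wf.
Qed.

(** The image of the identity under the inclusion in rank m + 1, with the
    convention that rank 0 is the trivial algebra. *)
Definition phi_prefix (P : TLD q m) : {ffun state (point m) -> F^o} :=
  if m == 0%N then base F (id_state m) else phi P.

Lemma phi_clasp_prefix P : phi (clasp_prefix P) = push (insc m.+2) (phi_prefix P).
Proof.
rewrite /clasp_prefix /phi_prefix; have [m0|m0] := eqVneq m 0%N.
  by rewrite phi1 push_base ?insc_top_id //; exact: id_wf.
by rewrite phi_incl // lt0n.
Qed.

Section Runs.
Variables (X : TLD q n) (v : {ffun state (point m) -> F^o}).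
Hypothesis Xv : phi X = push (insc m.+2) v.

(** Multiplying by E_n, ..., E_i moves the strand added on the right to a cap at
    position i. *)
Lemma phi_run i : (0 < i <= m.+2)%N -> phi (X * run n e i) = push (insc i) v.
Proof.
move=> il; have [k ik] : exists k, (i = m.+2 - k)%N by exists (m.+2 - i)%N; lia.
rewrite {}ik in il *; elim: k il => [|k IH] il.
  by rewrite subn0 run_top mulr1.
rewrite runS; last lia.
rewrite mulrA phi_mulr //; last lia.
rewrite (_ : (m.+2 - k.+1).+1 = m.+2 - k)%N; last lia.
rewrite IH; last lia.
apply: mono_push => s ws; first by apply: insc_wf => //; lia.
rewrite (_ : (m.+2 - k) = (m.+2 - k.+1).+1)%N; last lia.
by have [-> ->] := @rstep_insc m (m.+2 - k.+1) s ltac:(lia) ws.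
Qed.

Lemma phi_run0 : phi (X * run0 n e) = opR q 0 (push (insc 2) v).
Proof. by rewrite /run0 mulrA phi_mulr // phi_run. Qed.

(** The cap comes down to position 1, where E_0 makes the diagram odd, and climbs
    up again to position i. *)
Lemma phi_odd_run i : (0 < i <= m.+1)%N -> phi (X * odd_run n e i) = push (insc i) (oddify v).
Proof.
case: i => // i; elim: i => [|i IH] il.
  rewrite /odd_run /= mulr1 mulrA phi_mulr // phi_run //.
  rewrite push_mono; last by move=> s [wc _]; split.
  rewrite /opR {1}/push (big_morph _ (monoD delta _ _) (mono0 delta _ _)).
  apply: eq_bigr => s /asboolP ws; rewrite monoZ mono_base; last exact: insc_wf.
  by have [-> ->] := rstep0_insc1 s; rewrite scalerA.
rewrite odd_runS // mulrA phi_mulr ?IH //; last lia.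
apply: mono_push => s ws; first by apply: insc_wf => //; lia.
by have [-> ->] := @rstep_insc_up m i.+1 s isT ltac:(lia) ws.
Qed.

End Runs.

(** In an odd diagram every innermost cap counts as undotted, since the last dot
    may be moved away from it. *)
Lemma odd_insc i (c : conn n) : (0 < i < n.*2.+2)%N -> wf_conn c -> innermost c i ->
  (c, None) = insc i (delete_cap c i, None) /\ wf_conn (delete_cap c i).
Proof.
move=> il wc inn; have wcN : wf_state ((c, None) : state (point n)) by split.
have [//|[c' ot] E /= ws'] := @innermost_insc m i (c, None) il wcN inn.
have -> : delete_cap c i = c' by have := delete_insc (c', ot) il; rewrite -E.
by case: ot E => // t [].
Qed.

Lemma push_odd i (v : {ffun state (point m) -> F^o}) (c : conn n) : (0 < i < n.*2.+2)%N -> wf_conn c ->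
  push (insc i) v (c, None) = if innermost c i then v (delete_cap c i, None) else 0.
Proof.
move=> il wc; case: ifP => [inn|ninn].
  have [E wd] := odd_insc il wc inn; rewrite E; apply: push_at; first exact: insc_inj.
  by split.
by apply: push_out => s _ E; have := insc_innermost s il; rewrite E /= ninn.
Qed.

(** For odd diagrams, E_n ... E_2 E_0 does the same as E_n ... E_2 E_1. *)
Lemma push_odd_run0 (v : {ffun state (point m) -> F^o}) (c : conn n) : wf_conn c ->
  opR q 0 (push (insc 2) v) (c, None) = push (insc 1) v (c, None).
Proof.
move=> wc; rewrite /opR (@mono_push _ _ _ _ _ _ _ (fun s => gstep (rpt n) 0 (insc 2 s))).
- rewrite 2!pushE; apply: eq_bigr => -[c' ot] /asboolP[/= wc' _]; congr (_ * _).
  case: ot => [t|]; last by rewrite rstep0_insc2_odd.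
  have := @rstep0_insc2_even m (c', Some t) isT.
  by case: (gstep _ _ _) => c'' [t'|] // _; rewrite !xpair_eqE /= !andbF.
- by move=> s ws; apply: insc_wf.
- by move=> s ws; rewrite rstep0_insc2_loop.
Qed.

(** All dottings of the diagram with the cap deleted contribute. *)
Lemma push_oddify i (v : {ffun state (point m) -> F^o}) (c : conn n) : (0 < i < n.*2.+2)%N -> wf_conn c ->
  push (insc i) (oddify v) (c, None) =
  if innermost c i then
    \sum_(s : state (point m) | `[< wf_state s >] && (s.1 == delete_cap c i))
      v s * delta ^+ (s.2 == None)
  else 0.
Proof.
move=> il wc; rewrite push_mono; last by move=> s [ws _]; split.
rewrite sum_ffunE; case: ifP => [inn|ninn]; last first.
  apply: big1 => s _; rewrite !ffunE; case: (_ =P insc _ _) => [E|_]; last by rewrite scaler0.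
  by have := insc_innermost (s.1, None) il; rewrite -E /= ninn.
have [E wd] := odd_insc il wc inn; rewrite [RHS]big_mkcondr; apply: eq_bigr => s _.
rewrite !ffunE {1}E (inj_eq (insc_inj il)) xpair_eqE eqxx andbT [s.1 == _]eq_sym.
by case: (_ == s.1); [exact: mulr1 | exact: mulr0].
Qed.

End Transfer.

(** * Injectivity *)

Section HairpinRun.
Variables (F : fieldType) (A : algType F) (e : nat -> A).

Lemma down_conj n k : (k <= n)%N -> down n.+1 e k.+1 = e n.+1 * down n e k.
Proof.
elim: k => [|k IH] kn; first by rewrite /= subn0 mul1r mulr1.
rewrite [LHS]/= -/(down n.+1 e k.+1) IH; last exact: ltnW.
by rewrite subSS [in RHS]/= mulrA.
Qed.

Lemma odd_run_hairpin n : (0 < n)%N -> odd_run n e n = hairpin e n.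
Proof.
case: n => // n _; elim: n => [|n IH]; first by rewrite /odd_run /run /= mul1r mulr1.
rewrite hairpinS // -IH /odd_run /run !subn1 !succnK down_conj //=.
by rewrite !mulrA.
Qed.
End HairpinRun.

Section Injectivity.
Variables (F : fieldType) (q : F).
Hypothesis q_neq0 : q != 0.
Hypothesis qint_neq0 : forall m, (0 < m)%N -> qint q m != 0.

Lemma sub_alg_top n (x : TLD q n) : sub_alg (gen_nat q n) n x.
Proof.
elim/TLD_ind: x => [|c w x IH]; first exact: sub_alg0.
apply: sub_alg_lin IH; elim: w => [|i w IHw]; first by rewrite word_nil; exact: sub_alg1.
by rewrite word_cons -gen_nat_val; apply: sub_alg_gen => //; rewrite -ltnS.
Qed.

Lemma sub_alg_incl m n (y : TLD q n) : (m <= n)%N -> sub_alg (gen_nat q n) m y ->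
  exists x : TLD q m, y = incl n x.
Proof.
move=> mn; elim=> [|c u v _ [x ->] _ [z ->]|i u im _ [x ->]].
- by exists 1; rewrite incl1.
- by exists (c *: x + z); rewrite incl_lin.
- exists (gen_nat q m i * x); have := incl_gen q mn (inord i); rewrite inordK // => <-.
  exact: esym (inclM mn (gen_nat q m i) x).
Qed.

(** An element killed on the right by all generators is a multiple of the
    projector, so it vanishes as soon as its augmentation does. *)
Lemma right_null n (x : TLD q n) : eps x = 0 -> (forall i, x * genE i = 0) -> x = 0.
Proof.
move=> x0 xk; have [Q1 Q0] := projector_is_jw q_neq0 qint_neq0 n.
have := absorb (projector q n) xk; rewrite Q1 scale1r => E.
have := absorb_l x (fun i => proj1 (Q0 i)); rewrite x0 scale0r => E'.
exact: etrans (esym E) E'.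
Qed.

Section Step.
Variable n : nat.
Hypothesis n0 : (0 < n)%N.

Lemma phi_mulr0 (x : TLD q n) j : (j <= n)%N -> phi x = 0 -> phi (x * gen_nat q n j) = 0.
Proof. by move=> jn x0; rewrite (phi_mulr n0 x jn) x0; exact: mono0. Qed.

(** The kernel of phi is stable under right multiplication; if it is killed by
    one generator, then, as e_j = e_j e_i e_j for adjacent i and j, by the next. *)
Lemma kernel_spread i j : (i <= n)%N -> (j <= n)%N -> adjD i j ->
  (forall x : TLD q n, phi x = 0 -> x * gen_nat q n i = 0) ->
  forall x : TLD q n, phi x = 0 -> x * gen_nat q n j = 0.
Proof.
move=> iln jln ij K x x0; rewrite -(@gen_nat_adj _ q n j i) //; last first.
  by move: ij; rewrite /adjD orbC.
have E := K _ (phi_mulr0 jln x0).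
have -> : x * (gen_nat q n j * gen_nat q n i * gen_nat q n j) =
          (x * gen_nat q n j * gen_nat q n i) * gen_nat q n j.
  by rewrite !mulrA.
exact: etrans (congr1 (fun z => z * gen_nat q n j) E) (mul0r _).
Qed.

Lemma kernel_null : (1 < n)%N ->
  (forall x : TLD q n, phi x = 0 -> x * gen_nat q n n = 0) ->
  forall x : TLD q n, phi x = 0 -> x = 0.
Proof.
move=> n1 K; have Kj j : (0 < j <= n)%N -> forall x : TLD q n, phi x = 0 -> x * gen_nat q n j = 0.
  move=> jl; have [k jk] : exists k, (j = n - k)%N by exists (n - j)%N; lia.
  rewrite {}jk in jl *; elim: k jl => [|k IH] jl; first by rewrite subn0.
  apply: (@kernel_spread (n - k)); [lia|lia| |by apply: IH; lia].
  adj_lia.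
have K0 : forall x : TLD q n, phi x = 0 -> x * gen_nat q n 0 = 0.
  by apply: (@kernel_spread 2 0 n1 isT isT); apply: Kj; rewrite n1.
move=> x x0; apply: right_null; first by rewrite -(phi_id n0) x0 ffunE.
move=> i; rewrite -gen_nat_val; have [->|i0] := posnP i; first exact: K0.
by apply: Kj => //; rewrite i0 -ltnS ltn_ord.
Qed.

End Step.

(** In rank 1 the algebra is spanned by 1, E_0, E_1 and E_0 E_1, whose diagrams are
    the identity, the dotted and the undotted cap-cup pair and the odd diagram. *)
Lemma phi_inj1 (x : TLD q 1) : phi x = 0 -> x = 0.
Proof.
have [a [b [c [f ->]]]] := sub_alg_rank1 (@gen_nat_sq _ q 1)
  (@gen_nat_comm _ q 1) (leqnn 1) (sub_alg_top x).
pose s i := gstep (lpt 1) i (id_state 1).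
have sE i : (i <= 1)%N -> word_state [:: inord i : 'I_2] = s i by move=> i1; rewrite /= inordK.
have [l0 l1] : gloop (lpt 1) 0 (id_state 1) = false /\ gloop (lpt 1) 1 (id_state 1) = false.
  by case: (@gen_id 1 0 isT isT) => _ -> _; case: (@gen_id 1 1 isT isT) => _ -> _.
have pe i : (i <= 1)%N -> phi (gen_nat q 1 i) = base F (s i).
  move=> i1; have := phi_word q [:: inord i : 'I_2].
  rewrite word_cons word_nil mulr1 -/(gen_nat q 1 i) => ->.
  rewrite sE // /= inordK //; case: i i1 => [|[|]] // _; rewrite ?l0 ?l1; exact: scale1r.
have nab : (conn1 1 (lpt 1 0) == lpt 1 1) = false.
  by move: l1; rewrite /gloop /loop /= [X in _ && (X == _)]ffunE eqxx andbT.
have st i : (i <= 1)%N -> exists2 t, (s i).2 = Some t & t (lpt 1 0) = (i == 0%N).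
  case: i => [|[|]] // _; rewrite /s /gstep /cup /dots_after /= nab;
    by eexists; [reflexivity | rewrite ffunE eqxx].
have [t0 e0 d0] := st 0%N isT; have [t1 e1 d1] := st 1%N isT.
pose s01 := gstep (lpt 1) 0 (s 1).
have s01N : s01.2 = None.
  rewrite /s01 /gstep /cup /dots_after (_ : (s 1).1 _ = lpt 1 1) ?eqxx ?e1 ?d1 //.
  exact: cup_at.
have p01 : phi (gen_nat q 1 0 * gen_nat q 1 1) = base F s01.
  have := phi_word q [:: inord 0 : 'I_2; inord 1].
  rewrite 2!word_cons word_nil mulr1 -!/(gen_nat q 1 _) => ->.
  rewrite [word_state _]/= -[gstep _ _ _]/(gstep (lpt 1) (inord 0 : 'I_2) (word_state [:: inord 1 : 'I_2])).
  rewrite sE // [word_loops _]/= -[gstep _ _ _]/(word_state [:: inord 1 : 'I_2]) sE // !inordK //.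
  rewrite l1 /gloop /loop (_ : (s 1).1 _ = lpt 1 1); last exact: cup_at.
  by rewrite e1 d1 !eqxx; exact: scale1r.
have P4 (u v w z : TLD q 1) : phi (a *: u + b *: v + c *: w + f *: z) =
    a *: phi u + b *: phi v + c *: phi w + f *: phi z.
  by rewrite phiD phiD phiD; congr (_ + _); [congr (_ + _); [congr (_ + _)|]|]; exact: phiZ.
rewrite (P4 1 (gen_nat q 1 0) (gen_nat q 1 1)) p01 (pe 0 isT) (pe 1 isT) phi1 => H.
have ev y : a * (y == id_state 1)%:R + b * (y == s 0)%:R + c * (y == s 1)%:R + f * (y == s01)%:R = 0.
  by have := congr1 (fun v : {ffun _ -> F^o} => v y) H; rewrite !ffunE.
have ne (u v : state (point 1)) : u <> v -> (u == v) = false by move=> uv; apply/eqP.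
have idN i : (i <= 1)%N -> s i <> id_state 1.
  by move=> i1; rewrite -sE //; exact: word_state_id.
have n01 : s 0 <> s 1 by move=> E; move: e1 d0 d1; rewrite -E e0 => -[<-] ->.
have n0N i : (i <= 1)%N -> s i <> s01 by case/st => t E _ E'; move: E; rewrite E' s01N.
have idN1 : id_state 1 <> s01 by move=> E; move: s01N; rewrite -E.
have := ev s01; have := ev (s 1); have := ev (s 0); have := ev (id_state 1).
rewrite !eqxx !(ne _ _ idN1, ne _ _ (nesym idN1), ne _ _ (idN 0 isT), ne _ _ (idN 1 isT),
  ne _ _ (nesym (idN 0 isT)), ne _ _ (nesym (idN 1 isT)), ne _ _ n01, ne _ _ (nesym n01),
  ne _ _ (n0N 0 isT), ne _ _ (n0N 1 isT), ne _ _ (nesym (n0N 0 isT)), ne _ _ (nesym (n0N 1 isT))).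
rewrite !mulr0 !mulr1 !add0r !addr0 => -> -> -> ->.
by rewrite 4!scale0r 3!addr0.
Qed.

Section InductionStep.
Variable m : nat.
Hypothesis m0 : (0 < m)%N.
Hypothesis IH : forall y : TLD q m, phi y = 0 -> y = 0.
Local Notation n := m.+1.
Local Notation e := (gen_nat q n).

(** The hairpin is odd_run n, whose prefix is the identity. *)
Lemma phi_hairpin : phi (hairpin e n) = push (insc n) (base F (conn1 m, None)).
Proof.
have X1 : phi (1 : TLD q n) = push (insc m.+2) (base F (id_state m)).
  by rewrite phi1 push_base ?insc_top_id //; exact: id_wf.
have := phi_odd_run X1 (i := n); rewrite odd_run_hairpin // mul1r ltnSn.
move=> -> //; congr push; rewrite /oddify mono_base; last exact: id_wf.
by rewrite scale1r.
Qed.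

(** Write x E_n = y E_n + c z_n, with the hairpin z_n. The diagrams of y E_n are
    those of y with a cap inserted at position n, and z_n is this cap inserted in
    an odd identity connectivity, which is no diagram of rank m. Hence c = 0, and
    y = 0 by induction. *)
Lemma kernel_top (x : TLD q n) : phi x = 0 -> x * e n = 0.
Proof.
move=> x0; have [||y [c [sy E]]] := @sub_alg_left_ideal F (- qint q 2) _ n e
  (@gen_nat_sq _ q n) (@gen_nat_adj _ q n) (@gen_nat_comm _ q n) n x.
- by rewrite leqnn andbT ltnS.
- exact: sub_alg_top.
have [y' Ey] := sub_alg_incl (leqnSn m) sy; rewrite {}Ey {sy y} in E.
have R : phi (incl n y' * e n) = push (insc n) (phi y').
  have := phi_run (phi_incl y' m0) (i := n); rewrite runS // run_top mul1r; apply.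
  by rewrite leqnSn.
have := phi_mulr0 (ltn0Sn m) (leqnn n) x0; rewrite E phiD phiZ R phi_hairpin => P0.
have il : (0 < n < n.*2.+2)%N by rewrite -addnn; lia.
have ev s : wf_state s -> phi y' s + c * (s == (conn1 m, None))%:R = 0.
  move=> ws; have := congr1 (fun v : {ffun _ -> F^o} => v (insc n s)) P0.
  rewrite -pushZ -pushD push_at //; last exact: insc_inj.
  by rewrite !ffunE.
have bad s : ~ good s -> phi y' s = 0.
  by move=> gs; apply/eqP/negPn/negP => /(phi_good m0).
have c0 : c = 0.
  have := ev (conn1 m, None); rewrite eqxx mulr1 bad ?add0r => [|[_ /=]]; last exact.
  by apply; split=> //; exact: conn1_wf.
have y0 : y' = 0.
  apply: IH; apply/ffunP => s; rewrite ffunE.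
  have [gs|/bad //] := pselect (good s).
  by have := ev s; rewrite c0 mul0r addr0; apply; case: gs => [[]].
by rewrite c0 y0 (incl0 _ (leqnSn m)) mul0r scale0r addr0.
Qed.

Lemma phi_inj_step (x : TLD q n) : phi x = 0 -> x = 0.
Proof. by apply: (kernel_null (ltn0Sn m)); [rewrite ltnS | exact: kernel_top]. Qed.

End InductionStep.

Lemma phi_inj n (x : TLD q n) : (0 < n)%N -> phi x = 0 -> x = 0.
Proof.
elim: n x => // -[|n] IH x _; first exact: phi_inj1.
by apply: phi_inj_step => // y; exact: IH.
Qed.

End Injectivity.

(** * Coordinates in the basis of reduced words *)

Lemma clasp_linear (F : fieldType) (q : F) (A : algType F) (V : lmodType F) n (e : nat -> A)
    (f : A -> V) X : (forall c x y, f (c *: x + y) = c *: f x + f y) ->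
  f (X * clasp q n e) =
    \sum_(2 <= i < n.+2) coefg q n i *: f (X * run n e i)
    + coefg q n 1 *: (f (X * run n e 1) + f (X * run0 n e))
    + \sum_(1 <= i < n.+1) coefh q n i *: f (X * odd_run n e i).
Proof.
move=> fL; have f0 := lin0 fL; have fD := linD fL; have fZ := linZ fL.
have fS a b (g : nat -> F) (x : nat -> A) :
    f (X * \sum_(a <= i < b) g i *: x i) = \sum_(a <= i < b) g i *: f (X * x i).
  rewrite mulr_sumr (big_morph f fD f0); apply: eq_bigr => i _.
  by rewrite -scalerAr fZ.
by rewrite /clasp !mulrDr !fD !fS -scalerAr fZ mulrDr fD.
Qed.

Lemma scale_trans (K : pzRingType) (V : lmodType K) (x y z : V) a b :
  x = a *: y -> y = b *: z -> x = (a * b) *: z.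
Proof. by move=> -> ->; rewrite scalerA. Qed.

Section Basis.
Variables (F : fieldType) (q : F).
Hypothesis q_neq0 : q != 0.
Hypothesis qint_neq0 : forall m, (0 < m)%N -> qint q m != 0.
Local Notation delta := (- qint q 2).

Let delta0 : delta != 0. Proof. by rewrite oppr_eq0 qint_neq0. Qed.

Lemma reduced_behead n (i : 'I_n.+1) w : reduced q (i :: w) -> reduced q w.
Proof.
move=> red w' c sz E; apply: (red (i :: w') c sz).
by rewrite 2!word_cons E scalerAr.
Qed.

Lemma reduce n (w : seq 'I_n.+1) :
  exists (w' : seq 'I_n.+1) c, reduced q w' /\ word q w = c *: word q w'.
Proof.
have [k] := ubnP (size w); elim: k w => // k IH w wk.
have [red|] := pselect (reduced q w).
  by exists w, 1; split; [exact: red | rewrite scale1r].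
move=> /existsNP[w' /existsNP[c /not_implyP[sz /contrapT E]]].
have [|w0 [c0 [red E0]]] := IH w'; first exact: leq_trans sz _.
exists w0, (c * c0); split; first exact: red.
exact: scale_trans E E0.
Qed.

Section Rank.
Variable n : nat.
Hypothesis n0 : (0 < n)%N.

Lemma phi_eq (x y : TLD q n) : phi x = phi y -> x = y.
Proof.
move=> E; have H : -1 *: y + x = 0.
  apply: (phi_inj q_neq0 qint_neq0 n0).
  by apply: etrans (phi_lin (-1) y x) _; rewrite E scaleN1r addNr.
by move: H; rewrite scaleN1r addrC => /eqP; rewrite subr_eq0 => /eqP.
Qed.

(** By injectivity of phi, a word which closes a loop is a multiple of a shorter
    word. *)
Lemma reduced_loops (w : seq 'I_n.+1) : reduced q w -> word_loops w = 0%N.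
Proof.
elim: w => // i w IH red; have l0 := IH (reduced_behead red).
rewrite [word_loops _]/= l0; apply/eqP; rewrite eqb0; apply/negP => l.
apply: (red w delta (leqnn _)); apply: phi_eq.
apply: etrans (phi_word q (i :: w)) _.
apply: etrans (esym (phiZ delta (word q w))).
rewrite (phi_word q w) l0 expr0 scale1r [word_loops _]/= l0 l expr1.
congr (_ *: base F _); apply: (@gstep_id _ (lpt n) i (word_state w)) => //.
exact: word_state_wf.
Qed.

Lemma reduced_phi (w : seq 'I_n.+1) : reduced q w ->
  phi (word q w) = base F (word_state w) /\ word_diag w = diag_of (word_state w).
Proof.
move=> /reduced_loops l0; split; last exact: word_diag_state.
by rewrite phi_word l0 expr0 scale1r.
Qed.

(** Reducing a word keeps its diagram, since phi sends words to nonzero multiples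
    of their diagrams. *)
Lemma reduced_exists (s : state (point n)) : good s ->
  exists2 w : seq 'I_n.+1, reduced q w & word_state w = s.
Proof.
move=> gs; have [w ws] := good_reach gs; have [w' [c [red E]]] := reduce w.
exists w' => //; apply/eqP; move: (congr1 (fun x => phi x s) E).
rewrite (phiZ c) (proj1 (reduced_phi red)) phi_word ws !ffunE eqxx [s == _]eq_sym.
case: eqP => // _; rewrite mulr0n scaler0 => /eqP.
by rewrite [_ *: _]mulr1 expf_eq0 (negPf delta0) andbF.
Qed.

Lemma basis_phi (s : state (point n)) : good s -> phi (basis_elt q (diag_of s)) = base F s.
Proof.
move=> gs; have [w red ws] := reduced_exists gs.
pose P (x : TLD q n) := exists w, [/\ reduced q w, word_diag w = diag_of s & x = word q w].
have ex : exists x, P x.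
  exists (word q w), w; split; [exact: red | | exact: erefl].
  by rewrite (proj2 (reduced_phi red)) ws.
have [w' [red' D' Ew]] : P (basis_elt q (diag_of s)) := classical_sets.xgetPex 0 ex.
rewrite Ew; have [-> E] := reduced_phi red'; congr base.
by apply: diag_of_inj => //; [exact: word_state_good | rewrite -E].
Qed.

Lemma coords_phi (f : diag n -> F) (s : state (point n)) :
  phi (\sum_(D : diag n | typeD D) f D *: basis_elt q D) s =
  if `[< good s >] then f (diag_of s) else 0.
Proof.
rewrite (big_morph _ (@phiD _ q n) (phi0 q n)) sum_ffunE.
rewrite (eq_bigr (fun D => f D * (`[< good s >] && (D == diag_of s))%:R)).
  case: asboolP => [gs|_]; last by rewrite big1 // => D _; rewrite mulr0.
  rewrite (bigD1 (diag_of s)) ?diag_of_typeD //= eqxx mulr1 big1 ?addr0 // => D /andP[_ Ds].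
  by rewrite (negPf Ds) mulr0.
move=> D /typeD_diag_of [s' gs' <-]; rewrite phiZ basis_phi // !ffunE; congr (_ * (nat_of_bool _)%:R).
case: asboolP => [gs|gs] /=; last by apply/eqP => E; rewrite E in gs.
by apply/eqP/eqP => [->|] //; move/(diag_of_inj gs' gs).
Qed.

(** By injectivity of phi the coordinates of phi x are coordinates of x in the
    basis, and they are the only ones. *)
Lemma coef_phi (s : state (point n)) : good s ->
  coef q n (diag_of s) = phi (projector q n) s.
Proof.
move=> gs; rewrite /coef eqn0Ngt n0 /=.
pose x := projector q n.
pose st D := odflt (id_state n) [pick s : state (point n) | `[< good s >] && (diag_of s == D)].
have ex : exists f, is_coords x f.
  exists [ffun D => phi x (st D)]; apply: phi_eq; apply/ffunP => s'.
  rewrite coords_phi ffunE; case: asboolP => [gs'|gs'].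
    rewrite /st; case: pickP => [s2 /andP[/asboolP gs2 /eqP E]|/(_ s')] /=.
      by rewrite (diag_of_inj gs2 gs' E).
    by rewrite eqxx andbT => /asboolP.
  by apply/eqP/negPn/negP => /(phi_good n0).
have E := classical_sets.xgetPex (0 : {ffun diag n -> F}) ex.
have := congr1 (fun y => phi y s) E; rewrite coords_phi asboolT //.
Qed.

End Rank.

End Basis.

(** * The recursion for odd diagrams *)

(** The encodings of the diagrams in even_diags, the identity connectivity being
    no exception. *)
Definition even_states m (c : conn m) : {set state (point m)} :=
  [set s | [&& `[< good s >], s.1 == c & s.2 != None]].

Lemma even_diags_states m (c : conn m) : planar ((c, None) : state (point m)) ->
  even_diags c = [set diag_of s | s in even_states c].
Proof.
move=> pc; rewrite /even_diags; have [->|c1] := eqVneq c (conn1 m).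
  apply/setP => D; rewrite inE; apply/eqP/imsetP => [->|[s]].
    exists (id_state m); first by rewrite inE eqxx andbT asboolT //; exact: id_good.
    by congr pair; apply/setP => p; rewrite !inE [X in _ && X]ffunE andbF.
  rewrite inE => /and3P[/asboolP gs /eqP s1 _] ->.
  by rewrite (good_conn1 gs s1); congr pair; apply/setP => p; rewrite !inE [X in _ && X]ffunE andbF.
apply/setP => D; rewrite inE; apply/and3P/imsetP => [[/typeD_diag_of [s gs <-] /eqP s1 ev]|[s]].
  exists s => //; rewrite inE asboolT //= -s1 eqxx /=; apply/eqP => s2.
  by move: ev; rewrite /diag_of s2 /= cards1.
rewrite inE => /and3P[/asboolP gs /eqP s1 s2] ->; split.
- exact: diag_of_typeD.
- exact/eqP.
have [[_ _ dots] _] := gs; rewrite /diag_of; case: s {gs} s1 s2 dots => c' [t|] //= _ _ dots.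
by rewrite card_dots; case: (dots t erefl).
Qed.

Section Coefficient.
Variables (F : fieldType) (q : F).
Hypothesis q_neq0 : q != 0.
Hypothesis qint_neq0 : forall m, (0 < m)%N -> qint q m != 0.
Local Notation delta := (- qint q 2).
Variable m : nat.
Local Notation n := m.+1.
Local Notation v := (phi_prefix (projector q m)).

Lemma phi_prefix_pos : (0 < m)%N -> v = phi (projector q m).
Proof. by rewrite /phi_prefix; case: (m). Qed.

Lemma phi_prefix0 : m = 0%N -> v = base F (id_state m).
Proof. by rewrite /phi_prefix => ->. Qed.

Lemma coef_prefix (s : state (point m)) : good s -> coef q m (diag_of s) = v s.
Proof.
move=> gs; have [m0|m0] := posnP m; last by rewrite phi_prefix_pos // coef_phi.
rewrite phi_prefix0 // /coef (introT eqP m0).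
have {gs} -> : s = id_state m.
  apply: good_conn1 => //; case: gs => [[[wc _] _ _] _].
  by clear -m0 wc; case: m m0 s wc => // _ s; exact: conn_point0.
by rewrite ffunE eqxx.
Qed.

Lemma prefix_good s : v s != 0 -> good s.
Proof.
have [m0|m0] := posnP m; last by rewrite phi_prefix_pos //; exact: phi_good.
have [-> _|si] := eqVneq s (id_state m); first exact: id_good.
rewrite phi_prefix0 // ffunE (negPf si).
by rewrite eqxx.
Qed.

Lemma prefix_odd (c : conn m) : planar ((c, None) : state (point m)) ->
  v (c, None) = oapp (coef q m) 0 (odd_diag c).
Proof.
move=> pc; rewrite /odd_diag; have [->|/eqP c1] := eqVneq c (conn1 m).
  by apply/eqP/negPn/negP => /prefix_good [_ /(_ erefl)].
by rewrite /= -coef_prefix.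
Qed.

(** Even diagrams contribute their coefficient, and the odd one closes a loop. *)
Lemma prefix_even (c : conn m) : planar ((c, None) : state (point m)) ->
  \sum_(s : state (point m) | `[< wf_state s >] && (s.1 == c)) v s * delta ^+ (s.2 == None) =
  \sum_(D in even_diags c) coef q m D - qint q 2 * v (c, None).
Proof.
move=> pc; rewrite (bigD1 (c, None)) /=; last first.
  by rewrite eqxx andbT; apply/asboolP; case: pc.
rewrite expr1 mulrN mulrC addrC; congr (_ - _).
rewrite even_diags_states // big_imset /=; last first.
  move=> s s'; rewrite !inE => /and3P[/asboolP gs _ _] /and3P[/asboolP gs' _ _].
  exact: diag_of_inj.
have -> : \sum_(s in even_states c) coef q m (diag_of s) = \sum_(s in even_states c) v s.
  by apply: eq_bigr => s; rewrite inE => /and3P[/asboolP gs _ _]; rewrite coef_prefix.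
rewrite [LHS]big_mkcond [RHS]big_mkcond; apply: eq_bigr => s _; rewrite inE.
have [gs|gs] := asboolP (good s); last first.
  have -> : v s = 0 by apply/eqP/negPn/negP => /prefix_good.
  by rewrite mul0r !if_same.
rewrite (_ : `[< wf_state s >]); last by apply/asboolP; case: gs => [[]].
case: s {gs} => c' ot /=; have [->|_] //= := eqVneq c' c.
by rewrite xpair_eqE eqxx; case: ot => [t|] //=; rewrite mulr1.
Qed.

(** Both dottings of the last cap-cup pair contribute at position 1, whence the
    factor 2; at position n + 1 the h-term vanishes. *)
Lemma clasp_sums (inn : pred nat) (r h w u : nat -> F^o) (r0 : F^o) :
  (forall i, (0 < i < n.+2)%N -> r i = if inn i then w i else 0) ->
  r0 = (if inn 1%N then w 1%N else 0) ->
  (forall i, (0 < i < n.+1)%N -> h i = if inn i then u i else 0) ->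
  \sum_(2 <= i < n.+2) coefg q n i *: r i + coefg q n 1 *: (r 1%N + r0)
    + \sum_(1 <= i < n.+1) coefh q n i *: h i =
  \sum_(1 <= i < n.+2 | inn i) coefh q n i * u i
    + \sum_(1 <= i < n.+2 | inn i) 2 ^+ (i == 1)%N * coefg q n i * w i.
Proof.
move=> R -> H; rewrite addrC; congr (_ + _).
  rewrite [RHS]big_mkcond big_nat_recr //= coefh_top mul0r if_same addr0.
  rewrite [LHS]big_nat_cond [RHS]big_nat_cond; apply: eq_bigr => i /andP[il _].
  by rewrite H //; case: ifP => _; [exact: erefl | exact: mulr0].
rewrite [RHS]big_mkcond big_ltn //= addrC R //; congr (_ + _); last first.
  case: (inn 1%N); last by rewrite addr0; exact: mulr0.
  by rewrite -[LHS]/(_ * _) -[X in _ * X]mulr2n mulr_natl mulrnAr mulrnAl.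
rewrite [LHS]big_nat_cond [RHS]big_nat_cond; apply: eq_bigr => i /andP[il _].
rewrite R; last by lia.
rewrite (_ : (i == 1)%N = false); last by lia.
by case: ifP => _; [rewrite mul1r | exact: mulr0].
Qed.

(** The coefficient at an odd diagram in each term of Q_(n-1) R, where R is the
    clasp, is that of the diagrams obtained by deleting an innermost cap. *)
Lemma coef_odd (c : conn n) : good ((c, None) : state (point n)) ->
  coef q n (diag_of (c, None)) =
    \sum_(1 <= i < n.+2 | innermost c i)
       coefh q n i *
         (\sum_(D' in even_diags (delete_cap c i)) coef q m D'
          - qint q 2 * oapp (coef q m) 0 (odd_diag (delete_cap c i)))
    + \sum_(1 <= i < n.+2 | innermost c i)
       2 ^+ (i == 1)%N * coefg q n i *
         oapp (coef q m) 0 (odd_diag (delete_cap c i)).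
Proof.
move=> gc; have [[[/= wc _] nc _] _] := gc.
have pl i : (0 < i < n.+2)%N -> innermost c i ->
    planar ((delete_cap c i, None) : state (point m)).
  move=> il inn; have il' : (0 < i < n.*2.+2)%N by rewrite -addnn; lia.
  have [E wd] := odd_insc il' wc inn.
  by apply: (@insc_planar m i il') => //; rewrite -E; case: gc.
have Pv := phi_clasp_prefix (projector q m).
pose X := clasp_prefix (projector q m); pose at_c (x : TLD q n) : F^o := phi x (c, None).
pose w i := oapp (coef q m) 0 (odd_diag (delete_cap c i)).
pose u i := \sum_(D in even_diags (delete_cap c i)) coef q m D - qint q 2 * w i.
have range i : (0 < i < n.+2)%N -> (0 < i < n.*2.+2)%N by rewrite -addnn; lia.
have R i : (0 < i < n.+2)%N ->
    at_c (X * run n (gen_nat q n) i) = if innermost c i then w i else 0.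
  move=> il; rewrite /at_c (phi_run Pv il) push_odd //; last exact: range.
  by case: ifP => // inn; exact/prefix_odd/pl.
have R0 : at_c (X * run0 n (gen_nat q n)) = if innermost c 1 then w 1%N else 0.
  by rewrite /at_c (phi_run0 Pv) push_odd_run0 // -(R 1%N isT) -(phi_run Pv).
have H i : (0 < i < n.+1)%N ->
    at_c (X * odd_run n (gen_nat q n) i) = if innermost c i then u i else 0.
  move=> il; rewrite /at_c (phi_odd_run Pv il) push_oddify //; last by apply: range; lia.
  have il' : (0 < i < n.+2)%N by lia.
  by case: ifP => // inn; rewrite prefix_even ?prefix_odd //; exact: pl.
rewrite coef_phi // projector_rec //.
have lin : forall c x y, at_c (c *: x + y) = c *: at_c x + at_c y.
  by move=> k x y; rewrite /at_c phi_lin !ffunE.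
exact: etrans (clasp_linear (V := F^o) q n (gen_nat q n) X lin) (clasp_sums R R0 H).
Qed.

End Coefficient.

(** * The generic parameter *)

Section Indeterminate.
Variable K : fieldType.
Local Notation q := (tofrac 'X : {fraction {poly K}}).

Lemma indet_neq0 : q != 0.
Proof. by rewrite tofrac_eq0 polyX_eq0. Qed.

(** Otherwise the powers of the indeterminate of degrees 2 m and 0 would agree. *)
Lemma indet_exp_neq m : (0 < m)%N -> q ^+ m - q ^- m != 0.
Proof.
move=> m0; rewrite subr_eq0; apply/eqP => E.
have : q ^+ m * q ^+ m = 1 by rewrite {1}E mulVf // expf_neq0 // indet_neq0.
rewrite -exprD -tofracXn => /eqP; rewrite -tofrac1 tofrac_eq => /eqP /(congr1 (fun p : {poly K} => size p)).
rewrite size_polyXn size_poly1; lia.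
Qed.

Lemma qint_indet_neq0 m : (0 < m)%N -> qint q m != 0.
Proof.
move=> m0; rewrite /qint mulf_neq0 ?indet_exp_neq // invr_neq0 //.
exact: (indet_exp_neq (m := 1)).
Qed.

End Indeterminate.

Theorem proposition3p10 (R : realType) (n : nat) (hn : (1 <= n)%N)
    (D : diag n) (hD : typeD D) (hD1 : #|D.2| = 1%N) :
  let q : {fraction {poly R[i]}} := tofrac 'X in
  coef q n D =
    \sum_(1 <= i < n.+2 | innermost D.1 i)
       coefh q n i *
         (\sum_(D' in even_diags (delete_cap D.1 i)) coef q n.-1 D'
          - qint q 2 * oapp (coef q n.-1) 0 (odd_diag (delete_cap D.1 i)))
    + \sum_(1 <= i < n.+2 | innermost D.1 i)
       2 ^+ (i == 1)%N * coefg q n i *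
         oapp (coef q n.-1) 0 (odd_diag (delete_cap D.1 i)).
Proof.
move=> q; case: n hn D hD hD1 => // m _ D hD hD1.
have [[c [t|]] gs E] := typeD_diag_of hD; last first.
  rewrite -E; exact: (coef_odd (indet_neq0 _) (@qint_indet_neq0 _) gs).
have [[_ _ dots] _] := gs; have [_] := dots t erefl.
by rewrite -card_dots -[[set p | _]]/((diag_of (c, Some t)).2) E hD1.
Qed.
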